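(* Let $n\ge3$. For $(\alpha,\beta;\varpi;\lambda,\nu)\in\{\pm\}^2\times\mathrm{Irr}(SL(n-1,\mathbb R))_{\mathrm{fin}}\times\mathbb C^2$, $$\mathrm{Diff}_{G'}(I(\mathrm{triv},\lambda)^\alpha,J(\varpi,\nu)^\beta)=\begin{cases}\mathbb C\,\mathbb D_{(m,0)}&\text{if }(\alpha,\beta;\varpi;\lambda,\nu)\in\Lambda_1,\\ \mathbb C\,\mathbb D_{(m,\ell)}&\text{if }(\alpha,\beta;\varpi;\lambda,\nu)\in\Lambda_2,\\ \{0\}&\text{otherwise,}\end{cases}$$ where $$\Lambda_1=\{(\alpha,\alpha+m;\mathrm{triv};\lambda,\lambda+m):\alpha\in\{\pm\},\ \lambda\in\mathbb C,\ m\in\mathbb Z_{\ge0}\},$$ $$\Lambda_2=\{(\alpha,\alpha+m+\ell;\mathrm{poly}^\ell_{n-1};1-(m+\ell),1+\tfrac{\ell}{n-1}):\alpha\in\{\pm\},\ \ell,m\in\mathbb Z_{\ge0}\},$$ and $m$ (resp. $m,\ell$) are the integers occurring in the description of the parameter as an element of $\Lambda_1$ (resp. $\Lambda_2$).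
   Context: Groups: $G=SL(n+1,\mathbb R)$, $G'=\{\mathrm{diag}(g',1):g'\in SL(n,\mathbb R)\}\subset G$. With matrix units $E_{i,j}$ put $N_j^+=E_{1,j+1}$, $N_j^-=E_{j+1,1}$ ($1\le j\le n$), $\widetilde H_0=\frac1n\mathrm{diag}(n,-1,\dots,-1)$, $\widetilde H_0'=\frac1{n-1}\mathrm{diag}(n-1,-1,\dots,-1,0)$. Let $N_\pm=\exp(\mathrm{span}_{\mathbb R}\{N_1^\pm,\dots,N_n^\pm\})$, $N'_\pm=\exp(\mathrm{span}_{\mathbb R}\{N_1^\pm,\dots,N_{n-1}^\pm\})$, $A=\exp(\mathbb R\widetilde H_0)$, $A'=\exp(\mathbb R\widetilde H_0')$, $M=\{\mathrm{diag}(\det(g)^{-1},g):g\in SL^\pm(n,\mathbb R)\}$, $M'=\{\mathrm{diag}(\det(g')^{-1},g',1):g'\in SL^\pm(n-1,\mathbb R)\}$, where $SL^\pm(k,\mathbb R)$ is the group of real $k\times k$ matrices of determinant $\pm1$. Then $P=MAN_+$ and $P'=M'A'N_+'$ are parabolic subgroups with $G/P\simeq\mathbb{RP}^n$, $G'/P'\simeq\mathbb{RP}^{n-1}$, $P'\subset P$. Signs: $\{\pm\}\equiv\{\pm1\}$; for $\delta\in\{\pm\}$, $k\in\mathbb Z_{\ge0}$, $\delta+k$ denotes the sign $\delta\cdot(-1)^k$. Representations: $\mathrm{Irr}(\cdot)_{\mathrm{fin}}$ is the set of equivalence classes of finite-dimensional irreducible complex representations. $\mathbb C_\lambda$ is the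 character $\exp(t\widetilde H_0)\mapsto e^{\lambda t}$ of $A$ and $\mathbb C_\nu$ the character $\exp(t\widetilde H_0')\mapsto e^{\nu t}$ of $A'$. $\mathrm{sgn}^+=1$, $\mathrm{sgn}^-=\mathrm{sgn}(\det)$ on $SL^\pm$. Elements of $\mathrm{Irr}(M')_{\mathrm{fin}}$, $M'\simeq SL^\pm(n-1,\mathbb R)$, are written $\mathrm{sgn}^\beta\otimes\varpi$ with $\varpi\in\mathrm{Irr}(SL(n-1,\mathbb R))_{\mathrm{fin}}$ (extended to $SL^\pm(n-1,\mathbb R)$). $\mathrm{poly}^\ell_{n-1}$ is the representation on $\mathbb C^\ell[y_1,\dots,y_{n-1}]$, the homogeneous degree-$\ell$ polynomials on $\mathbb C^{n-1}$, extended to $SL^\pm(n-1,\mathbb R)$ by $(g\cdot p)(v)=p(g^{-1}v)$. $I(\mathrm{triv},\lambda)^\alpha=\mathrm{Ind}_P^G(\mathrm{sgn}^\alpha\boxtimes\mathbb C_\lambda)$ and $J(\varpi,\nu)^\beta=\mathrm{Ind}_{P'}^{G'}((\mathrm{sgn}^\beta\otimes\varpi)\boxtimes\mathbb C_\nu)$ are unnormalized smooth induced representations ($N_+,N_+'$ acting trivially): $\mathrm{Ind}_P^G(\sigma)=\{f\in C^\infty(G,V):f(gp)=\sigma(p)^{-1}f(g)\ \forall p\in P\}$ with left translation, realized on sections of bundles over $G/P$, $G'/P'$. $\mathrm{Diff}_{G'}(I,J)$ is the space of $G'$-intertwining differential operators $I\to J$, where, for the inclusion $\iota:G'/P'\hookrightarrow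 G/P$, a continuous linear map $\mathbb D$ between smooth sections is a differential operator if $\iota(\mathrm{Supp}(\mathbb Df))\subset\mathrm{Supp}(f)$ for all $f$. Coordinates: via $\mathbb R^n\simeq N_-$, $x\mapsto\exp(\sum_{j=1}^nx_jN_j^-)$, and $\mathbb R^{n-1}=\{x_n=0\}\simeq N_-'$, restriction to $N_-$ and $N'_-$ embeds $I(\mathrm{triv},\lambda)^\alpha\subset C^\infty(\mathbb R^n)$ and $J(\varpi,\nu)^\beta\subset C^\infty(\mathbb R^{n-1})\otimes W$ ($W$ the space of $\varpi$), and differential symmetry breaking operators are written as operators between these function spaces. For $\ell\in\mathbb Z_{\ge0}$ let $\Xi'_\ell=\{\mathbf l=(\ell_1,\dots,\ell_{n-1})\in(\mathbb Z_{\ge0})^{n-1}:\sum\ell_j=\ell\}$, $\widetilde y_{\mathbf l}=\frac{1}{\ell_1!\cdots\ell_{n-1}!}y_1^{\ell_1}\cdots y_{n-1}^{\ell_{n-1}}$, $\frac{\partial^\ell}{\partial x^{\mathbf l}}=\frac{\partial^\ell}{\partial x_1^{\ell_1}\cdots\partial x_{n-1}^{\ell_{n-1}}}$, and $(\mathrm{Rest}_{x_n=0}f)(x')=f(x',0)$. Define $\mathbb D_{(m,\ell)}:C^\infty(\mathbb R^n)\to C^\infty(\mathbb R^{n-1})\otimes\mathbb C^\ell[y_1,\dots,y_{n-1}]$ by $$\mathbb D_{(m,\ell)}=\mathrm{Rest}_{x_n=0}\circ\frac{\partial^m}{\partial x_n^m}\sum_{\mathbf l\in\Xi'_\ell}\frac{\partial^\ell}{\partial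 x^{\mathbf l}}\otimes\widetilde y_{\mathbf l},\qquad \mathbb D_{(m,0)}=\mathrm{Rest}_{x_n=0}\circ\frac{\partial^m}{\partial x_n^m}.$$ *)

(* Defs.v *)
From mathcomp Require Import all_boot all_order all_algebra.
From mathcomp Require Import all_classical all_reals all_analysis.
From mathcomp Require Import complex.
From mathcomp Require mpoly.
(* The notations of mpoly clash with those of the analysis library. *)
Import -(notations) mpoly.

Set Implicit Arguments.
Unset Strict Implicit.
Unset Printing Implicit Defensive.

Import Order.TTheory GRing.Theory Num.Theory.
Import numFieldNormedType.Exports.

Local Open Scope classical_set_scope.
Local Open Scope complex_scope.
Local Open Scope ring_scope.

(* A sign is a boolean, [true] standing for the sign -; so [delta (+) odd k]
   is the sign delta + k. *)

Section Smooth.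
Variables (R : realType) (V : normedModType R).

Definition iterD (w : seq V) (F : V -> R) : V -> R :=
  foldr (fun v (F' : V -> R) => fun x => 'D_v F' x) F w.

(* For an open set U, this is the C^oo condition on U. *)
Definition smooth_real (U : set V) (F : V -> R) : Prop :=
  forall (w : seq V) (x : V), U x ->
    {for x, continuous (iterD w F)} /\
    forall v : V, derivable (iterD w F) x v.

(* The maps Re o phi are the real linear forms on W. *)
Definition smooth_on (W : vectType R[i]) (U : set V) (F : V -> W) : Prop :=
  forall phi : 'Hom(W, R[i]^o),
    smooth_real U (fun x => complex.Re (phi (F x))).

Definition iterDC (w : seq V) (F : V -> R[i]) (x : V) : R[i] :=
  iterD w (fun y => complex.Re (F y)) x +i*
  iterD w (fun y => complex.Im (F y)) x.

End Smooth.

Section Groups.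
Variable R : realType.

Definition SL (k : nat) : set 'M[R]_k := [set g | \det g = 1].
Definition SLpm (k : nat) : set 'M[R]_k :=
  [set g | \det g = 1 \/ \det g = -1].

Definition expmx (k : nat) (A : 'M[R]_k.+1) : 'M[R]_k.+1 :=
  \matrix_(i, j) limn (series (fun r => (A ^+ r) i j / (r`!)%:R)).

Definition diag_last1 (k : nat) (g : 'M[R]_k) : 'M[R]_k.+1 :=
  castmx (addn1 k, addn1 k) (block_mx g 0 0 1%:M).
Definition diag_first (k : nat) (a : R) (g : 'M[R]_k) : 'M[R]_k.+1 :=
  block_mx (a%:M : 'M[R]_1) 0 0 g.

(* The elements below live in SL(k+1, R).  For k = n they give P = M A N_+ and
   N_-; for k = n - 1 and after g' |-> diag(g', 1), they give P' = M' A' N'_+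
   and N'_-.  Accordingly G' is identified with SL(n, R). *)
Definition H0 (k : nat) : 'M[R]_k.+1 :=
  (k%:R)^-1 *: diag_mx (\row_(j < k.+1) (if j == ord0 then k%:R else -1)).
Definition Nplus (k : nat) (j : 'I_k) : 'M[R]_k.+1 :=
  delta_mx ord0 (lift ord0 j).
Definition Nminus (k : nat) (j : 'I_k) : 'M[R]_k.+1 :=
  delta_mx (lift ord0 j) ord0.

Definition m_elt (k : nat) (g : 'M[R]_k) : 'M[R]_k.+1 :=
  diag_first (\det g)^-1 g.
Definition a_elt (k : nat) (t : R) : 'M[R]_k.+1 := expmx (t *: H0 k).
Definition nplus (k : nat) (x : 'rV[R]_k) : 'M[R]_k.+1 :=
  expmx (\sum_j x ord0 j *: Nplus j).
Definition nminus (k : nat) (x : 'rV[R]_k) : 'M[R]_k.+1 :=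
  expmx (\sum_j x ord0 j *: Nminus j).

End Groups.
Arguments SL {R} k.
Arguments SLpm {R} k.

Section Representations.
Variable R : realType.

(* A representation of SL^{+-}(k, R) on W is a function of matrices of which
   only the values on SL^{+-}(k, R) matter. *)
Definition is_rep (k : nat) (W : vectType R[i]) (rho : 'M[R]_k -> W -> W) :
    Prop :=
  [/\ forall g, SLpm k g -> linear (rho g),
      forall w, rho 1%:M w = w,
      forall g h, SLpm k g -> SLpm k h ->
        forall w, rho (g *m h) w = rho g (rho h w)
    & forall (w : W) (phi : 'Hom(W, R[i]^o)),
        {within SLpm k, continuous (fun g => complex.Re (phi (rho g w)))}].

Definition irreducible_on (k : nat) (H : set 'M[R]_k) (W : vectType R[i])
    (rho : 'M[R]_k -> W -> W) : Prop :=
  {:W}%VS <> 0%VS /\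
  forall U : {vspace W},
    (forall g, H g -> forall w, w \in U -> rho g w \in U) ->
    U = 0%VS \/ U = {:W}%VS.

Definition rep_equiv (k : nat) (H : set 'M[R]_k) (V W : lmodType R[i])
    (rho : 'M[R]_k -> V -> V) (tau : 'M[R]_k -> W -> W)
    (phi : {linear V -> W}) : Prop :=
  bijective phi /\ forall g, H g -> forall v, phi (rho g v) = tau g (phi v).

Definition triv_rep (k : nat) (g : 'M[R]_k) (z : R[i]^o) : R[i]^o := z.

Definition sgn_twist (k : nat) (alpha : bool) (W : lmodType R[i])
    (rho : 'M[R]_k -> W -> W) (g : 'M[R]_k) (w : W) : W :=
  (Num.sg (\det g))%:C ^+ alpha *: rho g w.

(* y_i |-> sum_j (g^-1)_ij y_j, so that the value at v is p(g^-1 v) *)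
Definition poly_act (k : nat) (g : 'M[R]_k) (p : mpoly k R[i]) : mpoly k R[i] :=
  comp_mpoly [tuple \sum_j (invmx g i j)%:C *: mpolyX R[i] (mnm1 j) | i < k] p.

Lemma poly_act_dhomog (k l : nat) (g : 'M[R]_k) (p : dhomog k R[i] l) :
  poly_act g p \is ishomog1 l mdeg.
Proof.
have dX i : tnth [tuple \sum_j (invmx g i j)%:C *: mpolyX R[i] (mnm1 j)
    | i < k] i \is ishomog1 1 mdeg.
  rewrite tnth_mktuple; apply: rpred_sum => j _; apply: rpredZ.
  by rewrite dhomogX; apply/eqP; exact: mdeg1.
rewrite /poly_act comp_mpolyE big_seq; apply: rpred_sum => m mp.
apply: rpredZ.
have -> : l = (\sum_(i < k) 1 * m i)%N.
  have /dhomogP/(_ m mp)<- := dhomog_is_dhomog p.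
  by rewrite /= mdegE; apply: eq_bigr => i _; rewrite mul1n.
elim/big_rec2: _ => [|i d q _ dq]; first exact: dhomog1.
by apply: dhomogM => //; apply: dhomogMn.
Qed.

Definition poly_rep (k l : nat) (g : 'M[R]_k) (p : dhomog k R[i] l) :
    dhomog k R[i] l :=
  DHomog (poly_act_dhomog g p).

End Representations.

Section Induced.
Variable R : realType.

Definition cexp (z : R[i]) : R[i] :=
  (expR (complex.Re z))%:C * (cos (complex.Im z) +i* sin (complex.Im z)).

(* SL(k, R) is a submanifold of the space of matrices: a function on it is
   smooth iff it is locally the restriction of a smooth function. *)
Definition smooth_on_SL (k : nat) (W : vectType R[i]) (f : 'M[R]_k -> W) :
    Prop :=
  forall g, SL k g -> exists (U : set 'M[R]_k) (F : 'M[R]_k -> W),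
    [/\ open U, U g, smooth_on U F & forall h, U h -> SL k h -> F h = f h].

(* The sections of Ind_P^G(sigma [x] C_lambda), for G = SL(k+1, R).  A function
   on G is encoded by its extension by zero to all matrices. *)
Definition Ind (k : nat) (W : vectType R[i]) (sigma : 'M[R]_k -> W -> W)
    (lambda : R[i]) : set ('M[R]_k.+1 -> W) :=
  [set f | [/\ forall g, ~ SL k.+1 g -> f g = 0,
      smooth_on_SL f
    & forall g, SL k.+1 g -> forall (m : 'M[R]_k) (t : R) (x : 'rV[R]_k),
        SLpm k m ->
        f (g *m (m_elt m *m a_elt k t *m nplus x)) =
          cexp (- (lambda * t%:C)) *: sigma (invmx m) (f g)]].

Definition ltrans (k : nat) (W : Type) (h : 'M[R]_k) (f : 'M[R]_k -> W) :
    'M[R]_k -> W :=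
  fun g => f (invmx h *m g).

(* In SL(k+1, R); it is the preimage of the support in G/P, because G -> G/P
   is open. *)
Definition supp (k : nat) (W : vectType R[i]) (f : 'M[R]_k -> W) :
    set 'M[R]_k :=
  closure [set g | f g != 0].

(* The topology of Ind is that of smooth sections over G/P: uniform convergence
   on compact sets of all derivatives in the charts x |-> h exp(x) P, h in G,
   which cover G/P. *)
Record seminorm_index (k : nat) (W : vectType R[i]) := SeminormIndex {
  si_base : 'M[R]_k.+1;
  si_baseP : SL k.+1 si_base;
  si_set : set 'rV[R]_k;
  si_compact : compact si_set;
  si_dirs : seq 'rV[R]_k;
  si_form : 'Hom(W, R[i]^o)
}.

Definition seminorm_lt (k : nat) (W : vectType R[i]) (s : seminorm_index k W)
    (f : 'M[R]_k.+1 -> W) (e : R) : Prop :=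
  forall x, si_set s x ->
    `| iterD (si_dirs s)
        (fun y => complex.Re (si_form s (f (si_base s *m nminus y)))) x | < e.

Definition continuous_op (k k' : nat) (V W : vectType R[i])
    (I : set ('M[R]_k.+1 -> V))
    (D : ('M[R]_k.+1 -> V) -> 'M[R]_k'.+1 -> W) : Prop :=
  forall (s' : seminorm_index k' W) (e : R), 0 < e ->
  exists (N : nat) (s : 'I_N -> seminorm_index k V) (d : R), 0 < d /\
    forall f, I f -> (forall i, seminorm_lt (s i) f d) ->
      seminorm_lt s' (D f) e.

(* [Diff I J] with I and J spaces of sections over G/P and G'/P'; two operators
   that agree on I represent the same element. *)
Definition Diff (p : nat) (V W : vectType R[i])
    (I : set ('M[R]_p.+2 -> V)) (J : set ('M[R]_p.+1 -> W))
    (D : ('M[R]_p.+2 -> V) -> 'M[R]_p.+1 -> W) : Prop :=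
  [/\ forall f, I f -> J (D f),
      forall (c : R[i]) f h, I f -> I h ->
        D (fun g => c *: f g + h g) = (fun g => c *: D f g + D h g),
      continuous_op I D,
      forall f, I f -> forall g, SL p.+1 g -> supp (D f) g ->
        supp f (diag_last1 g)
    & forall f, I f -> forall h, SL p.+1 h ->
        D (ltrans (diag_last1 h) f) = ltrans h (D f)].

Definition I_triv (n : nat) (alpha : bool) (lambda : R[i]) :
    set ('M[R]_n.+1 -> R[i]^o) :=
  Ind (sgn_twist alpha (@triv_rep R n)) lambda.

Definition J_rep (p : nat) (W : vectType R[i]) (varpi : 'M[R]_p -> W -> W)
    (nu : R[i]) (beta : bool) : set ('M[R]_p.+1 -> W) :=
  Ind (sgn_twist beta varpi) nu.

End Induced.

(* Here p = n - 1. *)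
Section Operators.
Variables (R : realType) (p : nat).

Definition append0 (x : 'rV[R]_p) : 'rV[R]_p.+1 :=
  castmx (erefl, addn1 p) (row_mx x 0).

Definition dir (j : 'I_p.+1) : 'rV[R]_p.+1 := delta_mx 0 j.
Definition dirs_xn (m : nat) : seq 'rV[R]_p.+1 := nseq m (dir ord_max).
Definition dirs_x' (l : 'I_p -> nat) : seq 'rV[R]_p.+1 :=
  flatten [seq nseq (l j) (dir (lift ord_max j)) | j <- enum 'I_p].

Definition ytilde (l : 'I_p -> nat) : mpoly p R[i] :=
  ((\prod_j (l j)`!)%:R)^-1 *: \prod_j mpolyX R[i] (mnm1 j) ^+ l j.

Lemma ytilde_dhomog (l : 'I_p -> nat) :
  ytilde l \is ishomog1 (\sum_j l j)%N mdeg.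
Proof.
rewrite rpredZ //; elim/big_rec2: _ => [|i d q _ dq]; first exact: dhomog1.
apply: dhomogM => //; rewrite -[d in ishomog1 d]mul1n; apply: dhomogMn.
by rewrite dhomogX; apply/eqP; exact: mdeg1.
Qed.

Definition D_m0 (m : nat) (f : 'rV[R]_p.+1 -> R[i]) (x' : 'rV[R]_p) : R[i]^o :=
  iterDC (dirs_xn m) f (append0 x').

(* [indhomog ell] only casts into the subtype of homogeneous polynomials of
   degree ell: its argument is homogeneous by [ytilde_dhomog]. *)
Definition D_ml (m ell : nat) (f : 'rV[R]_p.+1 -> R[i]) (x' : 'rV[R]_p) :
    dhomog p R[i] ell :=
  \sum_(l : {ffun 'I_p -> 'I_ell.+1} | (\sum_j l j)%N == ell)
    iterDC (dirs_xn m ++ dirs_x' (fun j => l j)) f (append0 x') *: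
      indhomog ell (ytilde (fun j => l j)).

(* Diff(I, J) = C.DD, where DD is an operator in the coordinates of N_- and
   N'_-; in particular DD maps I to J. *)
Definition Diff_is_line (W : vectType R[i])
    (I : set ('M[R]_p.+2 -> R[i]^o)) (J : set ('M[R]_p.+1 -> W))
    (DD : ('rV[R]_p.+1 -> R[i]) -> 'rV[R]_p -> W) : Prop :=
  exists D0 : ('M[R]_p.+2 -> R[i]^o) -> 'M[R]_p.+1 -> W,
    (forall f, I f -> forall x',
       D0 f (nminus x') = DD (fun x => f (nminus x)) x') /\
    forall D, Diff I J D <->
      exists c : R[i], forall f, I f -> forall g, D f g = c *: D0 f g.

Definition Diff_is_zero (W : vectType R[i])
    (I : set ('M[R]_p.+2 -> R[i]^o)) (J : set ('M[R]_p.+1 -> W)) : Prop :=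
  forall D, Diff I J D <-> forall f, I f -> forall g, D f g = 0.

End Operators.

Section Params.
Variables (R : realType) (p : nat) (W : vectType R[i]).
Variable varpi : 'M[R]_p -> W -> W.

(* An irreducible representation of SL(p, R) together with an extension to
   SL^{+-}(p, R).  There are two extensions, differing by sgn(det); those of
   triv and of poly^l are the given ones. *)
Definition irr_ext : Prop :=
  [/\ is_rep varpi,
      irreducible_on (SL p) varpi,
      forall phi, rep_equiv (SL p) (@triv_rep R p) varpi phi ->
        rep_equiv (SLpm p) (@triv_rep R p) varpi phi
    & forall (ell : nat) phi,
        rep_equiv (SL p) (@poly_rep R p ell) varpi phi ->
        rep_equiv (SLpm p) (@poly_rep R p ell) varpi phi].

(* phi realises the equivalence of varpi with triv, resp. poly^ell, as
   representations of SL(p, R); it is unique up to a scalar. *)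
Definition Lambda1 (alpha beta : bool) (lambda nu : R[i]) (m : nat)
    (phi : {linear R[i]^o -> W}) : Prop :=
  [/\ beta = alpha (+) odd m,
      rep_equiv (SL p) (@triv_rep R p) varpi phi
    & nu = lambda + m%:R].

Definition Lambda2 (alpha beta : bool) (lambda nu : R[i]) (m ell : nat)
    (phi : {linear dhomog p R[i] ell -> W}) : Prop :=
  [/\ beta = alpha (+) odd (m + ell),
      rep_equiv (SL p) (@poly_rep R p ell) varpi phi,
      lambda = 1 - (m + ell)%:R
    & nu = 1 + ell%:R / p%:R].

End Params.

(* Main.v *)
Require Import Defs.
From mathcomp Require Import all_boot all_order all_algebra.
From mathcomp Require Import all_classical all_reals all_analysis.
From mathcomp Require Import complex.
From HB Require Import structures.
From mathcomp Require Import ring lra spectral.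
From mathcomp Require mpoly.
(* The notations of mpoly clash with those of the analysis library. *)
Import -(notations) mpoly.
(* [iterD] is also the name of a lemma of ssrnat. *)
Import Defs.

(* Write p = n - 1, T f := (D f)(1) for D in Diff(I, J), and regard f in I near
   1 as the function x |-> f(nminus x) of x = (x', x_n).

   Uniqueness.  By G'-equivariance D is determined by T, which is local, and
   A' acts on x by dilations with positive weights while multiplying T by
   exponentials; with the continuity of D this forces T to vanish on sections
   that are flat to a high order at 0, so T is given by its values on
   polynomials.  On a monomial of bidegree (l, m) in (x', x_n), the action of A'
   gives nu = lambda + m + l + l/p whenever T is nonzero; the invariance under
   N'_+ gives (lambda + d) T(x_j q) = 0 for q homogeneous of degree d, hence
   lambda = 1 - (m + l) if l > 0; and M' makes T an intertwiner from poly^l to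
   varpi, hence an isomorphism, unique up to a scalar, which exists for at most
   one l.

   Existence.  Translating the candidate by G' reduces everything to its
   equivariance at 1 under P'.  M'A' is a change of variables.  For N'_+
   the D_(m', l') with m' + l' = N make up the N-th derivatives along the lines
   s |-> s x, on which N'_+ acts by s |-> s / (1 + c s), and d^N/ds^N intertwines
   the weights 1 - N and 1 + N (Bol's lemma); if l = 0 only x = e_n matters, and
   then c = 0, so that lambda is arbitrary. *)

Set Implicit Arguments.
Unset Strict Implicit.
Unset Printing Implicit Defensive.

Import Order.TTheory GRing.Theory Num.Theory.
Import numFieldNormedType.Exports.

Local Open Scope classical_set_scope.
Local Open Scope ring_scope.
Local Open Scope complex_scope.

(** * Smooth functions *)

(** Sections live on all of G/P, polynomials only on the chart N_-; T is carried over to functions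
    on R^n by cut-off sections, and locality makes the result independent of the cut-off. Locality
    by itself gives no bound on the order of T: the bound comes from comparing the seminorms of
    dilated sections with the one exponential by which T changes.

    Both families are treated at once. The representation triv is poly^0, and for all (m, l) the
    conditions are nu = lambda + m + l + l/p together with l = 0 or lambda = 1 - (m + l). The degree
    l is read off from varpi and then m from nu, so a single operator spans the space.

    For existence, N'_- does not reach all of G'/P'. The candidate is therefore defined at each g of
    G' by D_(m, l) at the origin applied to the translated section: left equivariance is then
    automatic, and the right P'-equivariance remains.

    Smoothness is expressed by iterated directional derivatives, so the chain rule and the symmetry
    of derivatives are set up in that form. *)

Section LineDerivative.
Variables (R : realType) (V : normedModType R).
Implicit Types (F : V -> R) (x y v : V).

Lemma line_quotient F v y t :
  (fun h : R => h^-1 *: (F ((h *: (1 : R) + t) *: v + y) - F (t *: v + y))) =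
  (fun h : R => h^-1 *: (F (h *: v + (t *: v + y)) - F (t *: v + y))).
Proof.
by apply/funext => h /=; rewrite [h *: (1 : R)]mulr1 scalerDl addrA.
Qed.

(** The difference quotients of F along v at t v + y are those of s |-> F (s v + y) at t, so
    one-variable theorems carry over to directional derivatives. *)
Lemma is_derive_line F v y (t d : R) :
  is_derive (t *: v + y) v F d -> is_derive t 1 (fun s : R => F (s *: v + y)) d.
Proof.
move=> [dF <-]; split; last by rewrite /derive line_quotient.
by move: dF; rewrite /derivable line_quotient.
Qed.

Lemma derivable_line F v y (t : R) :
  derivable F (t *: v + y) v -> derivable (fun s : R => F (s *: v + y)) t 1.
Proof. by move=> dF; have /is_derive_line [] := derivableP dF. Qed.

Lemma MVT_line F v x :
  (forall t : R, 0 <= t <= 1 -> derivable F (t *: v + x) v) ->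
  exists2 t : R, 0 <= t <= 1 & F (v + x) - F x = 'D_v F (t *: v + x).
Proof.
move=> dF.
have [||t t01] :=
  @MVT_segment R (fun s : R => F (s *: v + x)) (fun s : R => 'D_v F (s *: v + x)) 0 1 ler01.
- move=> s /[!in_itv]/= /andP[t0 t1]; apply: is_derive_line.
  by apply: derivableP; apply: dF; rewrite !ltW.
- apply: derivable_within_continuous => s /[!in_itv]/= t01.
  by apply: derivable_line; exact: dF.
by rewrite scale1r scale0r add0r subr0 mulr1 => ->; exists t => //; rewrite in_itv in t01.
Qed.

(** The chain rule with t |-> c t along the line, instead of a rescaling of the quotient, also
    covers c = 0. *)
Lemma is_derive_scale_dir F x v (c d : R) :
  is_derive x v F d -> is_derive x (c *: v) F (c * d).
Proof.
move=> dF.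
have e0 : x = 0 *: v + x by rewrite scale0r add0r.
have := dF; rewrite e0 => /is_derive_line [g1 g2]; rewrite -e0.
set g := fun s : R => F (s *: v + x) in g1 g2.
have h1 : derivable (fun t : R => c * t) 0 1.
  by apply: derivableM; [exact: derivable_cst|exact: derivable_id].
have h2 : 'D_1 (fun t : R => c * t) 0 = c.
  by rewrite -derive1E derive1Ml; [rewrite derive1_id mulr1|exact: derivable_id].
have g1' : derivable g (c * 0) 1 by rewrite (mulr0 c); exact: g1.
have dg : differentiable g (c * 0) by exact/derivable1_diffP.
have gh : derivable (g \o (fun t : R => c * t)) 0 1.
  apply/derivable1_diffP; by apply: differentiable_comp => //; exact/derivable1_diffP.
have := derive1_comp h1 g1'; rewrite !derive1E h2 mulr0 g2 mulrC => <-.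
have E : (fun h : R => h^-1 *: (F (h *: (c *: v) + x) - F x)) =
  (fun h : R => h^-1 *: ((g \o (fun t => c * t)) (h *: (1 : R) + 0) -
     (g \o (fun t => c * t)) 0)).
  apply/funext => h; rewrite /g /= addr0 mulr0 scale0r add0r.
  by rewrite [h *: (1 : R)]mulr1 scalerA mulrC.
split; first by rewrite /derivable E.
by rewrite /derive E.
Qed.

End LineDerivative.

(** * Mean value theorem in coordinates and differentiability of C^1 functions *)

Section MeanValue.
Variables (R : realType) (m : nat).
Implicit Types (F : 'rV[R]_m -> R) (x h : 'rV[R]_m).

Definition partial_row h (s : seq 'I_m) : 'rV[R]_m :=
  \row_j (if j \in s then h 0 j else 0).

Lemma norm_partial_row h s : `|partial_row h s| <= `|h|.
Proof.
rewrite [leLHS]/Num.Def.normr/= mx_normrE; apply: bigmax_le => // -[i j] _ /=.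
rewrite mxE; case: ifP => _; last by rewrite normr0.
by rewrite [leRHS]/Num.Def.normr/= mx_normrE (le_bigmax _ _ (ord0, j)).
Qed.

Lemma partial_row_cons h i s : i \notin s ->
  partial_row h (i :: s) = h 0 i *: delta_mx 0 i + partial_row h s.
Proof.
move=> is_; apply/rowP => j; rewrite !mxE inE eqxx /=.
have [->|ji] := eqVneq j i; first by rewrite (negbTE is_) mulr1 addr0.
by rewrite mulr0 add0r.
Qed.

Lemma norm_segment (t : R) h h' (r : R) : 0 <= t <= 1 ->
  `|h| <= r -> `|h + h'| <= r -> `|t *: h + h'| <= r + r * 2.
Proof.
move=> /andP[t0 t1] hr hhr.
have h'r : `|h'| <= r * 2.
  have -> : h' = (h + h') - h by rewrite addrC addKr.
  by rewrite (le_trans (ler_normB _ _))// mulr_natr mulr2n lerD.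
rewrite (le_trans (ler_normD _ _))// lerD// normrZ ger0_norm//.
by rewrite (le_trans _ hr)// ler_piMl.
Qed.

Lemma norm_delta_mx_coord h i : `|h 0 i *: (delta_mx 0 i : 'rV[R]_m)| <= `|h|.
Proof.
have -> : h 0 i *: (delta_mx 0 i : 'rV[R]_m) = partial_row h [:: i].
  rewrite partial_row_cons //.
  suff -> : partial_row h [::] = 0 by rewrite addr0.
  by apply/rowP => j; rewrite !mxE.
exact: norm_partial_row.
Qed.

(** The coordinates in s are changed one at a time, each change being a step along a coordinate
    line, where the one-variable theorem applies. The constant 3 is the crude bound of
    [norm_segment]. *)
Lemma mean_value F x (r : R) h (s : seq 'I_m) : uniq s ->
  (forall y v, `|y - x| < r -> derivable F y v) -> 3 * `|h| < r ->
  exists xi : 'I_m -> 'rV[R]_m, (forall i, `|xi i - x| <= 3 * `|h|) /\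
    F (x + partial_row h s) - F x =
      \sum_(i <- s) h 0 i * 'D_(delta_mx 0 i) F (xi i).
Proof.
move=> + dF hr; elim: s => [_|i s ih /= /andP[is_ us]].
  exists (fun=> x); split=> [i|]; first by rewrite subrr normr0 mulr_ge0.
  rewrite big_nil; suff -> : partial_row h [::] = 0 by rewrite addr0 subrr.
  by apply/rowP => j; rewrite !mxE.
have [xi [xi1 xi2]] := ih us.
set w := h 0 i *: delta_mx 0 i : 'rV[R]_m.
have bd (t : R) : 0 <= t <= 1 -> `|t *: w + (x + partial_row h s) - x| <= 3 * `|h|.
  move=> t01; rewrite addrCA [x + _]addrC addrK.
  have := @norm_segment t w (partial_row h s) `|h| t01 (norm_delta_mx_coord _ _).
  rewrite -partial_row_cons // => /(_ (norm_partial_row _ _)).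
  by move=> H; apply: le_trans H _; lra.
have [|t t01 e] := @MVT_line _ _ F w (x + partial_row h s).
  by move=> t /bd bt; apply: dF; apply: le_lt_trans hr.
exists (fun j => if j == i then t *: w + (x + partial_row h s) else xi j); split.
  by move=> j; case: ifP => _; [exact: bd|].
rewrite big_cons eqxx partial_row_cons // addrCA -/w.
have -> : \sum_(j <- s) h 0 j * 'D_(delta_mx 0 j) F
    (if j == i then t *: w + (x + partial_row h s) else xi j) =
    \sum_(j <- s) h 0 j * 'D_(delta_mx 0 j) F (xi j).
  rewrite big_seq [RHS]big_seq; apply: eq_bigr => j js.
  by case: eqP => // ji; rewrite -ji js in is_.
have [_ <-] := @is_derive_scale_dir R _ F (t *: w + (x + partial_row h s))
  (delta_mx 0 i) (h 0 i) ('D_(delta_mx 0 i) F (t *: w + (x + partial_row h s)))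
  (derivableP (dF _ _ (le_lt_trans (bd t t01) hr))).
by rewrite -xi2 -/w -e subrKA.
Qed.

Lemma partial_row_enum h : partial_row h (enum 'I_m) = h.
Proof. by apply/rowP => j; rewrite mxE mem_enum. Qed.

Definition lin_form (c : 'I_m -> R) (h : 'rV[R]_m) : R := \sum_i h 0 i * c i.

Fact lin_form_is_linear c : linear (lin_form c).
Proof.
move=> a u v; rewrite /lin_form scaler_sumr -big_split /=.
by apply: eq_bigr => i _; rewrite !mxE mulrDl -mulrA.
Qed.

HB.instance Definition _ c := GRing.isLinear.Build R 'rV[R]_m R *:%R (lin_form c)
  (lin_form_is_linear c).

Lemma continuous_lin_form c : continuous (lin_form c).
Proof.
move=> x; apply: continuous_big; first by move=> ?; exact: add_continuous.
move=> i _ y.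
by apply: (@continuousM R 'rV[R]_m (fun z => z 0 i) (fun=> c i) y);
  [exact: coord_continuous|exact: cst_continuous].
Qed.

Lemma norm_coord_le h i : `|h 0 i| <= `|h|.
Proof. by rewrite [leRHS]/Num.Def.normr/= mx_normrE (le_bigmax _ _ (ord0, i)). Qed.

(** The chain rule requires the outer function to be differentiable in the Frechet sense. The
    candidate differential is the linear form of the coordinate derivatives at x, and [mean_value]
    bounds the error. *)
Lemma C1_differentiable (U : set 'rV[R]_m) F x : open U -> U x ->
  (forall y v, U y -> derivable F y v) ->
  (forall i, {for x, continuous ('D_(delta_mx 0 i) F)}) ->
  differentiable F x.
Proof.
move=> oU Ux dF cF.
pose c i := 'D_(delta_mx 0 i) F x.
have E : F \o shift x = cst (F x) + lin_form c +o_ (0 : 'rV[R]_m) id.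
  apply/eqaddoP => _/posnumP[e].
  have [r /= r0 rU] : exists2 r, 0 < r & forall y, `|y - x| < r -> U y.
    have /nbhs_ballP[r /= r0 rU] := open_nbhs_nbhs (conj oU Ux).
    by exists r => // y yr; apply: rU; rewrite -ball_normE /ball_/= distrC.
  (* The error e is shared among the m coordinates; m + 1 keeps the quotient meaningful for m =
     0. *)
  have e'0 : 0 < e%:num / m.+1%:R by rewrite divr_gt0.
  have [d /= d0 dU] : exists2 d : R, 0 < d & forall y i, `|y - x| < d ->
      `|'D_(delta_mx 0 i) F y - c i| <= e%:num / m.+1%:R.
    suff /nbhs_ballP[d /= d0 H] : \forall y \near x, forall i,
        `|'D_(delta_mx 0 i) F y - c i| <= e%:num / m.+1%:R.
      by exists d => // y i yd; apply: H; rewrite -ball_normE /ball_/= distrC.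
    suff H i : \forall y \near x, `|'D_(delta_mx 0 i) F y - c i| <= e%:num / m.+1%:R.
      exact: filter_forall H.
    have /cvgrPdist_le/(_ _ e'0) := cF i.
    by apply: filterS => y; rewrite distrC.
  (* Division by 3 undoes the factor 3 of [mean_value], so that the intermediate points stay within
     r and d. *)
  have rd0 : 0 < Num.min r d / 3 by rewrite divr_gt0// lt_min r0.
  apply/nbhs_ballP; exists (Num.min r d / 3) => //= h.
  rewrite -ball_normE /ball_/= sub0r normrN ltr_pdivlMr// mulrC lt_min => /andP[hr hd].
  rewrite /cst /shift /= fctE.
  have [||xi [xi1]] := @mean_value F x r h (enum 'I_m) (enum_uniq _).
  - by move=> y v /rU; exact: dF.
  - exact: hr.
  rewrite partial_row_enum -[(F \o _) h]/(F (h + x)) -[(- _) h]/(- (F x + lin_form c h))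
    [h + x]addrC opprD addrA => ->.
  rewrite /lin_form big_enum /= -sumrB.
  rewrite (le_trans (ler_norm_sum _ _ _))//.
  have : \sum_(i < m) `|h 0 i * 'D_(delta_mx 0 i) F (xi i) - h 0 i * c i| <=
     \sum_(i < m) `|h| * (e%:num / m.+1%:R).
    apply: ler_sum => i _; rewrite -mulrBr normrM ler_pM ?norm_coord_le//.
    by apply: dU; apply: le_lt_trans (xi1 i) hd.
  move/le_trans; apply.
  rewrite sumr_const card_ord -[_ *+ m]mulr_natr.
  have -> : `|h| * (e%:num / m.+1%:R) * m%:R = (e%:num * `|h|) * (m%:R / m.+1%:R) by ring.
  by rewrite ler_piMr ?mulr_ge0// ler_pdivrMr// mul1r ler_nat.
have := diff_unique (continuous_lin_form (c:=c)) E.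
move=> D; apply/diff_locallyP; rewrite D; split=> //; exact: continuous_lin_form.
Qed.

End MeanValue.

(** * Calculus of C^k functions *)

Section Ck.
Variables (R : realType) (V : normedModType R).
Implicit Types (U O : set V) (F G : V -> R) (x y v : V) (k : nat).

(* [smooth_real] differentiates the last direction first, so closure under
   products or compositions needs this form, which peels off the innermost
   derivative. *)
Fixpoint Ck k U F : Prop :=
  (forall x, U x -> {for x, continuous F}) /\
  if k is k'.+1 then
    (forall x v, U x -> derivable F x v) /\ forall v, Ck k' U ('D_v F)
  else True.

Lemma Ck_continuous k U F x : Ck k U F -> U x -> {for x, continuous F}.
Proof. by case: k => [|k] [cF _]; exact: cF. Qed.

Lemma iterD_rcons (w : seq V) v F : iterD (rcons w v) F = iterD w ('D_v F).
Proof. exact: foldr_rcons. Qed.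

Lemma iterD_cat (w w' : seq V) F : iterD (w ++ w') F = iterD w (iterD w' F).
Proof. exact: foldr_cat. Qed.

Lemma smooth_D U F v : smooth_real U F -> smooth_real U ('D_v F).
Proof. by move=> sF w x Ux; rewrite -iterD_rcons; exact: sF. Qed.

Lemma smooth_iterD U F w : smooth_real U F -> smooth_real U (iterD w F).
Proof.
by move=> sF; elim: w => [|v w ih] /=; [exact: sF|exact: smooth_D].
Qed.

Lemma smooth_CkP U F : smooth_real U F <-> forall k, Ck k U F.
Proof.
split=> [sF k|CF].
  elim: k F sF => [|k ih] F sF; split=> //.
  - by move=> x Ux; have [] := sF [::] x Ux.
  - by move=> x Ux; have [] := sF [::] x Ux.
  - by split=> [x v Ux|v]; [have [_] := sF [::] x Ux|apply/ih/smooth_D].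
move=> w x Ux.
have CFw k : Ck k U (iterD w F).
  by elim: w k => //= v w ih k; have [_ [_]] := ih k.+1; apply.
by split; [exact: Ck_continuous (CFw 0) Ux|have [_ [d _]] := CFw 1 => v; exact: d].
Qed.

Lemma near_eq_continuous F G x : (\near x, F x = G x) ->
  {for x, continuous F} -> {for x, continuous G}.
Proof.
move=> FG cF; have e : F x = G x := nbhs_singleton FG.
change (G @ x --> G x); rewrite -e.
by apply: cvg_trans cF; exact: near_eq_cvg.
Qed.

Lemma open_near_eq U F G x : open U -> U x -> (forall y, U y -> F y = G y) ->
  \near x, F x = G x.
Proof. by move=> oU Ux FG; near=> y; apply: FG; near: y; exact: open_nbhs_nbhs.
Unshelve. all: by end_near. Qed.

Lemma Ck_ext k U F G : open U -> (forall y, U y -> F y = G y) ->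
  Ck k U F -> Ck k U G.
Proof.
move=> oU; elim: k F G => [|k ih] F G FG; first move=> [cF _].
  by split=> // x Ux; apply: near_eq_continuous (cF x Ux); exact: open_near_eq FG.
move=> [cF [dF CF]]; split=> [x Ux|].
  by apply: near_eq_continuous (cF x Ux); exact: open_near_eq FG.
split=> [x v Ux|v].
  by apply: near_eq_derivable (dF x v Ux); exact: open_near_eq FG.
by apply: ih (CF v) => y Uy; apply: near_eq_derive; exact: open_near_eq FG.
Qed.

Lemma CkW k U F : Ck k.+1 U F -> Ck k U F.
Proof.
elim: k F => [|k ih] F [cF [dF CF]]; first by split.
by split=> //; split=> // v; apply: ih; exact: CF.
Qed.

Lemma Ck_cst k U (c : R) : open U -> Ck k U (fun=> c).
Proof.
move=> oU; elim: k c => [|k ih] c; split=> //; try by move=> x _; exact: cst_continuous.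
split=> [x v _|v]; first exact: derivable_cst.
by apply: Ck_ext (ih 0) => // y _; rewrite derive_cst.
Qed.

Lemma Ck_add k U F G : open U -> Ck k U F -> Ck k U G ->
  Ck k U (fun x => F x + G x).
Proof.
move=> oU; elim: k F G => [|k ih] F G; move=> [cF HF] [cG HG]; split=> //;
  try by (move=> x Ux; apply: (@continuousD _ _ _ F G); [exact: cF|exact: cG]).
case: HF => dF CF; case: HG => dG CG; split=> [x v Ux|v].
  by apply: derivableD; [exact: dF|exact: dG].
apply: Ck_ext (ih _ _ (CF v) (CG v)) => // y Uy.
by rewrite deriveD//; [exact: dF|exact: dG].
Qed.

Lemma Ck_mul k U F G : open U -> Ck k U F -> Ck k U G ->
  Ck k U (fun x => F x * G x).
Proof.
move=> oU; elim: k F G => [|k ih] F G CF CG; have [cF HF] := CF;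
  have [cG HG] := CG; split=> //;
  try by (move=> x Ux; apply: (@continuousM _ _ F G); [exact: cF|exact: cG]).
case: HF => dF DF; case: HG => dG DG; split=> [x v Ux|v].
  by apply: derivableM; [exact: dF|exact: dG].
have H := Ck_add oU (ih _ _ (CkW CF) (DG v)) (ih _ _ (CkW CG) (DF v)).
apply: Ck_ext H => // y Uy.
by rewrite deriveM//; [exact: dF|exact: dG].
Qed.

Lemma Ck_sum k U (I : Type) (r : seq I) (P : pred I) (F : I -> V -> R) : open U ->
  (forall i, P i -> Ck k U (F i)) -> Ck k U (fun x => \sum_(i <- r | P i) F i x).
Proof.
move=> oU CF; elim: r => [|i r ih].
  by apply: Ck_ext (@Ck_cst k U 0 oU) => // y _; rewrite big_nil.
have [Pi|nPi] := boolP (P i).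
  apply: Ck_ext (Ck_add oU (CF _ Pi) ih) => // y _.
  by rewrite [in RHS]big_cons Pi.
by apply: Ck_ext ih => // y _; rewrite [in RHS]big_cons (negbTE nPi).
Qed.

Lemma is_derive_linear (L : {linear V -> R}) x v : is_derive x v L (L v).
Proof.
have E : (fun h : R => h^-1 *: (L (h *: v + x) - L x)) @ 0^' --> L v.
  apply/cvgrPdist_le => e e0; near=> h.
  rewrite [L (_ + _)]linearD addrK (_ : L (h *: v) = h *: (L v : R)); last exact: linearZ_LR.
  rewrite scalerA mulVf; last first.
    by near: h; exact: nbhs_dnbhs_neq.
  by rewrite scale1r subrr normr0 ltW.
split; first by apply/cvg_ex; exists (L v).
exact/cvg_lim.
Unshelve. all: by end_near. Qed.

Lemma Ck_linear k U (L : {linear V -> R}) : open U -> continuous L -> Ck k U L.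
Proof.
move=> oU cL; case: k => [|k]; split; try by move=> x _; exact: cL.
  exact: I.
split=> [x v _|v]; first by have [] := is_derive_linear L x v.
apply: Ck_ext (@Ck_cst k U (L v) oU); first exact: oU.
by move=> y _; have [_ ->] := is_derive_linear L y v.
Qed.

Lemma is_derive_lineV F x v (d : R) :
  is_derive (0 : R) 1 (fun s : R => F (s *: v + x)) d -> is_derive x v F d.
Proof.
move=> [dF <-].
have e0 : 0 *: v + x = x by rewrite scale0r add0r.
have E := @line_quotient R V F v x 0; rewrite e0 in E.
split; last by rewrite /derive /= e0 -E.
by rewrite /derivable -E; move: dF; rewrite /derivable /= e0.
Qed.

Lemma is_derive_comp1 (g : R -> R) F x v : derivable F x v ->
  derivable g (F x) 1 ->
  is_derive x v (fun y => g (F y)) ('D_1 g (F x) * 'D_v F x).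
Proof.
move=> dF dg; apply: is_derive_lineV.
have e0 : x = 0 *: v + x by rewrite scale0r add0r.
have := derivableP dF; rewrite {1}e0 => /is_derive_line[h1 h2].
set f := fun s : R => F (s *: v + x) in h1 h2.
have f0 : f 0 = F x by rewrite /f -e0.
have dg' : derivable g (f 0) 1 by rewrite f0; exact: dg.
have := derive1_comp h1 dg'; rewrite !derive1E h2 f0 => <-.
apply: derivableP.
have d1 : differentiable f 0 by exact/derivable1_diffP.
have d2 : differentiable g (f 0) by exact/derivable1_diffP.
exact/derivable1_diffP/differentiable_comp.
Qed.

End Ck.

Section CkComp.
Variables (R : realType) (V : normedModType R).

Lemma Ck_comp1 k (O : set V) (U : set R) (g : R -> R) (F : V -> R) :
  open O -> open U -> Ck k U g -> Ck k O F -> (forall x, O x -> U (F x)) ->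
  Ck k O (fun x => g (F x)).
Proof.
move=> oO oU; elim: k g F => [|k ih] g F Cg CF OU; have [cF HF] := CF;
  have [cg Hg] := Cg; split=> //;
  try by (move=> x Ox; apply: (@continuous_comp _ _ _ F g);
    [exact: cF|exact/cg/OU]).
case: HF => dF DF; case: Hg => dg Dg.
have D x v : O x -> is_derive x v (fun y => g (F y)) ('D_1 g (F x) * 'D_v F x).
  by move=> Ox; apply: is_derive_comp1; [exact: dF|exact/dg/OU].
split=> [x v /(D x v)[]//|v].
apply: Ck_ext (Ck_mul oO (ih _ _ (Dg 1) (CkW CF) OU) (DF v)) => // y Oy.
by have [_ ->] := D y v Oy.
Qed.

Lemma continuous_row m (phi : V -> 'rV[R]_m) x :
  (forall i, {for x, continuous (fun y => phi y 0 i)}) -> {for x, continuous phi}.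
Proof.
move=> H; apply/cvgrPdist_le => e e0.
have {}H i : \forall y \near x, `|phi x 0 i - phi y 0 i| <= e.
  by have /cvgrPdist_le/(_ _ e0) := H i.
have {}H : \forall y \near x, forall i, `|phi x 0 i - phi y 0 i| <= e.
  exact: filter_forall H.
apply: filterS H => y Hy.
rewrite [leLHS]/Num.Def.normr/= mx_normrE; apply: bigmax_le; first exact: ltW.
by move=> [i j] _ /=; rewrite !mxE (ord1 i).
Qed.

(** On the line through x along v the inner map becomes a curve, differentiable coordinatewise, and
    F is Frechet differentiable because it is C^1; so the chain rule for differentials applies. *)
Lemma is_derive_comp m (U : set 'rV[R]_m) (F : 'rV[R]_m -> R)
    (phi : V -> 'rV[R]_m) x v :
  open U -> U (phi x) -> Ck 1 U F ->
  (forall i, derivable (fun y => phi y 0 i) x v) ->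
  is_derive x v (fun y => F (phi y))
    (\sum_i 'D_v (fun y => phi y 0 i) x * 'D_(delta_mx 0 i) F (phi x)).
Proof.
move=> oU Ux [cF [dF CF]] dphi; apply: is_derive_lineV.
have e0 : x = 0 *: v + x by rewrite scale0r add0r.
pose gam := fun s : R => phi (s *: v + x).
have g0 : gam 0 = phi x by rewrite /gam -e0.
have dg i : is_derive (0 : R) 1 (fun s => gam s 0 i) ('D_v (fun y => phi y 0 i) x).
  apply: (@is_derive_line _ _ (fun y => phi y 0 i)); rewrite -e0.
  exact/derivableP/dphi.
have dgam : derivable gam 0 1.
  by apply/derivable_mxP => i j; rewrite (ord1 i); have [] := dg j.
have d1 : differentiable gam 0 by exact/derivable1_diffP.
have d2 : differentiable F (gam 0).
  rewrite g0; apply: (C1_differentiable oU Ux); first by move=> y w; exact: dF.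
  by move=> i; have := CF (delta_mx 0 i) => -[+ _]; apply.
have d12 : differentiable (F \o gam) 0 by exact: differentiable_comp.
apply: DeriveDef; first exact/derivable1_diffP.
rewrite (deriveE (1 : R) d12) diff_comp//= -(deriveE (1 : R) d1) (derive_mx dgam).
rewrite [X in 'd _ _ X]row_sum_delta linear_sum g0; apply: eq_bigr => i _.
rewrite linearZ /= mxE -deriveE -?g0//.
by have [_ ->] := dg i.
Qed.

(** Induction on k: by the chain rule the derivative is a sum of products of derivatives of [phi]
    with compositions of the same kind, one class lower. *)
Lemma Ck_comp k m (O : set V) (U : set 'rV[R]_m) (F : 'rV[R]_m -> R)
    (phi : V -> 'rV[R]_m) :
  open O -> open U -> Ck k U F -> (forall i, Ck k O (fun x => phi x 0 i)) ->
  (forall x, O x -> U (phi x)) -> Ck k O (fun x => F (phi x)).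
Proof.
move=> oO oU; elim: k F => [|k ih] F CF Cphi OU.
  split=> // x Ox; apply: (@continuous_comp _ _ _ phi F).
    by apply: continuous_row => i; exact: Ck_continuous (Cphi i) Ox.
  exact: Ck_continuous CF (OU _ Ox).
have C1 : Ck 1 U F.
  have [cF [dF DF]] := CF; split=> //; split=> // v; split=> // y Uy.
  exact: Ck_continuous (DF v) Uy.
have D x v : O x -> is_derive x v (fun y => F (phi y))
    (\sum_i 'D_v (fun y => phi y 0 i) x * 'D_(delta_mx 0 i) F (phi x)).
  move=> Ox; apply: (is_derive_comp oU) => //; first exact: OU.
  by move=> i; have [_ [d _]] := Cphi i; exact: d.
split.
  move=> x Ox; apply: (@continuous_comp _ _ _ phi F).
    by apply: continuous_row => i; exact: Ck_continuous (Cphi i) Ox.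
  exact: Ck_continuous CF (OU _ Ox).
split=> [x v /(D x v)[]//|v].
have H : Ck k O (fun x =>
    \sum_i 'D_v (fun y => phi y 0 i) x * 'D_(delta_mx 0 i) F (phi x)).
  apply: Ck_sum => // i _; apply: Ck_mul => //.
    by have [_ [_ d]] := Cphi i; exact: d.
  apply: (ih ('D_(delta_mx 0 i) F)) => //.
    by have [_ [_ d]] := CF; exact: d.
  by move=> j; exact: CkW.
by apply: Ck_ext H => // y Oy; have [_ ->] := D y v Oy.
Qed.

End CkComp.

(** * Linearity and symmetry of iterated directional derivatives *)

Section Directions.
Variables (R : realType) (V : normedModType R).
Implicit Types (U : set V) (F G : V -> R) (x y u v : V).

Lemma nbhs_norm_ball U x : open U -> U x ->
  exists2 r : R, 0 < r & forall y, `|y - x| < r -> U y.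
Proof.
move=> oU Ux; have /nbhs_ballP[r /= r0 rU] := open_nbhs_nbhs (conj oU Ux).
by exists r => // y yr; apply: rU; rewrite -ball_normE /ball_/= distrC.
Qed.

Lemma continuous_norm_ball F x (e : R) : {for x, continuous F} -> 0 < e ->
  exists2 r : R, 0 < r & forall y, `|y - x| < r -> `|F y - F x| <= e.
Proof.
move=> /cvgrPdist_le/[apply] /nbhs_ballP[r /= r0 H]; exists r => // y yx.
by rewrite distrC; apply: H; rewrite -ball_normE /ball_/= distrC.
Qed.

Lemma small_combination u v (r : R) : 0 < r ->
  exists2 d : R, 0 < d & forall h a b : R, `|h| < d -> 0 <= a <= 1 -> 0 <= b <= 1 ->
    `|a *: (h *: u) + b *: (h *: v)| < r.
Proof.
move=> r0; have p0 : 0 < `|u| + `|v| + 1 by rewrite ltr_wpDl// addr_ge0.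
exists (r / (`|u| + `|v| + 1)); first by rewrite divr_gt0.
move=> h a b; rewrite ltr_pdivlMr// => hr /andP[a0 a1] /andP[b0 b1].
apply: le_lt_trans hr; rewrite (le_trans (ler_normD _ _))// !normrZ.
rewrite (ger0_norm a0) (ger0_norm b0).
have hu : `|h| * `|u| >= 0 by rewrite mulr_ge0.
have hv : `|h| * `|v| >= 0 by rewrite mulr_ge0.
have h0 := normr_ge0 h.
rewrite !mulrDr mulr1.
have : a * (`|h| * `|u|) <= `|h| * `|u| by rewrite ler_piMl.
have : b * (`|h| * `|v|) <= `|h| * `|v| by rewrite ler_piMl.
lra.
Qed.

(** The increment along u + v is the increment along u from the displaced point h v + x plus the one
    along v from x; the mean value theorem and the continuity of the derivative along u handle the
    first. *)
Lemma is_derive_dirD U F x u v : open U -> U x -> Ck 1 U F ->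
  is_derive x (u + v) F ('D_u F x + 'D_v F x).
Proof.
move=> oU Ux [cF [dF CF]].
have H : (fun h : R => h^-1 *: (F (h *: (u + v) + x) - F x)) @ 0^' -->
    'D_u F x + 'D_v F x.
  have H2 : (fun h : R => h^-1 *: (F (h *: v + x) - F x)) @ 0^' --> 'D_v F x.
    exact: dF x v Ux.
  have H1 : (fun h : R => h^-1 *: (F (h *: u + (h *: v + x)) - F (h *: v + x))) @ 0^'
      --> 'D_u F x.
    apply/cvgrPdist_le => e e0.
    have [r r0 rU] := nbhs_norm_ball oU Ux.
    have [s s0 sF] := continuous_norm_ball ((CF u).1 x Ux) e0.
    have [d d0 dd] : exists2 d : R, 0 < d & forall h a b : R, `|h| < d ->
        0 <= a <= 1 -> 0 <= b <= 1 -> `|a *: (h *: u) + b *: (h *: v)| < Num.min r s.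
      by apply: small_combination; rewrite lt_min r0.
    near=> h.
    have h0 : h != 0 by near: h; exact: nbhs_dnbhs_neq.
    have hd : `|h| < d by near: h; exact: dnbhs0_lt.
    have pt (t : R) : 0 <= t <= 1 ->
        `|t *: (h *: u) + (h *: v + x) - x| < Num.min r s.
      move=> t01; rewrite addrA addrK -[h *: v]scale1r; apply: dd => //.
      by rewrite ler01 lexx.
    have [t01|t t01 ->] := @MVT_line _ _ F (h *: u) (h *: v + x).
      move=> t01'; apply: dF; apply: rU.
      by have := pt _ t01'; rewrite lt_min => /andP[].
    have dU : derivable F (t *: (h *: u) + (h *: v + x)) u.
      by apply: dF; apply: rU; have := pt _ t01; rewrite lt_min => /andP[].
    have [_ ->] := is_derive_scale_dir h (derivableP dU).
    rewrite [_ *: _]mulKf// distrC; apply: sF.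
    by have := pt _ t01; rewrite lt_min => /andP[].
  have H3 := cvgD H1 H2; have E : (fun h : R => h^-1 *: (F (h *: (u + v) + x) - F x)) =
    (fun h : R => h^-1 *: (F (h *: u + (h *: v + x)) - F (h *: v + x))) +
    (fun h : R => h^-1 *: (F (h *: v + x) - F x)).
    by apply/funext => h; rewrite fctE -scalerDr subrKA [h *: (u + v)]scalerDr -addrA.
  by rewrite E; exact: H3.
split; first by apply/cvg_ex; exists ('D_u F x + 'D_v F x).
exact/cvg_lim.
Unshelve. all: by end_near. Qed.

Lemma derive_dir_sum U F x (I : Type) (s : seq I) (c : I -> R) (v : I -> V) :
  open U -> U x -> Ck 1 U F ->
  'D_(\sum_(i <- s) c i *: v i) F x = \sum_(i <- s) c i * 'D_(v i) F x.
Proof.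
move=> oU Ux CF; elim: s => [|i s ih]; first by rewrite !big_nil derive0.
rewrite !big_cons; have [_ ->] := is_derive_dirD (c i *: v i) (\sum_(j <- s) c j *: v j) oU Ux CF.
rewrite ih; congr (_ + _).
have [_ [dF _]] := CF.
by have [_ ->] := is_derive_scale_dir (c i) (derivableP (dF x (v i) Ux)).
Qed.

(** The mean value theorem is applied twice: to y |-> F (h v + y) - F y along h u, then to the
    derivative of F along u in the direction h v. The second difference is symmetric in u and v,
    which is what the symmetry of derivatives rests on. *)
Lemma second_difference U F x u v (r h : R) : (forall y, `|y - x| < r -> U y) ->
  Ck 2 U F -> (forall a b : R, 0 <= a <= 1 -> 0 <= b <= 1 ->
    `|a *: (h *: u) + b *: (h *: v)| < r) ->
  exists a b : R, [/\ 0 <= a <= 1, 0 <= b <= 1 &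
    F (h *: u + (h *: v + x)) - F (h *: u + x) - F (h *: v + x) + F x =
    h * (h * 'D_v ('D_u F) (a *: (h *: u) + b *: (h *: v) + x))].
Proof.
move=> rU [cF [dF CF]] hr.
have inU (a b : R) : 0 <= a <= 1 -> 0 <= b <= 1 ->
    U (a *: (h *: u) + b *: (h *: v) + x).
  by move=> a01 b01; apply: rU; rewrite addrK; exact: hr.
have z01 : 0 <= (0 : R) <= 1.
  by apply/andP; split; [exact: lexx|exact: ler01].
have o01 : 0 <= (1 : R) <= 1 by apply/andP; split; [exact: ler01|exact: lexx].
pose H y := F (h *: v + y) - F y.
have dH (t : R) : 0 <= t <= 1 -> is_derive (t *: (h *: u) + x) (h *: u) H
    ('D_(h *: u) F (h *: v + (t *: (h *: u) + x)) - 'D_(h *: u) F (t *: (h *: u) + x)).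
  move=> t01.
  have d1 : derivable F (t *: (h *: u) + x) (h *: u).
    by apply: dF; have := inU t 0 t01 z01; rewrite scale0r addr0.
  have d2 : derivable F (h *: v + (t *: (h *: u) + x)) (h *: u).
    by apply: dF; have := inU t 1 t01 o01; rewrite scale1r addrAC addrC.
  have d3 : is_derive (t *: (h *: u) + x) (h *: u) (fun y => F (h *: v + y))
      ('D_(h *: u) F (h *: v + (t *: (h *: u) + x))).
    have E : (fun s : R => s^-1 *: (F (h *: v + (s *: (h *: u) + (t *: (h *: u) + x))) -
        F (h *: v + (t *: (h *: u) + x)))) =
      (fun s : R => s^-1 *: (F (s *: (h *: u) + (h *: v + (t *: (h *: u) + x))) -
        F (h *: v + (t *: (h *: u) + x)))).
      by apply/funext => s; rewrite addrCA.
    by split; [rewrite /derivable E; exact: d2|rewrite /derive E].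
  exact: (is_deriveB d3 (derivableP d1)).
have [t t01|a a01] := @MVT_line _ _ H (h *: u) x; first by have [] := dH t t01.
have [_ ->] := dH a a01.
have Ua : U (a *: (h *: u) + x) by have := inU a 0 a01 z01; rewrite scale0r addr0.
have Ua' : U (h *: v + (a *: (h *: u) + x)).
  by have := inU a 1 a01 o01; rewrite scale1r addrAC addrC.
have [_ ->] := is_derive_scale_dir h (derivableP (dF _ u Ua)).
have [_ ->] := is_derive_scale_dir h (derivableP (dF _ u Ua')).
have [_ [dDF _]] := CF u.
have [t t01|b b01] := @MVT_line _ _ ('D_u F) (h *: v) (a *: (h *: u) + x).
  by apply: dDF; have := inU a t a01 t01; rewrite addrAC addrC.
have Ub : U (b *: (h *: v) + (a *: (h *: u) + x)).
  by have := inU a b a01 b01; rewrite addrAC addrC.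
have [_ ->] := is_derive_scale_dir h (derivableP (dDF _ v Ub)).
rewrite -mulrBr => -> E; exists a, b; split; [exact: a01|exact: b01|].
have <- : b *: (h *: v) + (a *: (h *: u) + x) = a *: (h *: u) + b *: (h *: v) + x.
  by rewrite addrA [b *: _ + _]addrC.
rewrite -E /H [h *: v + (_ + _)]addrCA opprB [RHS]addrA.
exact: addrAC.
Qed.

Lemma dist_half (a b c e : R) : `|c - a| <= e / 2 -> `|c - b| <= e / 2 -> `|a - b| <= e.
Proof.
move=> ca cb; have -> : a - b = (c - b) - (c - a) by ring.
by rewrite (le_trans (ler_normB _ _))// (splitr e) lerD.
Qed.

(* Both mixed derivatives are the limit of the second difference over h^2. *)
Lemma derive_swap U F x u v : open U -> U x -> Ck 2 U F ->
  'D_v ('D_u F) x = 'D_u ('D_v F) x.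
Proof.
move=> oU Ux CF; apply/eqP; rewrite -subr_eq0 -normr_eq0.
apply/eqP/le_anti; rewrite normr_ge0 andbT; apply/ler_addgt0Pl => e e0.
rewrite addr0.
have [r r0 rU] := nbhs_norm_ball oU Ux.
have [_ [_ D]] := CF.
have e20 : 0 < e / 2 by rewrite divr_gt0.
have [_ [_ Du]] := D u; have [_ [_ Dv]] := D v.
have [s s0 sF] := continuous_norm_ball ((Du v).1 x Ux) e20.
have [s' s'0 s'F] := continuous_norm_ball ((Dv u).1 x Ux) e20.
pose q := Num.min r (Num.min s s').
have [d d0 dd] : exists2 d : R, 0 < d & forall h a b : R, `|h| < d ->
    0 <= a <= 1 -> 0 <= b <= 1 -> `|a *: (h *: u) + b *: (h *: v)| < q.
  by apply: small_combination; rewrite !lt_min r0 s0.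
pose h := d / 2.
have h0 : h != 0 by rewrite gt_eqF// divr_gt0.
have hd : `|h| < d by rewrite gtr0_norm ?divr_gt0// /h ltr_pdivrMr// mulr_natr mulr2n ltrDl.
have qr : q <= r by rewrite ge_min lexx.
have qs : q <= s by rewrite !ge_min lexx orbT.
have qs' : q <= s' by rewrite !ge_min lexx !orbT.
have [a [b [a01 b01 E1]]] := second_difference rU CF
  (fun a b a01 b01 => lt_le_trans (dd h a b hd a01 b01) qr).
have hr' (c k : R) : 0 <= c <= 1 -> 0 <= k <= 1 ->
    `|c *: (h *: v) + k *: (h *: u)| < r.
  by move=> c01 k01; rewrite addrC; exact: lt_le_trans (dd h k c hd k01 c01) qr.
have [a' [b' [a01' b01' E2]]] := second_difference rU CF hr'.
have E : 'D_v ('D_u F) (a *: (h *: u) + b *: (h *: v) + x) =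
    'D_u ('D_v F) (a' *: (h *: v) + b' *: (h *: u) + x).
  suff : forall y z : R, h * (h * y) = h * (h * z) -> y = z.
    move=> HH; apply: HH.
    have EP : h *: v + (h *: u + x) = h *: u + (h *: v + x) by exact: addrCA.
    have gen (P Q S f c k : R) : P - Q - S + f = c -> P - S - Q + f = k -> c = k.
      by move=> <- <-; rewrite [P - Q - S]addrAC.
    by rewrite EP in E2; exact: gen E1 E2.
  by move=> y z /(mulfI h0) /(mulfI h0).
have B1 := sF (a *: (h *: u) + b *: (h *: v) + x).
have B2 := s'F (a' *: (h *: v) + b' *: (h *: u) + x).
rewrite addrK in B1; rewrite addrK in B2.
have {}B1 := B1 (lt_le_trans (dd h a b hd a01 b01) qs).
rewrite [a' *: _ + _]addrC in B2.
have {}B2 := B2 (lt_le_trans (dd h b' a' hd b01' a01') qs').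
rewrite [a' *: _ + _]addrC in E; rewrite -E in B2.
exact: dist_half B1 B2.
Qed.

Lemma iterD_ext U F G (w : seq V) x : open U -> (forall y, U y -> F y = G y) ->
  U x -> iterD w F x = iterD w G x.
Proof.
move=> oU FG; elim: w x => [|v w ih] x Ux /=; first exact: FG.
by apply: near_eq_derive; exact: open_near_eq oU Ux ih.
Qed.

Lemma smooth_ext U F G : open U -> (forall y, U y -> F y = G y) ->
  smooth_real U F -> smooth_real U G.
Proof. by move=> oU FG /smooth_CkP CF; apply/smooth_CkP => k; exact: Ck_ext (CF k). Qed.

Lemma smoothM U F G : open U -> smooth_real U F -> smooth_real U G ->
  smooth_real U (fun x => F x * G x).
Proof.
by move=> oU /smooth_CkP CF /smooth_CkP CG; apply/smooth_CkP => k; exact: Ck_mul.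
Qed.

Lemma smoothD U F G : open U -> smooth_real U F -> smooth_real U G ->
  smooth_real U (fun x => F x + G x).
Proof.
by move=> oU /smooth_CkP CF /smooth_CkP CG; apply/smooth_CkP => k; exact: Ck_add.
Qed.

Lemma smooth_cst U (c : R) : open U -> smooth_real U (fun=> c).
Proof. by move=> oU; apply/smooth_CkP => k; exact: Ck_cst. Qed.

Lemma smooth_sum U (I : Type) (r : seq I) (P : pred I) (F : I -> V -> R) : open U ->
  (forall i, P i -> smooth_real U (F i)) ->
  smooth_real U (fun x => \sum_(i <- r | P i) F i x).
Proof.
move=> oU CF; apply/smooth_CkP => k; apply: Ck_sum => // i Pi.
by have /smooth_CkP := CF i Pi.
Qed.

Lemma smoothZ U (c : R) F : open U -> smooth_real U F ->
  smooth_real U (fun x => c * F x).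
Proof. by move=> oU sF; apply: (smoothM oU _ sF); exact: smooth_cst. Qed.

Lemma smoothN U F : open U -> smooth_real U F -> smooth_real U (fun x => - F x).
Proof.
move=> oU sF; have := smoothZ (-1) oU sF; apply: smooth_ext => // y _.
by rewrite mulN1r.
Qed.

Lemma smoothB U F G : open U -> smooth_real U F -> smooth_real U G ->
  smooth_real U (fun x => F x - G x).
Proof. by move=> oU sF sG; apply: (smoothD oU sF); exact: smoothN. Qed.

Lemma smoothX U F n : open U -> smooth_real U F -> smooth_real U (fun x => F x ^+ n).
Proof.
move=> oU sF; elim: n => [|n ih].
  by apply: smooth_ext (smooth_cst 1 oU) => // y _; rewrite expr0.
by apply: smooth_ext (smoothM oU sF ih) => // y _; rewrite exprS.
Qed.

Lemma smooth_sub U O F : U `<=` O -> smooth_real O F -> smooth_real U F.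
Proof. by move=> UO sF w x /UO; exact: sF. Qed.

Lemma smooth_local U F : (forall x, U x -> exists2 B, B x & smooth_real B F) ->
  smooth_real U F.
Proof. by move=> H w x /H[B Bx sF]; exact: sF. Qed.

Lemma iterDD U F G w x : open U -> U x -> smooth_real U F -> smooth_real U G ->
  iterD w (fun y => F y + G y) x = iterD w F x + iterD w G x.
Proof.
move=> oU + sF sG; elim: w x => //= v w ih x Ux.
rewrite (near_eq_derive _ (open_near_eq oU Ux ih)).
have [_ dF] := sF w x Ux; have [_ dG] := sG w x Ux.
exact: (deriveD (dF v) (dG v)).
Qed.

Lemma iterD_zero w x : iterD w (fun=> 0 : R) x = 0 :> R.
Proof.
elim: w x => //= v w ih x.
by rewrite (_ : iterD w _ = fun=> 0) ?derive_cst//; apply/funext => y; exact: ih.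
Qed.

Lemma iterDZ U F (c : R) w x : open U -> U x -> smooth_real U F ->
  iterD w (fun y => c * F y) x = c * iterD w F x.
Proof.
move=> oU + sF; elim: w x => //= v w ih x Ux.
rewrite (near_eq_derive _ (open_near_eq oU Ux ih)).
have [_ dF] := sF w x Ux.
exact: (deriveZ c (dF v)).
Qed.

Lemma iterD_sum U (I : Type) (r : seq I) (F : I -> V -> R) w x : open U -> U x ->
  (forall i, smooth_real U (F i)) ->
  iterD w (fun y => \sum_(i <- r) F i y) x = \sum_(i <- r) iterD w (F i) x.
Proof.
move=> oU Ux sF; elim: r => [|i r ih].
  rewrite big_nil -[RHS](iterD_zero w x); congr (iterD w _ x).
  by apply/funext => y; rewrite big_nil.
rewrite big_cons -ih -(iterDD _ oU Ux) //.
  by congr (iterD w _ x); apply/funext => y; rewrite big_cons.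
by apply: smooth_sum => // j _; exact: sF.
Qed.

Lemma iterD_perm U F (w w' : seq V) x : open U -> U x -> smooth_real U F ->
  perm_eq w w' -> iterD w F x = iterD w' F x.
Proof.
move=> oU Ux sF /permP; elim: w w' x Ux => [|v w ih] w' x Ux.
  by case: w' => // a w' /(_ predT).
move=> ww'.
have : v \in w' by rewrite -has_pred1 has_count -ww' /= eqxx.
move=> vw'; case/path.splitPr: w' / vw' ww' => w1 w2 ww'.
have E : {in U, forall y, iterD w F y = iterD (w1 ++ w2) F y}.
  move=> y; rewrite inE => Uy; apply: ih => // a.
  by have := ww' a; rewrite /= !count_cat /= addnCA => /addnI.
have -> : iterD (v :: w) F x = iterD (v :: w1 ++ w2) F x.
  by apply: near_eq_derive; apply: open_near_eq oU Ux _ => y Uy; apply: E; rewrite inE.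
(* The head v is moved past w1 one direction at a time, by the symmetry of second derivatives. *)
elim: w1 {ih ww' E} x Ux => [|a w1 ih] x Ux; first exact: erefl.
rewrite /=.
rewrite -(near_eq_derive _ (open_near_eq oU Ux ih)) /=.
have /smooth_CkP/(_ 2%N) C2 := smooth_iterD (w1 ++ w2) sF.
exact: derive_swap C2.
Qed.

Lemma iterD_dir_sum U F x (I : Type) (s : seq I) (c : I -> R) (v : I -> V)
    (w1 w2 : seq V) : open U -> U x -> smooth_real U F ->
  iterD (w1 ++ (\sum_(i <- s) c i *: v i) :: w2) F x =
  \sum_(i <- s) c i * iterD (w1 ++ v i :: w2) F x.
Proof.
move=> oU Ux sF; rewrite iterD_cat /=.
have sF' := smooth_iterD w2 sF; have /smooth_CkP/(_ 1%N) C1 := sF'.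
have -> : iterD w1 ('D_(\sum_(i <- s) c i *: v i) (iterD w2 F)) x =
    iterD w1 (fun y => \sum_(i <- s) c i * 'D_(v i) (iterD w2 F) y) x.
  by apply: (iterD_ext _ oU) => // y Uy; exact: derive_dir_sum oU Uy C1.
rewrite (iterD_sum _ _ oU Ux).
  apply: eq_bigr => i _; rewrite iterD_cat.
  by apply: (iterDZ _ _ oU Ux); exact: smooth_D.
by move=> i; apply: (smoothZ _ oU); exact: smooth_D.
Qed.

End Directions.

Section Affine.
Variables (R : realType) (V V' : normedModType R).

Lemma iterD_affine (A : V -> V') (L : V -> V') (F : V' -> R) (w : seq V) x :
  (forall (h : R) v y, A (h *: v + y) = h *: L v + A y) ->
  iterD w (fun y => F (A y)) x = iterD (map L w) F (A x).
Proof.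
move=> AL; elim: w x => //= v w ih x.
rewrite (_ : iterD w _ = fun y => iterD (map L w) F (A y)); last exact/funext.
rewrite /derive.
have -> : (fun h : R => h^-1 *: (iterD (map L w) F (A (h *: v + x)) -
    iterD (map L w) F (A x))) = (fun h : R => h^-1 *: (iterD (map L w) F
    (h *: L v + A x) - iterD (map L w) F (A x))).
  by apply/funext => h; rewrite AL.
by [].
Qed.

Lemma smooth_affine (U : set V) (O : set V') (A L : V -> V') (F : V' -> R) :
  (forall (h : R) v y, A (h *: v + y) = h *: L v + A y) ->
  continuous A -> (forall x, U x -> O (A x)) ->
  smooth_real O F -> smooth_real U (fun y => F (A y)).
Proof.
move=> AL cA UO sF w x /UO Ox.
have E : iterD w (fun y => F (A y)) = fun y => iterD (map L w) F (A y).
  by apply/funext => y; exact: iterD_affine.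
have [cF dF] := sF (map L w) _ Ox.
rewrite E; split.
  apply: (@continuous_comp _ _ _ A (iterD (map L w) F)); [exact: cA|exact: cF].
move=> v; have := dF (L v); rewrite /derivable.
have -> : (fun h : R => h^-1 *: (iterD (map L w) F (A (h *: v + x)) -
    iterD (map L w) F (A x))) = (fun h : R => h^-1 *: (iterD (map L w) F
    (h *: L v + A x) - iterD (map L w) F (A x))).
  by apply/funext => h; rewrite AL.
by [].
Qed.

End Affine.

Section SmoothMore.
Variables (R : realType) (V : normedModType R).

Lemma smooth_comp1 (B : set V) (U : set R) (g : R -> R) (F : V -> R) :
  open B -> open U -> smooth_real U g -> smooth_real B F ->
  (forall x, B x -> U (F x)) -> smooth_real B (fun x => g (F x)).
Proof.
move=> oB oU /smooth_CkP Cg /smooth_CkP CF BU; apply/smooth_CkP => k.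
exact: (Ck_comp1 oB oU (Cg k) (CF k) BU).
Qed.

Lemma smooth_comp m (B : set V) (U : set 'rV[R]_m) (F : 'rV[R]_m -> R)
    (phi : V -> 'rV[R]_m) :
  open B -> open U -> smooth_real U F ->
  (forall i, smooth_real B (fun x => phi x 0 i)) ->
  (forall x, B x -> U (phi x)) -> smooth_real B (fun x => F (phi x)).
Proof.
move=> oB oU /smooth_CkP CF Cphi BU; apply/smooth_CkP => k.
apply: (Ck_comp oB oU (CF k) _ BU) => i.
by have /smooth_CkP := Cphi i.
Qed.

Lemma smooth_linear (U : set V) (L : {linear V -> R}) : open U -> continuous L ->
  smooth_real U L.
Proof. by move=> oU cL; apply/smooth_CkP => k; exact: Ck_linear. Qed.

End SmoothMore.

(** * Smooth functions of one variable *)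

Section OneVariable.
Variable R : realType.
Implicit Types (U : set R) (g : R -> R) (x : R).

Lemma is_derive_continuous g x (d : R) : is_derive x 1 g d -> {for x, continuous g}.
Proof.
by move=> [dg _]; apply: differentiable_continuous; exact/derivable1_diffP.
Qed.

Lemma Ck_derive k U g (g' : R -> R) : open U ->
  (forall x, U x -> is_derive x 1 g (g' x)) -> Ck k U g' -> Ck k.+1 U g.
Proof.
move=> oU dg Cg'.
have dgv x v : U x -> is_derive x v g (v * g' x).
  move=> Ux; have := is_derive_scale_dir v (dg x Ux).
  by rewrite [v *: 1]mulr1.
split; first by move=> x /dg; exact: is_derive_continuous.
split=> [x v /(dgv x v)[]//|v].
apply: (Ck_ext oU _ (Ck_mul oU (Ck_cst k v oU) Cg')) => x Ux.
by have [_ ->] := dgv x v Ux.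
Qed.

(** The derivative stays in the family P, so the order of differentiability can be raised
    indefinitely. The families used are the exponential, a sin + b cos, c x^-n and [flat_exp q];
    their parameters are what makes them stable. *)
Lemma smooth_derive_closed U (P : (R -> R) -> Prop) : open U ->
  (forall g, P g -> exists2 g', P g' & forall x, U x -> is_derive x 1 g (g' x)) ->
  forall g, P g -> smooth_real U g.
Proof.
move=> oU H g Pg; apply/smooth_CkP => k.
elim: k g Pg => [|k ih] g Pg; have [g' Pg' dg] := H g Pg.
  by split=> // x /dg; exact: is_derive_continuous.
exact: (Ck_derive oU dg (ih _ Pg')).
Qed.

Lemma smooth_of_derive U g (g' : R -> R) : open U ->
  (forall x, U x -> is_derive x 1 g (g' x)) -> smooth_real U g' -> smooth_real U g.
Proof.
move=> oU dg /smooth_CkP Cg'; apply/smooth_CkP => -[|k].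
  by split=> // x /dg; exact: is_derive_continuous.
exact: (Ck_derive oU dg (Cg' k)).
Qed.

Lemma smooth_expR : smooth_real setT (@expR R).
Proof.
apply: (@smooth_derive_closed _ (fun g => g = @expR R)) => //; first exact: openT.
by move=> g ->; exists (@expR R) => // x _; exact: is_derive_expR.
Qed.

Lemma smooth_sin_cos (a b : R) : smooth_real setT (fun x => a * sin x + b * cos x).
Proof.
apply: (@smooth_derive_closed _ (fun g => exists a b : R,
   g = fun x => a * sin x + b * cos x)) => //; last by exists a, b.
  exact: openT.
move=> _ [c [d ->]]; exists (fun x => (- d) * sin x + c * cos x); first by exists (- d), c.
move=> x _.
have H1 : is_derive x 1 (fun x => c * sin x) (c * cos x).
  exact: is_deriveZ.
have H2 : is_derive x 1 (fun x => d * cos x) (d * - sin x).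
  exact: is_deriveZ.
apply: (is_derive_eq (is_deriveD H1 H2)).
by rewrite mulrN addrC mulNr.
Qed.

Lemma smooth_sin : smooth_real setT (@sin R).
Proof.
apply: (smooth_ext openT _ (smooth_sin_cos 1 0)) => x _.
by rewrite mul1r mul0r addr0.
Qed.

Lemma smooth_cos : smooth_real setT (@cos R).
Proof.
apply: (smooth_ext openT _ (smooth_sin_cos 0 1)) => x _.
by rewrite mul1r mul0r add0r.
Qed.

Lemma open_neq0 : open [set x : R | x != 0].
Proof.
exact: open_neq.
Qed.

Lemma is_derive_inv x : x != 0 -> is_derive x 1 (@GRing.inv R) (- x ^- 2).
Proof.
move=> x0; have d := @derivable_id R R x 1; split; first exact: (derivableV x0 d).
have := @deriveV R R id x 1 x0 d.
by rewrite derive_id [_ *: 1]mulr1.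
Qed.

Lemma smooth_inv : smooth_real [set x : R | x != 0] (@GRing.inv R).
Proof.
refine (@smooth_derive_closed _ (fun g => exists (c : R) n,
   g = fun x => c * x^-1 ^+ n) _ _ _ _); first exact: open_neq0.
  move=> _ [c [n ->]]; exists (fun x => (- c * n%:R) * x^-1 ^+ n.+1).
    by exists (- c * n%:R), n.+1.
  move=> x /= x0.
  have H := is_derive_inv x0.
  have H2 := is_deriveX n H; rewrite exprfctE in H2.
  have H1 := is_deriveZ c H2.
  apply: (is_derive_eq H1).
  rewrite /GRing.scale /=; case: n {H1 H2} => [|n] /=; first by rewrite !(mul0r, mulr0).
  by rewrite -exprVn !exprS; ring.
exists 1, 1%N; apply/funext => x; by rewrite mul1r expr1.
Qed.

Lemma smooth_ln : smooth_real [set x : R | 0 < x] (@ln R).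
Proof.
have s : smooth_real [set x : R | 0 < x] (@GRing.inv R).
  by apply: smooth_sub smooth_inv => x /= x0; rewrite gt_eqF.
have d x : [set x : R | 0 < x] x -> is_derive x 1 (@ln R) x^-1.
  by move=> x0; exact: is_derive1_ln.
exact: (smooth_of_derive (@open_gt R 0) d s).
Qed.

End OneVariable.

(** * Smooth cut-off functions *)

Section Bump.
Variable R : realType.
Implicit Types (q : {poly R}) (x y : R).

Lemma horner_bound q : exists2 C : R, 0 <= C & forall y, 1 <= y ->
  `|q.[y]| <= C * y ^+ (size q).
Proof.
exists (\sum_(i < size q) `|q`_i|); first exact: sumr_ge0.
move=> y y1; rewrite horner_coef (le_trans (ler_norm_sum _ _ _))// mulr_suml.
apply: ler_sum => i _; rewrite normrM ler_wpM2l// normrX ger0_norm ?(le_trans _ y1)//.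
by apply: ler_weXn2l => //; rewrite ltnW.
Qed.

Lemma horner_expR_lim q (e : R) : 0 < e -> exists2 M : R, 0 < M & forall y, M < y ->
  `|q.[y] * expR (- y)| <= e.
Proof.
move=> e0; have [C C0 HC] := horner_bound q.
set d := size q in HC *.
(* For y >= 1 one has |q(y)| <= C y^d and exp y >= y^(d+1) / (d+1)!, so the product is at most C
   (d+1)! / y; the summand 1 ensures y >= 1. *)
exists (C * (d.+1)`!%:R / e + 1).
  by rewrite ltr_wpDl// divr_ge0 ?mulr_ge0// ltW.
move=> y yM.
have y1 : 1 <= y.
  by rewrite (le_trans _ (ltW yM))// lerDr divr_ge0 ?mulr_ge0// ltW.
have y0 : 0 < y by exact: lt_le_trans y1.
rewrite normrM (ger0_norm (expR_ge0 _)) expRN ler_pdivrMr ?expR_gt0//.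
rewrite (le_trans (HC _ y1))//.
have : y ^+ d.+1 / d.+1`!%:R <= expR y.
  by rewrite (le_trans _ (expR_ge1Dxn d (ltW y0)))// lerDr.
move=> H; rewrite (le_trans _ (ler_wpM2l (ltW e0) H))//.
have f0 : (0 : R) < d.+1`!%:R by rewrite ltr0n fact_gt0.
rewrite mulrA ler_pdivlMr// exprS.
have : C * d.+1`!%:R <= e * y.
  rewrite -ler_pdivrMl// mulrC; apply: ltW; apply: le_lt_trans yM.
  by rewrite lerDl.
move=> H2; have : C * d.+1`!%:R * y ^+ d <= e * y * y ^+ d by rewrite ler_wpM2r// exprn_ge0// ltW.
by rewrite -!mulrA [_`!%:R * _]mulrC.
Qed.

(** The polynomial factor makes the family stable under differentiation, which replaces q by X^2 (q
    - q'). *)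
Definition flat_exp q x : R := if 0 < x then q.[x^-1] * expR (- x^-1) else 0.

Lemma is_derive_flat_exp q x :
  is_derive x 1 (flat_exp q) (flat_exp ('X^2 * (q - q^`())) x).
Proof.
have [x0|x0|->] := ltgtP x 0.
- rewrite /flat_exp ltNge (ltW x0) /=.
  have E : \forall y \near x, (fun=> 0 : R) y =
      if 0 < y then q.[y^-1] * expR (- y^-1) else 0.
    have : \forall y \near x, y < 0 by exact: lt_nbhsl.
    by apply: filterS => y y0; rewrite ltNge (ltW y0).
  exact: (near_eq_is_derive E (is_derive_cst (0 : R) x 1)).
- rewrite /flat_exp x0.
  have E : \forall y \near x, (fun y : R => q.[y^-1] * expR (- y^-1)) y =
      if 0 < y then q.[y^-1] * expR (- y^-1) else 0.
    have : \forall y \near x, 0 < y by exact: lt_nbhsr.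
    by apply: filterS => y y0; rewrite y0.
  apply: (near_eq_is_derive E).
  have xn : x != 0 by rewrite gt_eqF.
  have H := is_derive_inv xn.
  have Hq := @is_derive_comp1 _ _ (horner q) (@GRing.inv R) x 1 (@ex_derive _ _ _ _ _ _ _ H)
    (@derivable_horner R q x^-1).
  have HN : is_derive x 1 (fun y : R => - y^-1) (x ^- 2).
    by apply: (is_derive_eq (is_deriveN H)); rewrite opprK.
  have He := @is_derive_comp1 _ _ (@expR R) _ x 1 (@ex_derive _ _ _ _ _ _ _ HN)
    (@ex_derive _ _ _ _ _ _ _ (is_derive_expR _)).
  apply: (is_derive_eq (is_deriveM Hq He)).
  rewrite -(derive1E (horner q)) -derivE (@derive_val _ _ _ _ _ _ _ H) (@derive_val _ _ _ _ _ _ _ HN).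
  rewrite (@derive_val _ _ _ _ _ _ _ (is_derive_expR _)).
  rewrite /GRing.scale /= hornerM hornerXn hornerD hornerN -exprVn; ring.
rewrite [X in is_derive _ _ _ X](_ : _ = 0); last by rewrite /flat_exp ltxx.
have L : (fun h : R => h^-1 *: (flat_exp q (h *: (1 : R) + 0) - flat_exp q 0)) @ 0^' -->
    (0 : R).
  apply/cvgrPdist_le => e e0.
  (* The factor ['X] accounts for the division by h in the difference quotient. *)
  have [M M0 HM] := horner_expR_lim ('X * q) e0.
  near=> h.
  have hM : `|h| < M^-1 by near: h; apply: dnbhs0_lt; rewrite invr_gt0.
  rewrite [h *: 1]mulr1 addr0 sub0r normrN {2}/flat_exp ltxx subr0 /flat_exp.
  case: ifPn => [h0|_]; last by rewrite scaler0 normr0 ltW.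
  have := HM h^-1; rewrite hornerM hornerX -mulrA; apply.
  by rewrite gtr0_norm// in hM; rewrite -ltf_pV2 ?posrE ?invr_gt0 ?invrK.
split; first by apply/cvg_ex; exists (0 : R).
exact/cvg_lim.
Unshelve. all: by end_near. Qed.

Lemma smooth_flat_exp q : smooth_real setT (flat_exp q).
Proof.
apply: (@smooth_derive_closed _ _ (fun g => exists q, g = flat_exp q)); first exact: openT.
  move=> _ [r ->]; exists (flat_exp ('X^2 * (r - r^`()))); first by eexists.
  by move=> x _; exact: is_derive_flat_exp.
by exists q.
Qed.

Lemma flat_exp1_gt0 x : 0 < x -> 0 < flat_exp 1 x.
Proof. by move=> x0; rewrite /flat_exp x0 hornerC mul1r expR_gt0. Qed.

Lemma flat_exp1_ge0 x : 0 <= flat_exp 1 x.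
Proof. by rewrite /flat_exp; case: ifP => // x0; rewrite hornerC mul1r expR_ge0. Qed.

Lemma flat_exp_le0 q x : x <= 0 -> flat_exp q x = 0.
Proof. by move=> x0; rewrite /flat_exp ltNge x0. Qed.

(** A smooth step from 1 down to 0 between 1 and 2. The denominator is positive because 2 - x and x
    - 1 are never both nonpositive. *)
Definition cutoff x : R :=
  flat_exp 1 (2 - x) / (flat_exp 1 (2 - x) + flat_exp 1 (x - 1)).

Lemma cutoff_den_gt0 x : 0 < flat_exp 1 (2 - x) + flat_exp 1 (x - 1).
Proof.
have [x2|x2] := ltP x 2; first by rewrite ltr_pwDl ?flat_exp1_ge0 ?flat_exp1_gt0 ?subr_gt0.
by rewrite ltr_wpDl ?flat_exp1_ge0 ?flat_exp1_gt0 ?subr_gt0 // (lt_le_trans _ x2)// ltr1n.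
Qed.

Lemma cutoff1 x : x <= 1 -> cutoff x = 1.
Proof.
move=> x1; have := cutoff_den_gt0 x; rewrite /cutoff.
rewrite (@flat_exp_le0 _ (x - 1)) ?subr_le0// addr0 => h.
by rewrite divff// gt_eqF.
Qed.

Lemma cutoff0 x : 2 <= x -> cutoff x = 0.
Proof. by move=> x2; rewrite /cutoff flat_exp_le0 ?mul0r// subr_le0. Qed.

Lemma smooth_cutoff : smooth_real setT cutoff.
Proof.
have oT := @openT R.
have sid : smooth_real setT (fun x : R => x).
  apply: (@smooth_of_derive _ _ _ (fun=> 1)) => //; last exact: smooth_cst.
have s1 : smooth_real setT (fun x : R => 2 - x).
  by apply: (smoothB oT _ sid); exact: smooth_cst.
have s2 : smooth_real setT (fun x : R => x - 1).
  by apply: (smoothB oT sid); exact: smooth_cst.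
have t1 := smooth_comp1 oT oT (smooth_flat_exp 1) s1 (fun _ _ => I).
have t2 := smooth_comp1 oT oT (smooth_flat_exp 1) s2 (fun _ _ => I).
apply: (smoothM oT t1).
apply: (smooth_comp1 oT (@open_neq0 R) (@smooth_inv R) (smoothD oT t1 t2)).
by move=> x _; rewrite /= gt_eqF// cutoff_den_gt0.
Qed.

End Bump.

Section Taylor.
Variable R : realType.

(** Induction on M by the mean value theorem, g listing the successive derivatives of [g 0]. The
    Taylor constant 1 / M! is dropped, as only the power of t matters. *)
Lemma taylor_flat (M : nat) (g : nat -> R -> R) (B : R) :
  (forall j (t : R), 0 <= t <= 1 -> is_derive t 1 (g j) (g j.+1 t)) ->
  (forall j, (j < M)%N -> g j 0 = 0) ->
  (forall t, 0 <= t <= 1 -> `|g M t| <= B) ->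
  forall t, 0 <= t <= 1 -> `|g 0%N t| <= B * t ^+ M.
Proof.
elim: M g => [|M ih] g dg g0 gB t t01; first by rewrite expr0 mulr1; exact: gB.
have H := ih (fun j => g j.+1) (fun j => dg j.+1) _ gB.
have {}H s : 0 <= s <= 1 -> `|g 1%N s| <= B * s ^+ M.
  by apply: H => j jM; exact: g0.
have B0 : 0 <= B by apply: le_trans (gB t t01).
have [t0 t1] := andP t01.
have [||s] := @MVT_segment R (g 0%N) (g 1%N) 0 t t0.
- move=> r; rewrite in_itv /= => /andP[s0 st]; apply: dg.
  by rewrite ltW //= (le_trans (ltW st)).
- apply: derivable_within_continuous => r; rewrite in_itv /= => /andP[s0 st].
  by have [] := dg 0%N r; rewrite ?s0 ?(le_trans st).
rewrite in_itv /= => /andP[s0 st]; rewrite g0// !subr0 => ->.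
rewrite normrM (ger0_norm t0) exprSr mulrA ler_wpM2r//.
rewrite (le_trans (H s _)) ?s0 ?(le_trans st)// ler_wpM2l//.
by rewrite lerXn2r ?nnegrE.
Qed.

End Taylor.

(** * Complex-valued smooth functions *)

Section ComplexSmooth.
Variables (R : realType).
Implicit Types z w : R[i].

Lemma cReD z w : complex.Re (z + w) = complex.Re z + complex.Re w.
Proof. by case: z => a b; case: w. Qed.
Lemma cImD z w : complex.Im (z + w) = complex.Im z + complex.Im w.
Proof. by case: z => a b; case: w. Qed.
Lemma cReM z w :
  complex.Re (z * w) = complex.Re z * complex.Re w - complex.Im z * complex.Im w.
Proof. by case: z => a b; case: w. Qed.
Lemma cImM z w :
  complex.Im (z * w) = complex.Re z * complex.Im w + complex.Im z * complex.Re w.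
Proof. by case: z => a b; case: w. Qed.
Lemma complexP z w : complex.Re z = complex.Re w -> complex.Im z = complex.Im w -> z = w.
Proof. by case: z => a b; case: w => c d /= -> ->. Qed.

Variable V : normedModType R.
Implicit Types (U : set V) (F G : V -> R[i]).

Definition csmooth U F : Prop :=
  smooth_real U (fun x => complex.Re (F x)) /\
  smooth_real U (fun x => complex.Im (F x)).

Lemma csmooth_ext U F G : open U -> (forall y, U y -> F y = G y) ->
  csmooth U F -> csmooth U G.
Proof.
by move=> oU FG [rF iF]; split; [apply: (smooth_ext oU _ rF)|apply: (smooth_ext oU _ iF)];
  move=> y Uy; rewrite FG.
Qed.

Lemma csmoothD U F G : open U -> csmooth U F -> csmooth U G ->
  csmooth U (fun x => F x + G x).
Proof.
move=> oU [rF iF] [rG iG]; split.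
  by apply: (smooth_ext oU _ (smoothD oU rF rG)) => y _; rewrite cReD.
by apply: (smooth_ext oU _ (smoothD oU iF iG)) => y _; rewrite cImD.
Qed.

Lemma csmoothM U F G : open U -> csmooth U F -> csmooth U G ->
  csmooth U (fun x => F x * G x).
Proof.
move=> oU [rF iF] [rG iG]; split.
  have := smoothB oU (smoothM oU rF rG) (smoothM oU iF iG).
  by apply: (smooth_ext oU) => y _; rewrite cReM.
have := smoothD oU (smoothM oU rF iG) (smoothM oU iF rG).
by apply: (smooth_ext oU) => y _; rewrite cImM.
Qed.

Lemma csmooth_cst U z : open U -> csmooth U (fun=> z).
Proof. by move=> oU; split; exact: smooth_cst. Qed.

Lemma csmooth_real U (f : V -> R) : open U -> smooth_real U f ->
  csmooth U (fun x => (f x)%:C).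
Proof. by move=> oU sf; split => //=; exact: smooth_cst. Qed.

Lemma csmoothZ U z F : open U -> csmooth U F -> csmooth U (fun x => z * F x).
Proof. by move=> oU sF; apply: (csmoothM oU _ sF); exact: csmooth_cst. Qed.

Lemma csmooth_sum U (I : Type) (r : seq I) (P : pred I) (F : I -> V -> R[i]) : open U ->
  (forall i, csmooth U (F i)) ->
  csmooth U (fun x => \sum_(i <- r | P i) F i x).
Proof.
move=> oU CF; elim: r => [|i r ih].
  by apply: (csmooth_ext oU _ (csmooth_cst 0 oU)) => y _; rewrite big_nil.
have [Pi|nPi] := boolP (P i).
  by apply: (csmooth_ext oU _ (csmoothD oU (CF i) ih)) => y _; rewrite [in RHS]big_cons Pi.
by apply: (csmooth_ext oU _ ih) => y _; rewrite [in RHS]big_cons (negbTE nPi).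
Qed.

Lemma csmooth_prod U (I : Type) (r : seq I) (F : I -> V -> R[i]) : open U ->
  (forall i, csmooth U (F i)) ->
  csmooth U (fun x => \prod_(i <- r) F i x).
Proof.
move=> oU CF; elim: r => [|i r ih].
  by apply: (csmooth_ext oU _ (csmooth_cst 1 oU)) => y _; rewrite big_nil.
by apply: (csmooth_ext oU _ (csmoothM oU (CF i) ih)) => y _; rewrite [in RHS]big_cons.
Qed.

Lemma csmoothX U F n : open U -> csmooth U F -> csmooth U (fun x => F x ^+ n).
Proof.
move=> oU sF; elim: n => [|n ih].
  by apply: (csmooth_ext oU _ (csmooth_cst 1 oU)) => y _; rewrite expr0.
by apply: (csmooth_ext oU _ (csmoothM oU sF ih)) => y _; rewrite exprS.
Qed.

Lemma csmooth_sub U B F : U `<=` B -> csmooth B F -> csmooth U F.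
Proof. by move=> UB [rF iF]; split; [exact: smooth_sub rF|exact: smooth_sub iF]. Qed.

Lemma csmooth_local U F : (forall x, U x -> exists2 B, B x & csmooth B F) ->
  csmooth U F.
Proof.
by move=> H; split; apply: smooth_local => x /H[B Bx [rF iF]]; exists B.
Qed.

Lemma csmooth_cexp U z (f : V -> R) : open U -> smooth_real U f ->
  csmooth U (fun x => cexp (z * (f x)%:C)).
Proof.
move=> oU sf.
have s1 := smoothZ (complex.Re z) oU sf; have s2 := smoothZ (complex.Im z) oU sf.
have e1 := smooth_comp1 oU openT (@smooth_expR R) s1 (fun _ _ => I).
have c2 := smooth_comp1 oU openT (@smooth_cos R) s2 (fun _ _ => I).
have c3 := smooth_comp1 oU openT (@smooth_sin R) s2 (fun _ _ => I).
have H : csmooth U (fun x => (expR (complex.Re z * f x))%:C *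
    (cos (complex.Im z * f x) +i* sin (complex.Im z * f x))).
  by apply: (csmoothM oU (csmooth_real oU e1)); split.
apply: (csmooth_ext oU _ H) => y _; rewrite /cexp cReM cImM /=.
by rewrite !mulr0 subr0 add0r.
Qed.

Lemma iterDC_ext U F G (w : seq V) x : open U -> (forall y, U y -> F y = G y) ->
  U x -> iterDC w F x = iterDC w G x.
Proof.
move=> oU FG Ux; congr (_ +i* _);
  by apply: (iterD_ext _ oU) => // y Uy; rewrite FG.
Qed.

Lemma iterDC_D U F G (w : seq V) x : open U -> U x -> csmooth U F -> csmooth U G ->
  iterDC w (fun y => F y + G y) x = iterDC w F x + iterDC w G x.
Proof.
move=> oU Ux [rF iF] [rG iG]; apply: complexP; rewrite ?cReD ?cImD /=.
  rewrite -(iterDD _ oU Ux rF rG); congr (iterD w _ x).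
  by apply/funext => y; rewrite cReD.
rewrite -(iterDD _ oU Ux iF iG); congr (iterD w _ x).
by apply/funext => y; rewrite cImD.
Qed.

Lemma iterDC_Z U F z (w : seq V) x : open U -> U x -> csmooth U F ->
  iterDC w (fun y => z * F y) x = z * iterDC w F x.
Proof.
move=> oU Ux [rF iF]; apply: complexP; rewrite ?cReM ?cImM /=.
  have s1 := smoothZ (complex.Re z) oU rF.
  have s2 := smoothZ (- complex.Im z) oU iF.
  rewrite -mulNr -(iterDZ _ _ oU Ux rF) -(iterDZ _ _ oU Ux iF) -(iterDD _ oU Ux s1 s2).
  by congr (iterD w _ x); apply/funext => y; rewrite cReM mulNr.
have s1 := smoothZ (complex.Re z) oU iF.
have s2 := smoothZ (complex.Im z) oU rF.
rewrite -(iterDZ _ _ oU Ux iF) -(iterDZ _ _ oU Ux rF) -(iterDD _ oU Ux s1 s2).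
by congr (iterD w _ x); apply/funext => y; rewrite cImM.
Qed.

Lemma iterDC_sum U (I : Type) (r : seq I) (F : I -> V -> R[i]) (w : seq V) x :
  open U -> U x -> (forall i, csmooth U (F i)) ->
  iterDC w (fun y => \sum_(i <- r) F i y) x = \sum_(i <- r) iterDC w (F i) x.
Proof.
move=> oU Ux sF; elim: r => [|i r ih].
  rewrite big_nil; apply: complexP => /=; rewrite -[RHS](iterD_zero w x);
  by congr (iterD w _ x); apply/funext => y; rewrite big_nil.
rewrite big_cons -ih -(iterDC_D _ oU Ux (sF i)).
  by congr (iterDC w _ x); apply/funext => y; rewrite big_cons.
exact: csmooth_sum.
Qed.

Lemma iterDC_perm U F (w w' : seq V) x : open U -> U x -> csmooth U F ->
  perm_eq w w' -> iterDC w F x = iterDC w' F x.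
Proof.
by move=> oU Ux [rF iF] ww'; congr (_ +i* _);
  [exact: (iterD_perm oU Ux rF)|exact: (iterD_perm oU Ux iF)].
Qed.

Lemma iterDC_cat F (w w' : seq V) : iterDC (w ++ w') F = iterDC w (iterDC w' F).
Proof. by apply/funext => x; rewrite /iterDC /= !iterD_cat. Qed.

Lemma csmooth_iterDC U F (w : seq V) : csmooth U F -> csmooth U (iterDC w F).
Proof. by move=> [rF iF]; split; exact: smooth_iterD. Qed.

Lemma iterDC_dir_sum U F x (I : Type) (s : seq I) (c : I -> R) (v : I -> V)
    (w1 w2 : seq V) : open U -> U x -> csmooth U F ->
  iterDC (w1 ++ (\sum_(i <- s) c i *: v i) :: w2) F x =
  \sum_(i <- s) (c i)%:C * iterDC (w1 ++ v i :: w2) F x.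
Proof.
move=> oU Ux [rF iF].
have E (a : I -> R[i]) : \sum_(i <- s) a i =
    (\sum_(i <- s) complex.Re (a i)) +i* (\sum_(i <- s) complex.Im (a i)).
  by elim: (s) => [|i r ih]; rewrite ?big_nil// !big_cons ih; apply: complexP;
    rewrite ?cReD ?cImD.
rewrite E /iterDC (iterD_dir_sum _ _ _ _ _ oU Ux rF) (iterD_dir_sum _ _ _ _ _ oU Ux iF).
by congr (_ +i* _); apply: eq_bigr => i _; rewrite ?cReM ?cImM /= mul0r ?subr0 ?addr0.
Qed.

Lemma smooth_on_csmooth U F : @smooth_on R V (R[i]^o : vectType R[i]) U F -> csmooth U F.
Proof.
move=> sF; split.
  have := sF \1%VF; congr (smooth_real U _).
  by apply/funext => x; rewrite id_lfunE.
(* Multiplication by -i turns the imaginary part into a real part: Re (-i z) = Im z. *)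
have := sF ((- 'i%C) *: \1%VF); congr (smooth_real U _).
apply/funext => x; rewrite scale_lfunE id_lfunE [_ *: _]/(_ * _) cReM /=.
by rewrite oppr0 mul0r sub0r mulN1r opprK.
Qed.

Lemma csmooth_smooth_on U (F : V -> R[i]) : open U -> csmooth U F ->
  @smooth_on R V (R[i]^o : vectType R[i]) U F.
Proof.
move=> oU sF phi; have [s _] := csmoothZ (phi 1) oU sF.
apply: (smooth_ext oU _ s) => y _; rewrite mulrC.
by rewrite -[F y * phi 1]/(F y *: phi 1) -linearZ /= [_%:A]mulr1.
Qed.

End ComplexSmooth.

Section ComplexAffine.
Variables (R : realType) (V V' : normedModType R).

Lemma iterDC_affine (A : V -> V') (L : V -> V') (F : V' -> R[i]) (w : seq V) x :
  (forall (h : R) v y, A (h *: v + y) = h *: L v + A y) ->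
  iterDC w (fun y => F (A y)) x = iterDC (map L w) F (A x).
Proof.
by move=> AL; congr (_ +i* _);
  [exact: (iterD_affine (fun y => complex.Re (F y)))|
   exact: (iterD_affine (fun y => complex.Im (F y)))].
Qed.

Lemma csmooth_affine (U : set V) (B : set V') (A L : V -> V') (F : V' -> R[i]) :
  (forall (h : R) v y, A (h *: v + y) = h *: L v + A y) ->
  continuous A -> (forall x, U x -> B (A x)) ->
  csmooth B F -> csmooth U (fun y => F (A y)).
Proof.
by move=> AL cA UB [rF iF]; split;
  [exact: (smooth_affine AL cA UB rF)|exact: (smooth_affine AL cA UB iF)].
Qed.

Lemma csmooth_comp m (B : set V) (U : set 'rV[R]_m) (F : 'rV[R]_m -> R[i])
    (phi : V -> 'rV[R]_m) :
  open B -> open U -> csmooth U F ->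
  (forall i, smooth_real B (fun x => phi x 0 i)) ->
  (forall x, B x -> U (phi x)) -> csmooth B (fun x => F (phi x)).
Proof.
by move=> oB oU [rF iF] sphi BU; split;
  [exact: (smooth_comp oB oU rF sphi BU)|exact: (smooth_comp oB oU iF sphi BU)].
Qed.

End ComplexAffine.

(** * The groups and their charts *)

Section MatrixMaps.
Variable R : realType.

Lemma continuous_mx (V : normedModType R) m n (phi : V -> 'M[R]_(m, n)) x :
  (forall i j, {for x, continuous (fun y => phi y i j)}) -> {for x, continuous phi}.
Proof.
move=> H; apply/cvgrPdist_le => e e0.
have {}H (ij : 'I_m * 'I_n) :
    \forall y \near x, `|phi x ij.1 ij.2 - phi y ij.1 ij.2| <= e.
  by have /cvgrPdist_le/(_ _ e0) := H ij.1 ij.2.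
have {}H : \forall y \near x, forall ij : 'I_m * 'I_n,
    `|phi x ij.1 ij.2 - phi y ij.1 ij.2| <= e.
  exact: filter_forall H.
apply: filterS H => y Hy.
rewrite [leLHS]/Num.Def.normr/= mx_normrE; apply: bigmax_le; first exact: ltW.
by move=> [i j] _ /=; rewrite !mxE; exact: (Hy (i, j)).
Qed.

Lemma continuous_mx_linear m n m' n' (L : 'M[R]_(m, n) -> 'M[R]_(m', n')) :
  linear L -> continuous L.
Proof.
move=> lL x; apply: continuous_mx => i j.
have H0 : L 0 = 0 by have := lL (-1) 0 0; rewrite scaler0 addr0 scaleN1r addNr.
have LD u v : L (u + v) = L u + L v by have := lL 1 u v; rewrite !scale1r.
have LZ a u : L (a *: u) = a *: L u by have := lL a u 0; rewrite H0 !addr0.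
have E : (fun y => L y i j) =
    fun y => \sum_(k < m) \sum_(l < n) y k l * L (delta_mx k l) i j.
  apply/funext => y; rewrite {1}(matrix_sum_delta y).
  rewrite (big_morph L LD H0) summxE; apply: eq_bigr => k _.
  rewrite (big_morph L LD H0) summxE; apply: eq_bigr => l _.
  by rewrite LZ mxE.
move: x; rewrite -/(continuous (fun y => L y i j)) E.
apply: continuous_big; first by move=> ?; exact: add_continuous.
move=> k _; apply: continuous_big; first by move=> ?; exact: add_continuous.
move=> l _ y; apply: (@continuousM R _ (fun z : 'M[R]_(m, n) => z k l) (fun=> _) y).
  exact: coord_continuous.
exact: cst_continuous.
Qed.

End MatrixMaps.

(** * Matrix forms of N_+, N_-, A and P *)

Section Exponentials.
Variables (R : realType) (k : nat).

Lemma expmx_nilp (A : 'M[R]_k.+1) : A *m A = 0 -> expmx A = 1%:M + A.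
Proof.
move=> A2; apply/matrixP => i j; rewrite mxE.
apply: norm_lim_near_cst; exists 2%N => // n /= n2.
have Ar r : (1 < r)%N -> A ^+ r = 0.
  by case: r => [|[|r]] // _; rewrite !exprS mulrA [A * A]A2 mul0r.
rewrite /series /= (@big_cat_nat _ _ _ 2%N) //= [X in _ + X]big1_seq; last first.
  by move=> r /andP[_]; rewrite mem_index_iota => /andP[r2 _]; rewrite Ar// mxE mul0r.
rewrite addr0 big_nat_recl// big_nat1 expr0 expr1 !fact0 !divr1.
by rewrite -idmxE [RHS]mxE.
Qed.

Lemma diag_mxX (d : 'rV[R]_k.+1) n : diag_mx d ^+ n = diag_mx (\row_i (d 0 i ^+ n)).
Proof.
elim: n => [|n ih].
  by rewrite expr0; apply/matrixP => i j; rewrite !mxE expr0.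
rewrite exprS ih [_ * _]mulmx_diag; congr diag_mx.
by apply/rowP => i; rewrite !mxE exprS.
Qed.

Lemma expmx_diag (d : 'rV[R]_k.+1) :
  expmx (diag_mx d) = diag_mx (\row_i expR (d 0 i)).
Proof.
apply/matrixP => i j; rewrite !mxE.
have [<-|ij] := eqVneq i j.
  rewrite mulr1n /expR; congr (limn (series _)).
  by apply/funext => n; rewrite diag_mxX !mxE eqxx mulr1n.
rewrite mulr0n; apply: norm_lim_near_cst; exists 0%N => // n _ /=.
by rewrite /series /= big1// => r _; rewrite diag_mxX !mxE (negbTE ij) mulr0n mul0r.
Qed.

Section BlockEntries.
Variables (T : Type) (a : 'M[T]_1) (b : 'M[T]_(1, k)) (c : 'M[T]_(k, 1)) (d : 'M[T]_k).
Lemma block1E00 : block_mx a b c d ord0 ord0 = a 0 0.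
Proof.
have {1 2}-> : ord0 = lshift k (0 : 'I_1) by exact/val_inj.
by rewrite block_mxEul.
Qed.
Lemma block1E0l j : block_mx a b c d ord0 (lift ord0 j) = b 0 j.
Proof.
have {1}-> : ord0 = lshift k (0 : 'I_1) by exact/val_inj.
by rewrite -[lift ord0 j]rshift1 block_mxEur.
Qed.
Lemma block1El0 i : block_mx a b c d (lift ord0 i) ord0 = c i 0.
Proof.
have {2}-> : ord0 = lshift k (0 : 'I_1) by exact/val_inj.
by rewrite -[lift ord0 i]rshift1 block_mxEdl.
Qed.
Lemma block1Ell i j : block_mx a b c d (lift ord0 i) (lift ord0 j) = d i j.
Proof. by rewrite -[lift ord0 i]rshift1 -[lift ord0 j]rshift1 block_mxEdr. Qed.
Definition block1E := (block1E00, block1E0l, block1El0, block1Ell).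
End BlockEntries.

Lemma matrix1P (T : Type) (A B : 'M[T]_k.+1) :
  A ord0 ord0 = B ord0 ord0 ->
  (forall j, A ord0 (lift ord0 j) = B ord0 (lift ord0 j)) ->
  (forall i, A (lift ord0 i) ord0 = B (lift ord0 i) ord0) ->
  (forall i j, A (lift ord0 i) (lift ord0 j) = B (lift ord0 i) (lift ord0 j)) -> A = B.
Proof.
move=> h00 h0l hl0 hll; apply/matrixP => i j.
by case: (unliftP ord0 i) => [i1 ->|->]; case: (unliftP ord0 j) => [j1 ->|->].
Qed.

Lemma sum_NplusE (x : 'rV[R]_k) :
  \sum_j x 0 j *: Nplus R j = block_mx (0 : 'M[R]_1) x 0 0.
Proof.
apply: matrix1P => [|j|i|i j]; rewrite block1E summxE ?mxE.
- by rewrite big1// => j _; rewrite !mxE mulr0.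
- rewrite (bigD1 j)//= !mxE !eqxx mulr1 big1 ?addr0// => j' j'j.
  by rewrite !mxE (inj_eq (@lift_inj _ _)) eq_sym (negbTE j'j) mulr0.
- by rewrite big1// => j _; rewrite !mxE mulr0.
by rewrite big1// => j' _; rewrite !mxE mulr0.
Qed.

Lemma sum_NminusE (x : 'rV[R]_k) :
  \sum_j x 0 j *: Nminus R j = block_mx (0 : 'M[R]_1) 0 x^T 0.
Proof.
apply: matrix1P => [|j|i|i j]; rewrite block1E summxE ?mxE.
- by rewrite big1// => j _; rewrite !mxE mulr0.
- by rewrite big1// => j' _; rewrite !mxE andbF mulr0.
- rewrite (bigD1 i)//= !mxE !eqxx mulr1 big1 ?addr0// => j' j'j.
  by rewrite !mxE (inj_eq (@lift_inj _ _)) eq_sym (negbTE j'j) mulr0.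
by rewrite big1// => j' _; rewrite !mxE andbF mulr0.
Qed.

Lemma nplusE (x : 'rV[R]_k) : nplus x = block_mx (1%:M : 'M[R]_1) x 0 1%:M.
Proof.
rewrite /nplus sum_NplusE expmx_nilp.
  by apply: matrix1P => [|j|i|i j]; rewrite mxE !block1E !mxE ?(addr0, add0r)//
    ?eqxx ?(inj_eq (@lift_inj _ _)).
have H := @mulmx_block R 1 k 1 k 1 k 0 x 0 0 0 x 0 0.
by rewrite !(mul0mx, mulmx0, addr0) block_mx0 in H; exact: H.
Qed.

Lemma nminus_sum (x : 'rV[R]_k) : nminus x = 1%:M + \sum_j x 0 j *: Nminus R j.
Proof.
rewrite /nminus sum_NminusE expmx_nilp//.
have H := @mulmx_block R 1 k 1 k 1 k 0 0 x^T 0 0 0 x^T 0.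
by rewrite !(mul0mx, mulmx0, addr0) block_mx0 in H; exact: H.
Qed.

Lemma nminusE (x : 'rV[R]_k) : nminus x = block_mx (1%:M : 'M[R]_1) 0 x^T 1%:M.
Proof.
rewrite nminus_sum sum_NminusE.
by apply: matrix1P => [|j|i|i j]; rewrite mxE !block1E !mxE ?(addr0, add0r)//
  ?eqxx ?(inj_eq (@lift_inj _ _)).
Qed.

Lemma a_eltE (t : R) : (0 < k)%N ->
  a_elt k t = block_mx ((expR t)%:M : 'M[R]_1) 0 0 (expR (- (t / k%:R)))%:M.
Proof.
move=> k0; have kn : k%:R != 0 :> R by rewrite pnatr_eq0 -lt0n.
rewrite /a_elt /H0.
have -> : t *: (k%:R^-1 *: diag_mx (\row_(j < k.+1) (if j == ord0 then k%:R else -1))) =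
  diag_mx (\row_(j < k.+1) (if j == ord0 then t else - (t / k%:R))).
  apply/matrixP => i j; rewrite !mxE; case: (i == j); last by rewrite !mulr0n !mulr0.
  by rewrite !mulr1n; case: ifP => _; rewrite ?mulVf ?mulr1// mulrN1 mulrN.
rewrite expmx_diag; apply: matrix1P => [|j|i|i j]; rewrite block1E !mxE ?eqxx ?mulr1n//.
Qed.

End Exponentials.

Section Parabolic.
Variables (R : realType) (k : nat).
Hypothesis k_gt0 : (0 < k)%N.
Implicit Types (g h : 'M[R]_k.+1) (m : 'M[R]_k) (t : R) (x y : 'rV[R]_k).

Definition p_elt m t x : 'M[R]_k.+1 := m_elt m *m a_elt k t *m nplus x.

Lemma p_eltE m t x : p_elt m t x =
  block_mx ((\det m)^-1 * expR t)%:M ((\det m)^-1 * expR t *: x)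
           0 (expR (- (t / k%:R)) *: m).
Proof.
rewrite /p_elt /m_elt /diag_first (a_eltE _ k_gt0) nplusE.
have H1 := @mulmx_block R 1 k 1 k 1 k ((\det m)^-1)%:M 0 0 m
  (expR t)%:M 0 0 (expR (- (t / k%:R)))%:M.
rewrite H1 !(mul0mx, mulmx0, addr0, add0r).
have H2 := @mulmx_block R 1 k 1 k 1 k ((\det m)^-1%:M *m (expR t)%:M) 0 0
  (m *m (expR (- (t / k%:R)))%:M) 1%:M x 0 1%:M.
rewrite H2 !(mul0mx, mulmx0, addr0, add0r, mulmx1).
by rewrite -scalar_mxM mul_scalar_mx mul_mx_scalar.
Qed.

Lemma nminus_mulE g x i : (g *m nminus x) i ord0 = g i ord0 + \sum_j g i (lift ord0 j) * x 0 j.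
Proof.
rewrite mxE big_ord_recl nminusE block1E mxE eqxx mulr1; congr (_ + _).
by apply: eq_bigr => j _; rewrite block1E mxE.
Qed.

Lemma nminus00 x : nminus x ord0 ord0 = 1.
Proof. by rewrite nminusE block1E mxE eqxx. Qed.

Lemma nminusl0 x i : nminus x (lift ord0 i) ord0 = x 0 i.
Proof. by rewrite nminusE block1E mxE. Qed.

Lemma nminus0 : nminus (0 : 'rV[R]_k) = 1%:M.
Proof. by rewrite nminusE trmx0 -scalar_mx_block. Qed.

Lemma nminusD x y : nminus (x + y) = nminus x *m nminus y.
Proof.
rewrite !nminusE; have H := @mulmx_block R 1 k 1 k 1 k 1%:M 0 x^T 1%:M 1%:M 0 y^T 1%:M.
by rewrite H !(mul0mx, mulmx0, addr0, add0r, mulmx1, mul1mx) linearD.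
Qed.

Lemma det_nminus x : \det (nminus x) = 1.
Proof.
rewrite nminusE; have H := @det_lblock R 1 k 1%:M x^T 1%:M.
by rewrite H !det1 mulr1.
Qed.

Lemma SL_nminus x : SL k.+1 (nminus x).
Proof. exact: det_nminus. Qed.

Lemma SL1 n : SL n (1%:M : 'M[R]_n).
Proof. exact: det1. Qed.

Lemma SLM n (g h : 'M[R]_n) : SL n g -> SL n h -> SL n (g *m h).
Proof. by rewrite /SL /mkset => gs hs; rewrite det_mulmx gs hs mulr1. Qed.

Lemma SL_unit n (g : 'M[R]_n) : SL n g -> g \in unitmx.
Proof. by move=> /= gs; rewrite unitmxE gs unitr1. Qed.

Lemma SLpm_unit n (g : 'M[R]_n) : SLpm n g -> g \in unitmx.
Proof. by move=> /= [] gs; rewrite unitmxE gs ?unitr1 ?unitrN1. Qed.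

Lemma SLV n (g : 'M[R]_n) : SL n g -> SL n (invmx g).
Proof. by rewrite /SL /mkset => gs; rewrite det_inv gs invr1. Qed.

Lemma SLM_iff n (g h : 'M[R]_n) : SL n g -> (SL n (g *m h) <-> SL n h).
Proof. by rewrite /SL /mkset => gs; rewrite det_mulmx gs mul1r. Qed.

Lemma SLpmV n (g : 'M[R]_n) : SLpm n g -> SLpm n (invmx g).
Proof. by rewrite /SLpm /mkset => -[] gs; rewrite det_inv gs ?invr1 ?invrN1; [left|right]. Qed.

Lemma SL_SLpm n (g : 'M[R]_n) : SL n g -> SLpm n g.
Proof. by left. Qed.

Lemma det_p_elt m t x : SLpm k m -> \det (p_elt m t x) = 1.
Proof.
move=> sm; rewrite p_eltE.
have H := @det_ublock R 1 k ((\det m)^-1 * expR t)%:M ((\det m)^-1 * expR t *: x)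
  (expR (- (t / k%:R)) *: m).
rewrite H det_scalar1 detZ -expRM_natr mulNr divfK ?pnatr_eq0 -?lt0n//.
have d0 : \det m != 0 by have := SLpm_unit sm; rewrite unitmxE unitfE.
by rewrite expRN; field; rewrite d0 gt_eqF ?expR_gt0.
Qed.

Lemma p_elt_mul0 g m t x i : (g *m p_elt m t x) i ord0 = g i ord0 * ((\det m)^-1 * expR t).
Proof.
rewrite mxE big_ord_recl p_eltE block1E mxE eqxx mulr1n big1 ?addr0// => j _.
by rewrite block1E mxE mulr0.
Qed.

End Parabolic.

Section Homogeneity.
Variables (R : realType) (alpha : bool) (lambda : R[i]).
Implicit Types (c d t : R).

Lemma cexpD (z w : R[i]) : cexp (z + w) = cexp z * cexp w.
Proof.
rewrite /cexp cReD cImD expRD cosD sinD; by apply: complexP; rewrite ?(cReM, cImM) /=; ring.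
Qed.

Lemma cexp0 : cexp (0 : R[i]) = 1.
Proof. by rewrite /cexp /= expR0 cos0 sin0; apply: complexP; rewrite ?(cReM, cImM) /=; ring. Qed.

(* The factor by which a section of I is multiplied when the first column of
   its argument, on which alone it depends, is multiplied by c. *)
Definition hfac c : R[i] :=
  cexp (- (lambda * (ln `|c|)%:C)) * (Num.sg c)%:C ^+ alpha.

Lemma hfacM c d : c != 0 -> d != 0 -> hfac (c * d) = hfac c * hfac d.
Proof.
move=> c0 d0; rewrite /hfac normrM lnM ?posrE ?normr_gt0//.
rewrite rmorphD mulrDr opprD cexpD sgrM rmorphM exprMn.
by rewrite mulrACA.
Qed.

Lemma hfac1 : hfac 1 = 1.
Proof. by rewrite /hfac normr1 ln1 mulr0 oppr0 cexp0 sgr1 mul1r expr1n. Qed.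

Lemma hfac_gt0 c : 0 < c -> hfac c = cexp (- (lambda * (ln c)%:C)).
Proof. by move=> c0; rewrite /hfac gtr0_norm// gtr0_sg// rmorph1 expr1n mulr1. Qed.

(** The logarithm of |u| is taken as half that of u^2, and the sign of u as u exp (- ln |u|); both
    are smooth where u does not vanish. *)
Lemma csmooth_hfac (V : normedModType R) (U : set V) (u : V -> R) : open U ->
  smooth_real U u -> (forall x, U x -> u x != 0) -> csmooth U (fun x => hfac (u x)).
Proof.
move=> oU su u0.
have s2 := smoothX 2 oU su.
have sl : smooth_real U (fun x => 2^-1 * ln (u x ^+ 2)).
  apply: (smoothZ _ oU).
  apply: (smooth_comp1 oU (@open_gt R 0) (@smooth_ln R) s2) => x Ux.
  by rewrite /= exprn_even_gt0//= u0.
have e1 := smooth_comp1 oU openT (@smooth_expR R) (smoothN oU sl) (fun _ _ => I).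
have ss := csmoothX alpha oU (csmooth_real oU (smoothM oU su e1)).
have := csmoothM oU (csmooth_cexp (- lambda) oU sl) ss.
apply: (csmooth_ext oU) => x Ux.
have ux := u0 x Ux; have ux0 : 0 < `|u x| by rewrite normr_gt0.
have -> : 2^-1 * ln (u x ^+ 2) = ln `|u x|.
  rewrite -real_normK ?num_real// lnXn// [ln _ *+ 2]mulr2n; lra.
have -> : u x * expR (- ln `|u x|) = Num.sg (u x).
  by rewrite expRN lnK ?posrE// [X in X / _]numEsg mulfK// gt_eqF.
by rewrite /hfac mulNr.
Qed.

End Homogeneity.

(** * The chart N_- of G/P and the cut-off sections *)

Section Chart.
Variables (R : realType) (k : nat).
Hypothesis k_gt0 : (0 < k)%N.
Variables (alpha : bool) (lambda : R[i]).
Implicit Types (g h : 'M[R]_k.+1) (x : 'rV[R]_k).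
Local Notation hfac := (hfac alpha lambda).
Local Notation I := (@I_triv R k alpha lambda).

(** Affine coordinates of the point of projective space spanned by the first column; they are 0 by
    default when the corner entry vanishes. *)
Definition chart g : 'rV[R]_k := \row_i (g (lift ord0 i) ord0 / g ord0 ord0).

Lemma chart_nminus x : chart (nminus x) = x.
Proof. by apply/rowP => i; rewrite mxE nminusl0 nminus00 divr1. Qed.

Lemma mul_nminusl0 x g j : (nminus x *m g) ord0 j = g ord0 j.
Proof.
rewrite mxE big_ord_recl nminusE block1E mxE eqxx mul1r big1 ?addr0// => i _.
by rewrite block1E mxE mul0r.
Qed.

Lemma mul_nminus_lift x g i j :
  (nminus x *m g) (lift ord0 i) j = x 0 i * g ord0 j + g (lift ord0 i) j.
Proof.
rewrite mxE big_ord_recl nminusE block1E mxE; congr (_ + _).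
rewrite (bigD1 i)//= block1E mxE eqxx mul1r big1 ?addr0// => l li.
by rewrite block1E mxE eq_sym (negbTE li) mul0r.
Qed.

(** The factorisation of the big cell N_- M A N_+. Once the N_- factor is removed the first column
    is (c, 0, ..., 0), and |c| and the sign of c give the A part and the determinant of the M
    part. *)
Lemma chart_factor g : SL k.+1 g -> g ord0 ord0 != 0 -> exists m y,
  [/\ SLpm k m, \det m = Num.sg (g ord0 ord0) &
    g = nminus (chart g) *m p_elt m (ln `|g ord0 ord0|) y].
Proof.
move=> gS; set c := g ord0 ord0 => c0.
pose t := ln `|c|.
have et : expR t = `|c| by rewrite lnK// posrE normr_gt0.
have [B [B00 Bl0 gB detB]] : exists B : 'M[R]_k.+1, [/\ B ord0 ord0 = c,
    forall i, B (lift ord0 i) ord0 = 0, g = nminus (chart g) *m B & \det B = 1].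
  exists (nminus (- chart g) *m g); split; first by rewrite mul_nminusl0.
  - by move=> i; rewrite mul_nminus_lift !mxE mulNr divfK// addNr.
  - by rewrite mulmxA -nminusD addrN nminus0 mul1mx.
  by rewrite det_mulmx det_nminus mul1r.
pose D := \matrix_(i < k, j < k) B (lift ord0 i) (lift ord0 j).
(* The lower block has determinant 1 / c, and exp (t / k)^k = |c|, so the rescaled block has the
   sign of c as determinant. *)
pose m := expR (t / k%:R) *: D.
have BE : B = block_mx (c%:M : 'M[R]_1) (\row_j B ord0 (lift ord0 j)) 0 D.
  apply: matrix1P => [|j|i|i j]; rewrite block1E !mxE//.
have cD : c * \det D = 1.
  have := @det_ublock R 1 k (c%:M) (\row_j B ord0 (lift ord0 j)) D.
  by rewrite -BE detB det_scalar1.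
have dm : \det m = Num.sg c.
  rewrite detZ -expRM_natr divfK ?pnatr_eq0 -?lt0n// et.
  by rewrite [`|c|]normrEsg -mulrA cD mulr1.
have sgE : (Num.sg c)^-1 * `|c| = c.
  by rewrite normrEsg mulKf// sgr_eq0.
exists m, (\row_j (B ord0 (lift ord0 j) / c)); split=> //.
  by rewrite /SLpm /mkset dm; case: sgrP c0 => // _ _; [left|right].
rewrite [LHS]gB; congr (_ *m _).
apply: matrix1P => [|j|i|i j]; rewrite p_eltE// !block1E !mxE ?dm ?et ?sgE.
- by rewrite B00 eqxx mulr1n.
- by rewrite mulrC divfK.
- by rewrite Bl0.
by rewrite mulrA -expRD addNr expR0 mul1r.
Qed.

Lemma I_p_elt f g m t y : I f -> SL k.+1 g -> SLpm k m ->
  f (g *m p_elt m t y) = cexp (- (lambda * t%:C)) * ((Num.sg (\det m))%:C ^+ alpha * f g).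
Proof.
move=> [_ _ If] gS mS; rewrite (If g gS m t y mS) /sgn_twist /triv_rep det_inv.
by rewrite sgrV.
Qed.

Lemma I_chart f g : I f -> SL k.+1 g -> g ord0 ord0 != 0 ->
  f g = hfac (g ord0 ord0) * f (nminus (chart g)).
Proof.
move=> If gS c0; have [m [y [mS dm {1}->]]] := chart_factor gS c0.
rewrite (I_p_elt _ _ If (SL_nminus _) mS) dm sgr_id.
by rewrite /hfac mulrA.
Qed.

Definition col_norm2 g : R := \sum_i g i ord0 ^+ 2.

(** Homogeneous of degree 0 in the first column, hence invariant under P on the right. The factor 3
    puts the thresholds of [cutoff] where the square of the corner entry is 2/3, resp. 1/3, of the
    squared norm of the column. *)
Definition chi g : R := cutoff (3 * (1 - g ord0 ord0 ^+ 2 / col_norm2 g)).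

Lemma col_norm2_ge g : g ord0 ord0 ^+ 2 <= col_norm2 g.
Proof. by rewrite /col_norm2 big_ord_recl lerDl sumr_ge0// => i _; rewrite sqr_ge0. Qed.

Lemma col_norm2_gt0 g : SL k.+1 g -> 0 < col_norm2 g.
Proof.
move=> gS; rewrite lt_def sumr_ge0 ?andbT; last by move=> i _; exact: sqr_ge0.
apply/eqP => /eqP; rewrite psumr_eq0; last by move=> i _; exact: sqr_ge0.
move=> /allP H; have : \det g = 0.
  rewrite (expand_det_col g ord0) big1// => i _.
  have := H i; rewrite mem_index_enum => /(_ isT); rewrite sqrf_eq0 => /eqP ->.
  by rewrite mul0r.
by rewrite gS => /eqP; rewrite oner_eq0.
Qed.

Lemma smooth_entry (U : set 'M[R]_k.+1) i j : open U -> smooth_real U (fun g => g i j).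
Proof.
move=> oU.
have l : linear (fun g : 'M[R]_k.+1 => g i j) by move=> a u v; rewrite !mxE.
pose L : {linear 'M[R]_k.+1 -> R} := HB.pack (fun g : 'M[R]_k.+1 => g i j)
  (GRing.isLinear.Build R _ _ _ _ l).
by apply: (@smooth_linear _ _ U L) => //; exact: coord_continuous.
Qed.

Lemma smooth_col_norm2 (U : set 'M[R]_k.+1) : open U -> smooth_real U col_norm2.
Proof.
by move=> oU; apply: smooth_sum => // i _; apply: smoothX => //; exact: smooth_entry.
Qed.

Lemma smooth_chi (U : set 'M[R]_k.+1) : open U -> (forall g, U g -> col_norm2 g != 0) ->
  smooth_real U chi.
Proof.
move=> oU U0.
have sV := smooth_comp1 oU (@open_neq0 R) (@smooth_inv R) (smooth_col_norm2 oU) U0.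
have sq := smoothM oU (smoothX 2 oU (smooth_entry ord0 ord0 oU)) sV.
have s3 := smoothZ 3 oU (smoothB oU (smooth_cst 1 oU) sq).
exact: (smooth_comp1 oU openT (@smooth_cutoff R) s3 (fun _ _ => Logic.I)).
Qed.

Lemma chi_eq1 g : 0 < col_norm2 g -> 2 * col_norm2 g <= 3 * g ord0 ord0 ^+ 2 -> chi g = 1.
Proof.
move=> n0 ng; rewrite /chi cutoff1//.
have : 2 / 3 <= g ord0 ord0 ^+ 2 / col_norm2 g by rewrite ler_pdivlMr//; lra.
lra.
Qed.

Lemma chi_eq0 g : 0 < col_norm2 g -> 3 * g ord0 ord0 ^+ 2 <= col_norm2 g -> chi g = 0.
Proof.
move=> n0 ng; rewrite /chi cutoff0//.
have : g ord0 ord0 ^+ 2 / col_norm2 g <= 1 / 3 by rewrite ler_pdivrMr//; lra.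
lra.
Qed.

(* A section with the germ of H at the base point; the cut-off vanishes near
   the hyperplane at infinity of the chart. *)
Definition bfun (H : 'rV[R]_k -> R[i]) g : R[i] :=
  if g ord0 ord0 == 0 then 0 else (chi g)%:C * hfac (g ord0 ord0) * H (chart g).

Definition bsec (H : 'rV[R]_k -> R[i]) g : R[i]^o :=
  if \det g == 1 then bfun H g else 0.

Lemma continuous_smooth (V : normedModType R) (F : V -> R) :
  smooth_real setT F -> continuous F.
Proof. by move=> sF z; have [] := sF [::] z Logic.I. Qed.

Lemma open_gt0_smooth (V : normedModType R) (F : V -> R) :
  smooth_real setT F -> open [set z | 0 < F z].
Proof.
move=> /continuous_smooth cF.
by apply: (@open_comp _ _ F [set y | 0 < y]) => [z _|]; [exact: cF|exact: open_gt].
Qed.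

Lemma open_neq0_smooth (V : normedModType R) (F : V -> R) :
  smooth_real setT F -> open [set z | F z != 0].
Proof.
move=> /continuous_smooth cF.
by apply: (@open_comp _ _ F [set y | y != 0]) => [z _|]; [exact: cF|exact: open_neq0].
Qed.

Lemma csmooth_chart (V : normedModType R) (U : set V) (phi : V -> 'M[R]_k.+1)
    (H : 'rV[R]_k -> R[i]) : open U -> csmooth setT H ->
  (forall i j, smooth_real U (fun z => phi z i j)) ->
  (forall z, U z -> phi z ord0 ord0 != 0) -> csmooth U (fun z => H (chart (phi z))).
Proof.
move=> oU sH sphi U0; apply: (csmooth_comp oU openT sH) => // i.
have sV := smooth_comp1 oU (@open_neq0 R) (@smooth_inv R) (sphi ord0 ord0) U0.
apply: (smooth_ext oU _ (smoothM oU (sphi (lift ord0 i) ord0) sV)) => x _.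
by rewrite mxE.
Qed.

(** Near a zero of the corner entry the cut-off is identically 0; elsewhere every factor is
    smooth. *)
Lemma csmooth_bfun H : csmooth setT H -> csmooth [set g | 0 < col_norm2 g] (bfun H).
Proof.
move=> sH; apply: csmooth_local => g /= ng.
have oT : open [set: 'M[R]_k.+1] by exact: openT.
have [g0|g0] := eqVneq (g ord0 ord0) 0.
  exists [set h | 0 < col_norm2 h - 3 * h ord0 ord0 ^+ 2].
    by rewrite /= g0 expr0n /= mulr0 subr0.
  have oU : open [set h : 'M[R]_k.+1 | 0 < col_norm2 h - 3 * h ord0 ord0 ^+ 2].
    apply: open_gt0_smooth; apply: (smoothB oT (smooth_col_norm2 oT)).
    exact: (smoothZ _ oT (smoothX 2 oT (smooth_entry ord0 ord0 oT))).
  apply: (csmooth_ext oU _ (csmooth_cst 0 oU)) => h /= hU; rewrite /bfun.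
  case: ifP => // _; rewrite chi_eq0 ?mul0r//.
      by have := sqr_ge0 (h ord0 ord0); move: hU; lra.
  by rewrite -subr_ge0 ltW.
exists [set h | h ord0 ord0 != 0] => //.
have oU : open [set h : 'M[R]_k.+1 | h ord0 ord0 != 0].
  exact: open_neq0_smooth (smooth_entry ord0 ord0 oT).
have s1 : smooth_real [set h : 'M[R]_k.+1 | h ord0 ord0 != 0] chi.
  apply: smooth_chi => // h /= h0; rewrite gt_eqF//.
  by rewrite (lt_le_trans _ (col_norm2_ge h))// exprn_even_gt0.
have s2 : csmooth [set h : 'M[R]_k.+1 | h ord0 ord0 != 0] (fun h => hfac (h ord0 ord0)).
  by apply: (csmooth_hfac _ _ oU (smooth_entry _ _ oU)); exact.
have s3 : csmooth [set h : 'M[R]_k.+1 | h ord0 ord0 != 0] (fun h => H (chart h)).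
  by apply: (@csmooth_chart _ _ id H oU sH (fun i j => smooth_entry i j oU)); exact.
have := csmoothM oU (csmoothM oU (csmooth_real oU s1) s2) s3.
by apply: (csmooth_ext oU) => h /= h0; rewrite /bfun (negbTE h0).
Qed.

Lemma hfac_p_elt m t : SLpm k m ->
  hfac ((\det m)^-1 * expR t) = cexp (- (lambda * t%:C)) * (Num.sg (\det m))%:C ^+ alpha.
Proof.
move=> mS; have d0 : \det m != 0 by have := SLpm_unit mS; rewrite unitmxE unitfE.
have e0 : expR t != 0 by rewrite gt_eqF ?expR_gt0.
have di : (\det m)^-1 != 0 by rewrite invr_eq0.
rewrite (hfacM _ _ di e0) mulrC hfac_gt0 ?expR_gt0// expRK.
congr (_ * _); rewrite /hfac sgrV.
have -> : `|(\det m)^-1| = 1.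
  by case: mS => /= ->; rewrite ?invrN ?invr1 ?normrN normr1.
by rewrite ln1 mulr0 oppr0 cexp0 mul1r.
Qed.

Lemma bsec_I H : csmooth setT H -> I (bsec H).
Proof.
move=> sH; split=> [g gS|g gS|g gS m t x mS].
- by rewrite /bsec; case: eqP.
- exists [set g | 0 < col_norm2 g], (bfun H); split.
  + exact: open_gt0_smooth (smooth_col_norm2 openT).
  + exact: col_norm2_gt0.
  + apply: csmooth_smooth_on; last exact: csmooth_bfun.
    exact: open_gt0_smooth (smooth_col_norm2 openT).
  by move=> h _ hS; rewrite /bsec hS eqxx.
rewrite -/(p_elt m t x) /bsec det_mulmx (det_p_elt k_gt0 _ _ mS) mulr1 gS eqxx /bfun.
(* Right multiplication by P multiplies the first column by c, so [chart] and [chi] do not change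
   and only [hfac] does. *)
set c := (\det m)^-1 * expR t.
have c0 : c != 0.
  have d0 : \det m != 0 by have := SLpm_unit mS; rewrite unitmxE unitfE.
  by rewrite mulf_neq0 ?invr_eq0// gt_eqF ?expR_gt0.
have E i : (g *m p_elt m t x) i ord0 = g i ord0 * c by exact: p_elt_mul0.
rewrite E mulf_eq0 (negbTE c0) orbF.
case: ifPn => [_|g0]; first by rewrite /sgn_twist /triv_rep !scaler0.
have -> : chart (g *m p_elt m t x) = chart g.
  by apply/rowP => i; rewrite [LHS]mxE [RHS]mxE !E -mulf_div divff// mulr1.
have -> : chi (g *m p_elt m t x) = chi g.
  rewrite /chi /col_norm2; congr (cutoff (_ * (_ - _))).
  under eq_bigr do rewrite E exprMn.
  by rewrite E exprMn -mulr_suml -mulf_div divff ?mulr1// sqrf_eq0.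
rewrite hfacM// hfac_p_elt// /sgn_twist /triv_rep det_inv sgrV.
have sc (a b : R[i]) : a *: (b : R[i]^o) = a * b by [].
by rewrite !sc; set S := _ ^+ alpha; set T := cexp _; ring.
Qed.

End Chart.

(** * The embedding of G' in G and its action on the chart *)

Section LastIndex.
Variable (R : realType).

Lemma lift_max_ord0 k : lift ord_max ord0 = ord0 :> 'I_k.+2.
Proof. exact/val_inj. Qed.

Lemma lift0_lift_max k (i : 'I_k) : lift ord0 (lift ord_max i) = lift ord_max (lift ord0 i).
Proof.
by apply/val_inj; rewrite /= /bump /= !add1n ltnS leqNgt (ltn_ord i) !add0n.
Qed.

Lemma lift0_max k : lift ord0 ord_max = ord_max :> 'I_k.+2.
Proof. exact/val_inj. Qed.

Lemma lift_max_widen k (i : 'I_k) : lift ord_max i = widen_ord (leqnSn k) i.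
Proof. by apply/val_inj; rewrite /= /bump leqNgt ltn_ord. Qed.

Lemma big_ord_lift_max (V : nmodType) k (F : 'I_k.+1 -> V) :
  \sum_i F i = \sum_(i < k) F (lift ord_max i) + F ord_max.
Proof. by rewrite big_ord_recr; under [in RHS]eq_bigr do rewrite lift_max_widen. Qed.

Lemma ord_max_ind k (P : 'I_k.+1 -> Prop) :
  P ord_max -> (forall i, P (lift ord_max i)) -> forall i, P i.
Proof. by move=> P1 P2 i; case: (unliftP ord_max i) => [j ->|->]. Qed.

Lemma castmx_mulmx n n' (e : n = n') (A B : 'M[R]_n) :
  castmx (e, e) A *m castmx (e, e) B = castmx (e, e) (A *m B).
Proof. by case: n' / e; rewrite !castmx_id. Qed.

Lemma det_castmx n n' (e : n = n') (A : 'M[R]_n) : \det (castmx (e, e) A) = \det A.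
Proof. by case: n' / e; rewrite castmx_id. Qed.

Lemma castmx_1 n n' (e : n = n') : castmx (e, e) (1%:M : 'M[R]_n) = 1%:M.
Proof. by case: n' / e; rewrite castmx_id. Qed.

Variable k : nat.
Implicit Types g h : 'M[R]_k.

Lemma diag_last1M g h : diag_last1 (g *m h) = diag_last1 g *m diag_last1 h.
Proof.
by rewrite /diag_last1 castmx_mulmx mulmx_block !(mulmx0, mul0mx, addr0, add0r, mulmx1).
Qed.

Lemma diag_last1_1 : diag_last1 (1%:M : 'M[R]_k) = 1%:M.
Proof. by rewrite /diag_last1 -scalar_mx_block castmx_1. Qed.

Lemma det_diag_last1 g : \det (diag_last1 g) = \det g.
Proof. by rewrite /diag_last1 det_castmx det_ublock det1 mulr1. Qed.

Lemma SL_diag_last1 g : SL k g -> SL k.+1 (diag_last1 g).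
Proof. by rewrite /SL /mkset det_diag_last1. Qed.

Lemma diag_last1V g : SL k g -> invmx (diag_last1 g) = diag_last1 (invmx g).
Proof.
move=> gS; have gu := SL_unit (SL_diag_last1 gS).
apply: (can_inj (mulKmx gu)); rewrite mulmxV// -diag_last1M mulmxV ?diag_last1_1//.
exact: SL_unit gS.
Qed.

Lemma cast_lift_max (i : 'I_k) : cast_ord (esym (addn1 k)) (lift ord_max i) = lshift 1 i.
Proof. by apply/val_inj; rewrite /= /bump leqNgt ltn_ord. Qed.

Lemma cast_max : cast_ord (esym (addn1 k)) ord_max = rshift k (0 : 'I_1).
Proof. by apply/val_inj; rewrite /= addn0. Qed.

Lemma diag_last1_ll g i j : diag_last1 g (lift ord_max i) (lift ord_max j) = g i j.
Proof. by rewrite castmxE !cast_lift_max block_mxEul. Qed.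
Lemma diag_last1_lm g i : diag_last1 g (lift ord_max i) ord_max = 0.
Proof. by rewrite castmxE cast_lift_max cast_max block_mxEur mxE. Qed.
Lemma diag_last1_ml g j : diag_last1 g ord_max (lift ord_max j) = 0.
Proof. by rewrite castmxE cast_lift_max cast_max block_mxEdl mxE. Qed.
Lemma diag_last1_mm g : diag_last1 g ord_max ord_max = 1.
Proof. by rewrite castmxE cast_max block_mxEdr mxE eqxx. Qed.

End LastIndex.

Section ChartAction.
Variables (R : realType) (p : nat).
Implicit Types (h : 'M[R]_p.+1) (x : 'rV[R]_p.+1).

Lemma diag_nminus_lift h x (i : 'I_p.+1) :
  (diag_last1 h *m nminus x) (lift ord_max i) ord0 =
  h i ord0 + \sum_j h i (lift ord0 j) * x 0 (lift ord_max j).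
Proof.
rewrite nminus_mulE big_ord_lift_max -[X in diag_last1 h _ X]lift_max_ord0 diag_last1_ll.
rewrite lift0_max diag_last1_lm mul0r addr0; congr (_ + _); apply: eq_bigr => j _.
by rewrite lift0_lift_max diag_last1_ll.
Qed.

Lemma diag_nminus_max h x : (diag_last1 h *m nminus x) ord_max ord0 = x 0 ord_max.
Proof.
rewrite nminus_mulE big_ord_lift_max -[X in diag_last1 h _ X]lift_max_ord0 diag_last1_ml.
rewrite lift0_max diag_last1_mm mul1r big1 ?addr0 ?add0r// => j _.
by rewrite lift0_lift_max diag_last1_ml mul0r.
Qed.

End ChartAction.

(** * Translates and germs of sections *)

Section Sections.
Variables (R : realType) (k : nat).

Lemma ltrans_Ind (W : vectType R[i]) (sigma : 'M[R]_k -> W -> W) lambda h f :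
  SL k.+1 h -> Ind sigma lambda f -> Ind sigma lambda (fun g => f (h *m g)).
Proof.
move=> hS [f0 sf fe]; split=> [g gS|g gS|g gS m t x mS].
- by apply: f0; move/(SLM_iff g hS).
- have [U [F [oU Ug sF Ff]]] := sf (h *m g) (SLM hS gS).
  have cA : continuous (fun g : 'M[R]_k.+1 => h *m g).
    by apply: continuous_mx_linear => a u v; rewrite mulmxDr -scalemxAr.
  exists [set g | U (h *m g)], (fun g => F (h *m g)); split=> //.
  + by apply: (@open_comp _ _ (fun g => h *m g) U) => // z _; exact: cA.
  + have AL (a : R) (u v : 'M[R]_k.+1) : h *m (a *: u + v) = a *: (h *m u) + h *m v.
      by rewrite mulmxDr -scalemxAr.
    move=> phi.
    exact: (@smooth_affine _ _ _ [set g | U (h *m g)] U _ _ _ AL cA (fun _ u => u) (sF phi)).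
  by move=> g' Ug' gS'; apply: Ff => //; exact: SLM.
by rewrite mulmxA fe//; exact: SLM.
Qed.

Lemma continuous_nminus_mul (h : 'M[R]_k.+1) : continuous (fun x : 'rV[R]_k => h *m nminus x).
Proof.
have E : (fun x : 'rV[R]_k => h *m nminus x) =
    (fun x => h *m (\sum_j x 0 j *: Nminus R j) + h).
  by apply/funext => x; rewrite nminus_sum mulmxDr mulmx1 addrC.
have cl : continuous (fun x : 'rV[R]_k => h *m (\sum_j x 0 j *: Nminus R j)).
  apply: continuous_mx_linear => a u v.
  rewrite scalemxAr -mulmxDr scaler_sumr -big_split /=; congr (_ *m _).
  by apply: eq_bigr => j _; rewrite !mxE scalerDl scalerA.
by rewrite E => x; exact: (cvgD (cl x) (cvg_cst h)).
Qed.

Lemma nminus_affine (h : 'M[R]_k.+1) (a : R) (v y : 'rV[R]_k) :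
  h *m nminus (a *: v + y) = a *: (h *m (nminus v - 1%:M)) + h *m nminus y.
Proof.
rewrite scalemxAr -mulmxDr; congr (_ *m _).
rewrite !nminus_sum [1%:M + _ - _]addrC addKr addrCA; congr (_ + _).
rewrite scaler_sumr -big_split /=; apply: eq_bigr => j _.
by rewrite !mxE scalerDl scalerA.
Qed.

Lemma smooth_section (W : vectType R[i]) (sigma : 'M[R]_k -> W -> W) lambda h f :
  SL k.+1 h -> Ind sigma lambda f -> smooth_on setT (fun x => f (h *m nminus x)).
Proof.
move=> hS [_ sf _] phi; apply: smooth_local => x _.
have [U [F [oU Ux sF Ff]]] := sf (h *m nminus x) (SLM hS (SL_nminus x)).
have oB : open [set y | U (h *m nminus y)].
  by apply: (@open_comp _ _ (fun y => h *m nminus y) U) => // z _; exact: continuous_nminus_mul.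
exists [set y | U (h *m nminus y)] => //.
have := @smooth_affine _ _ _ [set y | U (h *m nminus y)] U (fun y => h *m nminus y)
  (fun v => h *m (nminus v - 1%:M)) (fun y => complex.Re (phi (F y)))
  (@nminus_affine h) (@continuous_nminus_mul h) (fun _ u => u) (sF phi).
apply: (smooth_ext oB) => y Uy; rewrite Ff//.
exact: SLM hS (SL_nminus _).
Qed.

Variables (alpha : bool) (lambda : R[i]).
Hypothesis k_gt0 : (0 < k)%N.
Local Notation I := (@I_triv R k alpha lambda).

Lemma csmooth_section h f : SL k.+1 h -> I f -> csmooth setT (fun x => f (h *m nminus x)).
Proof. by move=> hS If; apply: smooth_on_csmooth; exact: smooth_section hS If. Qed.

Lemma csmooth_section1 f : I f -> csmooth setT (fun x => f (nminus x)).
Proof.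
move=> If; have := csmooth_section (SL1 R k.+1) If.
by congr (csmooth _ _); apply/funext => x; rewrite mul1mx.
Qed.

Lemma I_add c f h : I f -> I h -> I (fun g => c *: f g + h g).
Proof.
move=> [f0 sf fe] [h0 sh he]; split=> [g gS|g gS|g gS m t x mS].
- by rewrite f0// h0// scaler0 addr0.
- have [U [F [oU Ug sF Ff]]] := sf g gS; have [U' [F' [oU' Ug' sF' Ff']]] := sh g gS.
  exists (U `&` U'), (fun g => c * F g + F' g); split=> //; first exact: openI.
    apply: csmooth_smooth_on; first exact: openI.
    apply: csmoothD; first exact: openI.
      apply: csmoothZ; first exact: openI.
      by apply: csmooth_sub (smooth_on_csmooth sF) => z [].
    by apply: csmooth_sub (smooth_on_csmooth sF') => z [].
  by move=> g' [g'U g'U'] g'S; rewrite Ff// Ff'.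
rewrite fe// he// /sgn_twist /triv_rep !scalerDr; congr (_ + _).
by rewrite !scalerA mulrC mulrA mulrC -!mulrA; congr (_ *: _); ring.
Qed.

Lemma nminus_chart_nbhs (P : 'rV[R]_k -> Prop) :
  (\forall x \near (0 : 'rV[R]_k), P x) ->
  \forall g \near (1%:M : 'M[R]_k.+1), P (chart g).
Proof.
move=> P0.
have c0 : chart (1%:M : 'M[R]_k.+1) = 0 by rewrite -nminus0 chart_nminus.
have oU : open [set h : 'M[R]_k.+1 | h ord0 ord0 != 0].
  exact: open_neq0_smooth (smooth_entry ord0 ord0 openT).
have U1 : [set h : 'M[R]_k.+1 | h ord0 ord0 != 0] 1%:M by rewrite /= mxE eqxx oner_eq0.
suff cc : {for (1%:M : 'M[R]_k.+1), continuous (@chart R k)}.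
  by apply: cc; rewrite c0.
apply: continuous_row => i.
have sV := smooth_comp1 oU (@open_neq0 R) (@smooth_inv R) (smooth_entry ord0 ord0 oU)
  (fun _ h => h).
have E : (fun g : 'M[R]_k.+1 => chart g 0 i) =
    fun g => g (lift ord0 i) ord0 * (g ord0 ord0)^-1 by apply/funext => g; rewrite mxE.
rewrite E.
by have [] := smoothM oU (smooth_entry (lift ord0 i) ord0 oU) sV [::] (x := 1%:M) U1.
Qed.

(** Near 1 the cut-off is 1 and [I_chart] recovers f from its values on N_-, so the germ of a
    section at 1 is determined by its germ in the chart. *)
Lemma bsec_near f H : I f -> (\forall x \near (0 : 'rV[R]_k), f (nminus x) = H x) ->
  \forall g \near (1%:M : 'M[R]_k.+1), f g = bsec alpha lambda H g.
Proof.
move=> If fH.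
have N1 := nminus_chart_nbhs fH.
have oT : open [set: 'M[R]_k.+1] by exact: openT.
(* An open form of the condition in [chi_eq1]: the corner entry carries more than 2/3 of the squared
   norm of the column. *)
have oU : open [set h : 'M[R]_k.+1 | 0 < 3 * h ord0 ord0 ^+ 2 - 2 * col_norm2 h].
  apply: open_gt0_smooth; apply: (smoothB oT).
    exact: (smoothZ _ oT (smoothX 2 oT (smooth_entry ord0 ord0 oT))).
  exact: (smoothZ _ oT (smooth_col_norm2 oT)).
have U1 : [set h : 'M[R]_k.+1 | 0 < 3 * h ord0 ord0 ^+ 2 - 2 * col_norm2 h] 1%:M.
  rewrite /= /col_norm2 big_ord_recl big1 ?mxE ?eqxx ?expr1n ?addr0; last first.
    by move=> i _; rewrite mxE /= expr0n.
  lra.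
have N2 := open_nbhs_nbhs (conj oU U1).
apply: filterS2 N1 N2 => g /= fg g1.
rewrite /bsec; case: eqP => [gS|gS]; last by have [f0 _ _] := If; exact: f0.
have g0 : g ord0 ord0 != 0.
  apply/eqP => g0; have := col_norm2_gt0 gS; move: g1; rewrite g0 expr0n /=; lra.
rewrite /bfun (negbTE g0) chi_eq1; last 2 first.
- exact: col_norm2_gt0.
- by move: g1; lra.
by rewrite mul1r (I_chart k_gt0 If gS g0) fg.
Qed.

Lemma bsec_nminus_near H :
  \forall x \near (0 : 'rV[R]_k), bsec alpha lambda H (nminus x) = H x.
Proof.
have c1 := @continuous_nminus_mul 1%:M.
have oT : open [set: 'M[R]_k.+1] by exact: openT.
have oU : open [set h : 'M[R]_k.+1 | 0 < 3 * h ord0 ord0 ^+ 2 - 2 * col_norm2 h].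
  apply: open_gt0_smooth; apply: (smoothB oT).
    exact: (smoothZ _ oT (smoothX 2 oT (smooth_entry ord0 ord0 oT))).
  exact: (smoothZ _ oT (smooth_col_norm2 oT)).
have U1 : [set h : 'M[R]_k.+1 | 0 < 3 * h ord0 ord0 ^+ 2 - 2 * col_norm2 h]
    (1%:M *m nminus 0).
  rewrite mul1mx nminus0 /= /col_norm2 big_ord_recl big1 ?mxE ?eqxx ?expr1n ?addr0; last first.
    by move=> i _; rewrite mxE /= expr0n.
  lra.
have H1 : \forall x \near (0 : 'rV[R]_k), 0 < 3 * (1%:M *m nminus x) ord0 ord0 ^+ 2 -
    2 * col_norm2 (1%:M *m nminus x) := c1 0 _ (open_nbhs_nbhs (conj oU U1)).
apply: filterS H1 => x /=.
rewrite mul1mx /bsec det_nminus eqxx /bfun nminus00 oner_eq0 => x1.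
rewrite chart_nminus hfac1 mulr1 chi_eq1 ?mul1r//; last by move: x1; rewrite nminus00; lra.
exact: col_norm2_gt0 (SL_nminus x).
Qed.

End Sections.

(** * Flat functions and Taylor estimates *)

Section Flatness.
Variables (R : realType) (V : normedModType R).

Definition flat m (N : nat) (H : 'rV[R]_m -> R) : Prop :=
  forall w : seq 'rV[R]_m, (size w < N)%N -> iterD w H 0 = 0.

(** By the product and chain rules the innermost derivative gives terms of the same shape, in which
    either H is replaced by a derivative, flat to one order less, or only [eta] changes. This is why
    [eta] is left arbitrary. *)
Lemma flat_comp m N (B : set V) (z0 : V) (H : 'rV[R]_m -> R) (gam : V -> 'rV[R]_m)
    (eta : V -> R) (w : seq V) : open B -> B z0 -> smooth_real setT H -> flat N H ->
  (forall i, smooth_real B (fun z => gam z 0 i)) -> gam z0 = 0 ->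
  smooth_real B eta -> (size w < N)%N ->
  iterD w (fun z => H (gam z) * eta z) z0 = 0.
Proof.
move=> oB Bz0 + + sg g0; elim/last_ind: w N H eta => [|w u ih] N H eta sH fH se wN.
  by rewrite /= g0; have := fH [::] wN => /= ->; rewrite mul0r.
rewrite iterD_rcons.
have sHg (K : 'rV[R]_m -> R) : smooth_real setT K -> smooth_real B (fun z => K (gam z)).
  by move=> sK; exact: (smooth_comp oB openT sK sg (fun _ _ => Logic.I)).
have s1 i : smooth_real B (fun z => 'D_(delta_mx 0 i) H (gam z) *
    ('D_u (fun y => gam y 0 i) z * eta z)).
  apply: (smoothM oB); first exact: sHg (smooth_D _ sH).
  by apply: (smoothM oB _ se); exact: smooth_D (sg i).
have s2 : smooth_real B (fun z => H (gam z) * 'D_u eta z).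
  exact: (smoothM oB (sHg _ sH) (smooth_D u se)).
have E z : B z -> (fun z => \sum_i 'D_(delta_mx 0 i) H (gam z) *
    ('D_u (fun y => gam y 0 i) z * eta z) + H (gam z) * 'D_u eta z) z =
    'D_u (fun z => H (gam z) * eta z) z.
  move=> Bz /=.
  have C1 : Ck 1 setT H by have /smooth_CkP := sH.
  have dg i : derivable (fun y => gam y 0 i) z u by have [_] := sg i [::] z Bz.
  have dHg := is_derive_comp openT Logic.I C1 dg.
  have de : derivable eta z u by have [_] := se [::] z Bz.
  have [_ ->] := is_deriveM dHg (derivableP de).
  rewrite [RHS]addrC /GRing.scale /=; congr (_ + _).
  by rewrite mulr_sumr; apply: eq_bigr => i _; rewrite mulrA mulrC; congr (_ * _); exact: mulrC.
have s3 := smooth_sum (index_enum 'I_m) (P := xpredT) oB (fun i _ => s1 i).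
rewrite -(iterD_ext w oB E Bz0) (iterDD _ oB Bz0 s3 s2).
rewrite size_rcons in wN; case: N => // N in fH wN *.
have flD i : flat N ('D_(delta_mx 0 i) H).
  by move=> v vN; rewrite -iterD_rcons; apply: fH; rewrite size_rcons.
have fH' : flat N H by move=> v vN; apply: fH; exact: ltnW.
rewrite (iterD_sum _ _ oB Bz0 s1) (ih N _ _ sH fH' (smooth_D u se) wN) addr0.
rewrite big1 // => i _.
have s4 : smooth_real B (fun z => 'D_u (fun y => gam y 0 i) z * eta z).
  by apply: (smoothM oB _ se); exact: smooth_D (sg i).
exact: (ih N _ _ (smooth_D _ sH) (flD i) s4 wN).
Qed.

End Flatness.

Section Scaling.
Variables (R : realType) (V : normedModType R).
Local Notation VR := (V * R)%type.

Definition sdir : VR := (0, 1).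
Definition ydir (v : V) : VR := (v, 0).

(** Taylor expansion in s at s = 0; compactness of C bounds the M-th derivative in s uniformly in
    y. *)
Lemma taylor_bound (K : VR -> R) (C : set V) (w : seq V) (M : nat) :
  compact C -> smooth_real setT K ->
  (forall (w' : seq VR) y, (size w' < M + size w)%N -> iterD w' K (y, 0) = 0) ->
  exists2 B : R, 0 <= B & forall y s, C y -> 0 <= s <= 1 ->
    `|iterD (map ydir w) K (y, s)| <= B * s ^+ M.
Proof.
move=> cC sK fK.
pose w1 := nseq M sdir ++ map ydir w.
have cK : continuous (fun z => `|iterD w1 K z|).
  move=> z; apply: (@continuous_comp _ _ _ (iterD w1 K) (fun r => `|r|)).
    by have [] := sK w1 z Logic.I.
  exact: norm_continuous.
have [[y0 Cy0]|C0] := pselect (C !=set0); last first.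
  by exists 0 => // y s Cy; exfalso; apply: C0; exists y.
have cCs : compact (C `*` `[(0 : R), 1]) by apply: compact_setX => //; exact: segment_compact.
have [|z _ zB] := compact_EVT_max _ cCs (continuous_subspaceT cK).
  by exists (y0, 0); split => //=; rewrite in_itv /= lexx ler01.
exists (`|iterD w1 K z|) => // y s Cy s01.
pose g j t := iterD (nseq j sdir ++ map ydir w) K (y, t).
have ys t : (y, t) = t *: sdir + ydir y.
  by rewrite /sdir /ydir; congr (_, _); rewrite /= ?scaler0 ?add0r// addr0 [_ *: _]mulr1.
have H1 j (t : R) : 0 <= t <= 1 -> is_derive t 1 (g j) (g j.+1 t).
  move=> _; rewrite /g.
  have -> : (fun t => iterD (nseq j sdir ++ map ydir w) K (y, t)) =
     (fun t => iterD (nseq j sdir ++ map ydir w) K (t *: sdir + ydir y)).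
    by apply/funext => t'; rewrite ys.
  apply: is_derive_line; rewrite -ys; apply: derivableP.
  by have [_] := sK (nseq j sdir ++ map ydir w) (y, t) Logic.I; exact.
have H2 j : (j < M)%N -> g j 0 = 0.
  by move=> jM; apply: fK; rewrite size_cat size_nseq size_map ltn_add2r.
have H3 t : 0 <= t <= 1 -> `|g M t| <= `|iterD w1 K z|.
  move=> t01; apply: (zB (y, t)); rewrite inE; split; first exact: Cy.
  by rewrite /= in_itv.
exact: taylor_flat H1 H2 H3 s s01.
Qed.

End Scaling.

Section Norm1.
Variable R : realType.
Implicit Types z w : R[i].
(** A submultiplicative norm with values in R, whereas the norm of R[i] takes its values in R[i]. *)
Definition norm1 z : R := `|complex.Re z| + `|complex.Im z|.

Lemma norm1_ge0 z : 0 <= norm1 z. Proof. exact: addr_ge0. Qed.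
Lemma Re_norm1 z : `|complex.Re z| <= norm1 z. Proof. by rewrite lerDl. Qed.
Lemma norm1M z w : norm1 (z * w) <= norm1 z * norm1 w.
Proof.
rewrite /norm1 cReM cImM.
have := ler_normB (complex.Re z * complex.Re w) (complex.Im z * complex.Im w).
have := ler_normD (complex.Re z * complex.Im w) (complex.Im z * complex.Re w).
rewrite !normrM; lra.
Qed.
Lemma norm1_cexp z : norm1 (cexp z) <= 2 * expR (complex.Re z).
Proof.
rewrite /cexp /norm1 cReM cImM /= !mul0r subr0 addr0 !normrM (ger0_norm (expR_ge0 _)).
rewrite -mulrDr mulrC ler_wpM2r ?expR_ge0//.
have := cos_max (complex.Im z); have := sin_max (complex.Im z); lra.
Qed.
End Norm1.

(** * Operators in Diff(I, J) are determined by a finite jet *)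

Section Operator.
Variables (R : realType) (p : nat).
Hypothesis p_gt0 : (0 < p)%N.
Variables (alpha beta : bool) (lambda nu : R[i]) (W : vectType R[i]).
Variable varpi : 'M[R]_p -> W -> W.
Hypothesis varpi_rep : is_rep varpi.
Local Notation I := (@I_triv R p.+1 alpha lambda).
Local Notation J := (J_rep varpi nu beta).
Variable D : ('M[R]_p.+2 -> R[i]^o) -> 'M[R]_p.+1 -> W.
Hypothesis DD : Diff I J D.
Local Notation bsec := (bsec alpha lambda).
Implicit Types (H : 'rV[R]_p.+1 -> R[i]) (f : 'M[R]_p.+2 -> R[i]^o) (m : 'M[R]_p).

Let k_gt0 : (0 < p.+1)%N. Proof. by []. Qed.

(** [at1] is the functional T, and [lift_at1] reads it on functions of x through cut-off
    sections. *)
Definition at1 f : W := D f 1%:M.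
Definition lift_at1 H : W := at1 (bsec H).

Lemma op_at1 f h : I f -> SL p.+1 h ->
  D f h = at1 (fun g => f (diag_last1 h *m g)).
Proof.
move=> If hS; have [_ _ _ _ eqD] := DD.
have := eqD f If _ (SLV hS); rewrite /ltrans -diag_last1V// => E.
have := congr1 (fun F => F 1%:M) E; rewrite mulmx1 /= => {}E.
have hu := SL_unit hS; have du := SL_unit (SL_diag_last1 hS).
by rewrite !invmxK in E; rewrite -E.
Qed.

Lemma op_offSL f h : I f -> ~ SL p.+1 h -> D f h = 0.
Proof. by move=> If hS; have [DJ _ _ _ _] := DD; have [H0 _ _] := DJ f If; exact: H0. Qed.

Lemma at1_lin c f h : I f -> I h -> at1 (fun g => c *: f g + h g) = c *: at1 f + at1 h.
Proof. by move=> If Ih; have [_ L _ _ _] := DD; rewrite /at1 L. Qed.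

(** If T f were non-zero, 1 would lie in the support of D f, hence in that of f. *)
Lemma at1_local f : I f -> (\forall g \near (1%:M : 'M[R]_p.+2), f g = 0) -> at1 f = 0.
Proof.
move=> If f0; have [_ _ _ sD _] := DD; apply/eqP/negP => /negP T0.
have : supp (D f) 1%:M by apply: subset_closure.
move=> /(sD f If _ (SL1 R _)); rewrite diag_last1_1 => /(_ _ f0) [g [/= fg0 fg]].
by rewrite fg eqxx in fg0.
Qed.

Lemma at1_near f h : I f -> I h -> (\forall g \near (1%:M : 'M[R]_p.+2), f g = h g) ->
  at1 f = at1 h.
Proof.
move=> If Ih fh.
have Id : I (fun g => (-1) *: h g + f g) by exact: I_add.
have : at1 (fun g => (-1) *: h g + f g) = 0.
  by apply: at1_local => //; apply: filterS fh => g ->; rewrite scaleN1r addNr.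
by rewrite at1_lin// scaleN1r addrC => /eqP; rewrite subr_eq0 => /eqP.
Qed.

Lemma at1_lift f H : I f -> csmooth setT H ->
  (\forall x \near (0 : 'rV[R]_p.+1), f (nminus x) = H x) -> at1 f = lift_at1 H.
Proof.
by move=> If sH fH; apply: at1_near => //; [exact: bsec_I|exact: bsec_near].
Qed.

Lemma at1_chart f : I f -> at1 f = lift_at1 (fun x => f (nminus x)).
Proof.
move=> If; apply: at1_lift => //; first exact: csmooth_section1 If.
by near=> x.
Unshelve. all: by end_near. Qed.

Lemma lift_at1_lin c H K : csmooth setT H -> csmooth setT K ->
  lift_at1 (fun x => c * H x + K x) = c *: lift_at1 H + lift_at1 K.
Proof.
move=> sH sK; rewrite -at1_lin; try exact: bsec_I.
congr at1; apply/funext => g; rewrite /bsec; case: ifP => _; last first.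
  by rewrite scaler0 addr0.
rewrite /bfun; case: ifP => _; first by rewrite scaler0 addr0.
have sc (a b : R[i]) : a *: (b : R[i]^o) = a * b by [].
by rewrite sc; ring.
Qed.

Lemma lift_at1Z c H : csmooth setT H -> lift_at1 (fun x => c * H x) = c *: lift_at1 H.
Proof.
move=> sH; have s0 : csmooth setT (fun _ : 'rV[R]_p.+1 => (0 : R[i])) by apply: csmooth_cst; exact: openT.
have L0 : lift_at1 (fun=> 0) = 0.
  have := lift_at1_lin (-1) s0 s0; rewrite scaleN1r addNr.
  by rewrite (_ : (fun x => -1 * 0 + 0) = fun=> 0)//; apply/funext => x; rewrite mulr0 addr0.
have := lift_at1_lin c sH s0; rewrite L0 addr0 => <-.
by congr lift_at1; apply/funext => x; rewrite addr0.
Qed.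

(** The value of D f at an element of P' is computed twice: by left equivariance, as T of a
    translate of f, and by the right covariance of sections of J. *)
Lemma at1_p_elt f m t b : I f -> SLpm p m ->
  at1 (fun g => f (diag_last1 (p_elt m t b) *m g)) =
  cexp (- (nu * t%:C)) *: ((Num.sg (\det m))%:C ^+ beta *: varpi (invmx m) (at1 f)).
Proof.
move=> If mS; have pS : SL p.+1 (p_elt m t b) by exact: det_p_elt.
rewrite -op_at1//; have [DJ _ _ _ _] := DD; have [_ _ eqJ] := DJ f If.
by rewrite -[p_elt _ _ _]mul1mx (eqJ _ (SL1 R _) m t b mS) /sgn_twist det_inv sgrV.
Qed.

Lemma col0_p_elt m t b x :
  [/\ (diag_last1 (p_elt m t b) *m nminus x) ord0 ord0 =
        (\det m)^-1 * expR t * (1 + \sum_j b 0 j * x 0 (lift ord_max j)),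
      forall i, (diag_last1 (p_elt m t b) *m nminus x) (lift ord0 (lift ord_max i)) ord0 =
        expR (- (t / p%:R)) * \sum_j m i j * x 0 (lift ord_max j) &
      (diag_last1 (p_elt m t b) *m nminus x) (lift ord0 ord_max) ord0 = x 0 ord_max].
Proof.
split.
- have := diag_nminus_lift (p_elt m t b) x ord0; rewrite lift_max_ord0 => ->.
  rewrite p_eltE// block1E mxE eqxx mulr1n mulrDr mulr1.
  congr (_ + _); rewrite mulr_sumr; apply: eq_bigr => j _.
  by rewrite block1E mxE mulrA.
- move=> i; rewrite lift0_lift_max diag_nminus_lift p_eltE// block1E mxE add0r mulr_sumr.
  by apply: eq_bigr => j _; rewrite block1E mxE mulrA.
by rewrite lift0_max diag_nminus_max.
Qed.

(** The form that the action of M'A' takes in the chart, block diagonal in (x', x_n). *)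
Definition mact m (a b : R) (x : 'rV[R]_p.+1) : 'rV[R]_p.+1 :=
  \row_i (if unlift ord_max i is Some i' then
            a * \sum_j m i' j * x 0 (lift ord_max j) else b * x 0 ord_max).

Lemma mact_lift m a b x i :
  mact m a b x 0 (lift ord_max i) = a * \sum_j m i j * x 0 (lift ord_max j).
Proof. by rewrite mxE liftK. Qed.

Lemma mact_max m a b x : mact m a b x 0 ord_max = b * x 0 ord_max.
Proof. by rewrite mxE unlift_none. Qed.

(** Only the first column matters, so P' acts on the chart by a projective transformation: a linear
    map divided by the new corner entry, to which [hfac] is applied. *)
Lemma section_p_elt f m t (b : 'rV[R]_p) (x : 'rV[R]_p.+1) : I f -> SLpm p m ->
  1 + \sum_j b 0 j * x 0 (lift ord_max j) != 0 ->
  f (diag_last1 (p_elt m t b) *m nminus x) =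
  hfac alpha lambda ((\det m)^-1 * expR t * (1 + \sum_j b 0 j * x 0 (lift ord_max j))) *
  f (nminus (mact m (expR (- (t / p%:R)) * ((\det m)^-1 * expR t *
      (1 + \sum_j b 0 j * x 0 (lift ord_max j)))^-1)
    ((\det m)^-1 * expR t * (1 + \sum_j b 0 j * x 0 (lift ord_max j)))^-1 x)).
Proof.
move=> If mS u0; have [E0 El Em] := col0_p_elt m t b x.
have d0 : \det m != 0 by have := SLpm_unit mS; rewrite unitmxE unitfE.
have S : SL p.+2 (diag_last1 (p_elt m t b) *m nminus x).
  by apply: SLM (SL_nminus _); apply: SL_diag_last1; exact: det_p_elt.
rewrite (I_chart k_gt0 If S) E0; last first.
  have e0 : expR t != 0 by rewrite gt_eqF ?expR_gt0.
  by rewrite !mulf_neq0 ?invr_eq0.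
congr (_ * f (nminus _)); apply/rowP; elim/ord_max_ind => [|i].
  by rewrite mxE mact_max Em E0 mulrC.
by rewrite mxE mact_lift El E0 mulrAC.
Qed.

Lemma csmooth_mact H m a b : csmooth setT H -> csmooth setT (fun x => H (mact m a b x)).
Proof.
move=> sH; have AL (c : R) (v y : 'rV[R]_p.+1) :
    mact m a b (c *: v + y) = c *: mact m a b v + mact m a b y.
  apply/rowP; elim/ord_max_ind => [|i]; rewrite mxE ?mact_max ?mact_lift !(mxE, mact_max, mact_lift)
    ?unlift_none ?liftK; first by ring.
  rewrite mulrCA -mulrDr; congr (_ * _); rewrite mulr_sumr -big_split /=.
  by apply: eq_bigr => j _; rewrite !mxE; ring.
apply: (csmooth_affine AL _ _ sH) => //.
exact: continuous_mx_linear.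
Qed.

(** This is [at1_p_elt] read on functions: near 0 the translated cut-off section has the germ of the
    transformed function. *)
Lemma lift_at1_p_elt H m t : csmooth setT H -> SLpm p m ->
  hfac alpha lambda ((\det m)^-1 * expR t) *: lift_at1 (fun x => H (mact m
    (expR (- (t / p%:R)) * ((\det m)^-1 * expR t)^-1) ((\det m)^-1 * expR t)^-1 x)) =
  cexp (- (nu * t%:C)) *: ((Num.sg (\det m))%:C ^+ beta *: varpi (invmx m) (lift_at1 H)).
Proof.
move=> sH mS; have pS : SL p.+1 (p_elt m t 0) by exact: det_p_elt.
have IH : I (bsec H) by exact: bsec_I.
rewrite -(at1_p_elt t 0 IH mS) -lift_at1Z; last exact: csmooth_mact.
apply/esym/at1_lift; first exact: (ltrans_Ind (SL_diag_last1 pS) IH).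
  by apply: (csmoothZ _ openT); exact: csmooth_mact.
have c0 : (\det m)^-1 * expR t != 0.
  have d0 : \det m != 0 by have := SLpm_unit mS; rewrite unitmxE unitfE.
  have e0 : expR t != 0 by rewrite gt_eqF ?expR_gt0.
  by rewrite mulf_neq0 ?invr_eq0.
set q := mact m _ _.
have cq : {for (0 : 'rV[R]_p.+1), continuous q}.
  apply: continuous_mx_linear => c v y; apply/rowP; elim/ord_max_ind => [|i];
    rewrite /q !(mxE, mact_max, mact_lift) ?unlift_none ?liftK; first by ring.
  rewrite mulrCA -mulrDr; congr (_ * _); rewrite mulr_sumr -big_split /=.
  by apply: eq_bigr => j _; rewrite !mxE; ring.
have q0 : q 0 = 0.
  apply/rowP; elim/ord_max_ind => [|i]; rewrite /q ?mact_max ?mact_lift !mxE ?mulr0//.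
  by rewrite big1 ?mulr0// => j _; rewrite mxE mulr0.
have N : \forall x \near (0 : 'rV[R]_p.+1), bsec H (nminus (q x)) = H (q x).
  have cq' : q @ (0 : 'rV[R]_p.+1) --> (0 : 'rV[R]_p.+1) by rewrite -[X in _ --> X]q0.
  exact: (cq' _ (bsec_nminus_near alpha lambda H)).
apply: filterS N => x Nx.
have s0 : \sum_j (0 : 'rV[R]_p) 0 j * x 0 (lift ord_max j) = 0.
  by rewrite big1// => j _; rewrite mxE mul0r.
rewrite section_p_elt// s0 addr0 ?oner_eq0// mulr1 Nx//.
Qed.

End Operator.

(** * The dilations of A', down to the parameter 0 *)

Section Dilation.
Variables (R : realType) (p : nat).

(** The action of A' on the chart with s = exp (- t / p). In this parameter the exponents are
    natural numbers, p for x_n and p + 1 for the other coordinates, so the map extends smoothly to s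
    = 0. *)
Definition dil (s : R) (x : 'rV[R]_p.+1) : 'rV[R]_p.+1 :=
  \row_i (s ^+ (p + (i != ord_max)) * x 0 i).

Lemma dil_mact s x : dil s x = mact 1%:M (s ^+ p.+1) (s ^+ p) x.
Proof.
apply/rowP; elim/ord_max_ind => [|i]; first by rewrite mact_max mxE eqxx addn0.
rewrite mact_lift mxE (bigD1 i)//= mxE eqxx mul1r big1 => [|j ji].
  by rewrite eq_sym neq_lift addr0 addn1.
by rewrite mxE eq_sym (negbTE ji) mul0r.
Qed.

Lemma smooth_linearP (V : normedModType R) (U : set V) (f : V -> R) :
  linear f -> continuous f -> open U -> smooth_real U f.
Proof.
move=> l cf oU.
pose L : {linear V -> R} := HB.pack f (GRing.isLinear.Build R _ _ _ _ l).
exact: (@smooth_linear _ _ U L).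
Qed.

Local Notation VR := ('rV[R]_p.+1 * R)%type.
Variables (alpha : bool) (lambda : R[i]) (h : 'M[R]_p.+2).
Hypothesis hS : SL p.+2 h.
Variable H : 'rV[R]_p.+1 -> R[i].
Hypothesis sH : csmooth setT H.

(** The cut-off section of x |-> H (dil s x) in the chart based at h, as a function of the pair (y,
    s) including s = 0, so that it can be expanded in s. *)
Definition dsec (z : VR) : R[i] :=
  let g := h *m nminus z.1 in
  if g ord0 ord0 == 0 then 0
  else (chi g)%:C * hfac alpha lambda (g ord0 ord0) * H (dil z.2 (chart g)).

Lemma bsec_dil s y :
  bsec alpha lambda (fun x => H (dil s x)) (h *m nminus y) = dsec (y, s).
Proof.
rewrite /bsec det_mulmx det_nminus mulr1 hS eqxx /bfun /dsec /=.
by case: ifP.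
Qed.

Lemma smooth_snd (U : set VR) : open U -> smooth_real U (fun z : VR => z.2).
Proof. by apply: smooth_linearP => [a u v //|z]; exact: cvg_snd. Qed.

Lemma smooth_base_entry (U : set VR) i j : open U ->
  smooth_real U (fun z : VR => (h *m nminus z.1) i j).
Proof.
move=> oU.
have cA : continuous (fun z : VR => h *m nminus z.1).
  move=> z; apply: (@continuous_comp _ _ _ fst (fun y => h *m nminus y)).
    exact: cvg_fst.
  exact: continuous_nminus_mul.
have AL (a : R) (v y : VR) : h *m nminus (a *: v + y).1 =
    a *: (h *m (nminus v.1 - 1%:M)) + h *m nminus y.1 by exact: nminus_affine.
exact: (@smooth_affine _ _ _ U setT (fun z : VR => h *m nminus z.1)
  (fun v => h *m (nminus v.1 - 1%:M)) _ AL cA (fun _ _ => Logic.I) (smooth_entry i j openT)).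
Qed.

Definition reg : set VR := [set z | (h *m nminus z.1) ord0 ord0 != 0].
Definition irr : set VR := [set z | 0 < col_norm2 (h *m nminus z.1) -
  3 * (h *m nminus z.1) ord0 ord0 ^+ 2].

Lemma open_reg : open reg.
Proof. exact: open_neq0_smooth (smooth_base_entry _ _ openT). Qed.

Lemma smooth_base_norm2 : smooth_real [set: VR] (fun z : VR => col_norm2 (h *m nminus z.1)).
Proof.
apply: (smooth_sum _ openT) => i _.
exact: (smoothX 2 openT (smooth_base_entry i ord0 openT)).
Qed.

Lemma open_irr : open irr.
Proof.
apply: open_gt0_smooth; apply: (smoothB openT smooth_base_norm2).
exact: (smoothZ _ openT (smoothX 2 openT (smooth_base_entry _ _ openT))).
Qed.

Lemma reg_irr z : reg z \/ irr z.
Proof.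
have [z0|z0] := eqVneq ((h *m nminus z.1) ord0 ord0) 0; [right|by left].
rewrite /irr /= z0 expr0n mulr0 subr0.
by apply: col_norm2_gt0; exact: SLM hS (SL_nminus _).
Qed.

Lemma dsec_irr z : irr z -> dsec z = 0.
Proof.
move=> zi; rewrite /dsec; case: eqP => // _; rewrite chi_eq0 ?mul0r//.
  by apply: col_norm2_gt0; exact: SLM hS (SL_nminus _).
by rewrite -subr_ge0 ltW.
Qed.

Definition dsec_coef (z : VR) : R[i] := (chi (h *m nminus z.1))%:C *
  hfac alpha lambda ((h *m nminus z.1) ord0 ord0).

Lemma csmooth_dsec_coef : csmooth reg dsec_coef.
Proof.
have oB := open_reg.
apply: (csmoothM oB).
  apply: (csmooth_real oB).
  have n0 z : reg z -> [set x : R | x != 0] (col_norm2 (h *m nminus z.1)).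
    by move=> _; rewrite /= gt_eqF//; apply: col_norm2_gt0; exact: SLM hS (SL_nminus _).
  have sn : smooth_real reg (fun z : VR => col_norm2 (h *m nminus z.1)).
    by apply: smooth_sub smooth_base_norm2.
  have sV := smooth_comp1 oB (@open_neq0 R) (@smooth_inv R) sn n0.
  have sq := smoothM oB (smoothX 2 oB (smooth_base_entry ord0 ord0 oB)) sV.
  have s3 := smoothZ 3 oB (smoothB oB (smooth_cst 1 oB) sq).
  exact: (smooth_comp1 oB openT (@smooth_cutoff R) s3 (fun _ _ => Logic.I)).
by apply: (csmooth_hfac _ _ oB (smooth_base_entry _ _ oB)); exact.
Qed.

Definition dsec_path (z : VR) : 'rV[R]_p.+1 := dil z.2 (chart (h *m nminus z.1)).

Lemma smooth_dsec_path i : smooth_real reg (fun z => dsec_path z 0 i).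
Proof.
have oB := open_reg.
have sV := smooth_comp1 oB (@open_neq0 R) (@smooth_inv R) (smooth_base_entry ord0 ord0 oB)
  (fun _ u => u).
have := smoothM oB (smoothX (p + (i != ord_max)) oB (smooth_snd oB))
  (smoothM oB (smooth_base_entry (lift ord0 i) ord0 oB) sV).
by apply: (smooth_ext oB) => z _; rewrite !mxE.
Qed.

Lemma dsec_reg z : reg z -> dsec_coef z * H (dsec_path z) = dsec z.
Proof. by rewrite /reg /= => z0; rewrite /dsec (negbTE z0). Qed.

Lemma csmooth_dsec : csmooth setT dsec.
Proof.
apply: csmooth_local => z _; case: (reg_irr z) => [rz|iz].
  exists reg => //; have oB := open_reg.
  have := csmoothM oB csmooth_dsec_coef (csmooth_comp oB openT sH smooth_dsec_path
    (fun _ _ => Logic.I)).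
  exact: (csmooth_ext oB dsec_reg).
exists irr => //; have oB := open_irr.
by apply: (csmooth_ext oB _ (csmooth_cst 0 oB)) => y /dsec_irr ->.
Qed.

Hypothesis p_gt0 : (0 < p)%N.

(** At s = 0 the dilation sends every point to 0, because p > 0; so flatness of H at 0 becomes
    flatness of [dsec] along the whole slice s = 0. *)
Lemma dsec_flat N : flat N (fun x => complex.Re (H x)) ->
  flat N (fun x => complex.Im (H x)) ->
  forall (w : seq VR) y, (size w < N)%N ->
    iterD w (fun z => complex.Re (dsec z)) (y, 0) = 0 /\
    iterD w (fun z => complex.Im (dsec z)) (y, 0) = 0.
Proof.
move=> fr fi w y wN; have [rz|iz] := reg_irr (y, 0); last first.
  by split; rewrite -[RHS](iterD_zero w (y, 0 : R)); apply: (iterD_ext _ open_irr) => // z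
    /dsec_irr ->.
have oB := open_reg.
have [cr ci] := csmooth_dsec_coef; have [hr hi] := sH.
have g0 : dsec_path (y, 0) = 0.
  by apply/rowP => i; rewrite !mxE expr0n addn_eq0 eqn0Ngt p_gt0 /= mul0r.
have path K (eta : VR -> R) : smooth_real setT K -> flat N K -> smooth_real reg eta ->
    iterD w (fun z => K (dsec_path z) * eta z) (y, 0) = 0.
  by move=> sK fK se; exact: (flat_comp oB rz sK fK smooth_dsec_path g0 se wN).
have sp K : smooth_real setT K -> smooth_real reg (fun z => K (dsec_path z)).
  by move=> sK; exact: (smooth_comp oB openT sK smooth_dsec_path (fun _ _ => Logic.I)).
split.
  rewrite (iterD_ext (G := fun z => complex.Re (H (dsec_path z)) * complex.Re (dsec_coef z) +
      complex.Im (H (dsec_path z)) * - complex.Im (dsec_coef z)) _ oB _ rz); last first.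
    by move=> z /dsec_reg <-; rewrite cReM; ring.
  rewrite (iterDD _ oB rz).
  - by rewrite (path _ _ hr fr cr) (path _ _ hi fi (smoothN oB ci)) addr0.
  - exact: (smoothM oB (sp _ hr) cr).
  - exact: (smoothM oB (sp _ hi) (smoothN oB ci)).
rewrite (iterD_ext (G := fun z => complex.Re (H (dsec_path z)) * complex.Im (dsec_coef z) +
    complex.Im (H (dsec_path z)) * complex.Re (dsec_coef z)) _ oB _ rz); last first.
  by move=> z /dsec_reg <-; rewrite cImM; ring.
rewrite (iterDD _ oB rz).
- by rewrite (path _ _ hr fr ci) (path _ _ hi fi cr) addr0.
- exact: (smoothM oB (sp _ hr) ci).
- exact: (smoothM oB (sp _ hi) cr).
Qed.

End Dilation.

(** * The functional T has finite order *)

Section FlatOperator.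
Variables (R : realType) (p : nat).
Hypothesis p_gt0 : (0 < p)%N.
Variables (alpha beta : bool) (lambda nu : R[i]) (W : vectType R[i]).
Variable varpi : 'M[R]_p -> W -> W.
Hypothesis varpi_rep : is_rep varpi.
Local Notation I := (@I_triv R p.+1 alpha lambda).
Local Notation J := (J_rep varpi nu beta).
Variable D : ('M[R]_p.+2 -> R[i]^o) -> 'M[R]_p.+1 -> W.
Hypothesis DD : Diff I J D.
Local Notation bsec := (bsec alpha lambda).
Local Notation lift_at1 := (lift_at1 alpha lambda D).
Implicit Types (H : 'rV[R]_p.+1 -> R[i]).

Lemma csmooth_dil H s : csmooth setT H -> csmooth setT (fun x => H (dil s x)).
Proof.
move=> sH; rewrite (_ : (fun x => _) = fun x => H (mact 1%:M (s ^+ p.+1) (s ^+ p) x)).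
  exact: csmooth_mact.
by apply/funext => x; rewrite dil_mact.
Qed.

(** The case m = 1 and t = - p ln s of [lift_at1_p_elt]. *)
Lemma lift_at1_dil H s : csmooth setT H -> 0 < s ->
  lift_at1 (fun x => H (dil s x)) =
  cexp ((nu - lambda) * (p%:R * ln s)%:C) *: lift_at1 H.
Proof.
move=> sH s0; pose t := - (p%:R * ln s).
have := lift_at1_p_elt p_gt0 DD t sH (SL_SLpm (SL1 R p)).
rewrite det1 sgr1 rmorph1 expr1n scale1r invr1 mul1r invmx1.
have [_ -> _ _] := varpi_rep.
have pn : p%:R != 0 :> R by rewrite pnatr_eq0 -lt0n.
have et : (expR t)^-1 = s ^+ p by rewrite -expRN opprK mulrC expRM_natr lnK.
have ep : expR (- (t / p%:R)) = s by rewrite mulNr opprK mulrC mulKf// lnK.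
rewrite et ep -exprS hfac_gt0 ?expR_gt0// expRK.
rewrite (_ : (fun x => _) = fun x => H (dil s x)); last first.
  by apply/funext => x; rewrite dil_mact.
move=> E; apply: (scalerI (_ : cexp (- (lambda * t%:C)) != 0)).
  apply/eqP => c0; have := cexp0 R; rewrite -(addNr (lambda * t%:C)) cexpD c0 mul0r.
  by move/eqP; rewrite eq_sym oner_eq0.
rewrite E scalerA -cexpD; congr (cexp _ *: _).
by rewrite /t rmorphN; ring.
Qed.

Lemma norm1_form (phi : 'Hom(R[i]^o, R[i]^o)) (z : R[i]) : phi z = phi 1 * z.
Proof. by rewrite -{1}[z]mulr1 -[z * 1]/(z *: (1 : R[i]^o)) linearZ /= mulrC. Qed.

(* The sections attached to [x |-> H (dil t x)] have all seminorms O(t ^ M) as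
   t -> 0 if H is flat to order M plus the order of the seminorm, whereas T
   multiplies them by a power of t that does not depend on H. *)
Lemma lift_at1_flat_form (phi : 'Hom(W, R[i]^o)) :
  exists N, forall H, csmooth setT H -> flat N (fun x => complex.Re (H x)) ->
    flat N (fun x => complex.Im (H x)) -> complex.Re (phi (lift_at1 H)) = 0.
Proof.
have [_ _ cD _ _] := DD.
(* The seminorm that evaluates [phi] at the base point: a one-point compact set and no
   derivative. *)
pose s' := SeminormIndex (SL1 R p.+1) (@compact_set1 _ (0 : 'rV[R]_p)) [::] phi.
have [n [s [d [d0 Hd]]]] := cD s' 1 ltr01.
pose a := complex.Re ((nu - lambda) * p%:R%:C).
(* Under the dilation by t the functional T scales like t^a in modulus; M >= 1 + a leaves a factor t
   to spare. *)
have [M Ma] : exists M : nat, 1 + a <= M%:R.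
  exists (Num.bound `|1 + a|); rewrite ltW// (le_lt_trans (ler_norm _))//.
  exact: archi_boundP.
pose q := \max_(i < n) size (si_dirs (s i)).
exists (M + q)%N => H sH fr fi.
(* A bound that survives multiplication by every A > 0 forces the value to be 0. *)
have key (A : R) : 0 < A -> `|A * complex.Re (phi (lift_at1 H))| < 1.
  move=> A0.
  pose K i := dsec alpha lambda (si_base (s i)) H.
  have sK i : csmooth setT (K i) by apply: csmooth_dsec => //; exact: si_baseP.
  have fK i (w' : seq ('rV[R]_p.+1 * R)%type) y :
      (size w' < M + size (si_dirs (s i)))%N ->
      iterD w' (fun z => complex.Re (K i z)) (y, 0) = 0 /\
      iterD w' (fun z => complex.Im (K i z)) (y, 0) = 0.
    move=> w'N; apply: (dsec_flat alpha lambda (si_baseP (s i)) sH p_gt0 fr fi).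
    by rewrite (leq_trans w'N)// leq_add2l (leq_bigmax i).
  have /choice[B HB] : forall i, exists B : R, 0 <= B /\ forall y t, si_set (s i) y ->
      0 <= t <= 1 -> norm1 (iterDC (map (@ydir R _) (si_dirs (s i))) (K i) (y, t)) <= B * t ^+ M.
    move=> i; have [r1 r2] := sK i.
    have [B1 B10 HB1] := taylor_bound (@si_compact _ _ _ (s i)) r1 (fun w y h => (fK i w y h).1).
    have [B2 B20 HB2] := taylor_bound (@si_compact _ _ _ (s i)) r2 (fun w y h => (fK i w y h).2).
    exists (B1 + B2); split=> [|y t Cy t01]; first exact: addr_ge0.
    by rewrite mulrDl; apply: lerD; [exact: HB1|exact: HB2].
  pose c i := norm1 (si_form (s i) 1).
  pose S := \sum_i c i * (A * 2) * B i.
  have S0 i : 0 <= c i * (A * 2) * B i.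
    by have [B0 _] := HB i; rewrite !mulr_ge0 ?norm1_ge0// ltW.
  have SS0 : 0 <= S by apply: sumr_ge0 => i _; exact: S0.
  (* Small enough that S t < d, where S t bounds the seminorms [s i] of the section used below. *)
  pose t := Num.min 1 (d / (1 + S)).
  have S1 : 0 < 1 + S by rewrite ltr_pwDl.
  have t0 : 0 < t by rewrite lt_min ltr01 divr_gt0.
  have t1 : t <= 1 by rewrite ge_min lexx.
  (* This scalar cancels the factor by which T changes under the dilation, so that T of the scaled
     section is A times T of H. *)
  pose zt := A%:C * cexp (- ((nu - lambda) * (p%:R * ln t)%:C)).
  have nz : norm1 zt * t ^+ M <= A * 2 * t.
    have n1 : norm1 zt <= A * (2 * expR (- (a * ln t))).
      rewrite (le_trans (norm1M _ _))//; apply: ler_pM; rewrite ?norm1_ge0//.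
        by rewrite /norm1 /= normr0 addr0 gtr0_norm.
      rewrite (le_trans (norm1_cexp _))// ler_wpM2l// ler_expR /a.
      have RN (z : R[i]) (x : R) : complex.Re (- (z * x%:C)) = - (complex.Re z * x).
        by case: z => u v /=; rewrite mulr0 subr0.
      by rewrite rmorphM mulrA RN.
    apply: (le_trans (ler_wpM2r (exprn_ge0 _ (ltW t0)) n1)).
    rewrite -!mulrA ler_wpM2l ?(ltW A0)// ler_wpM2l//.
    have tE : t = expR (ln t) by rewrite lnK.
    have l0 : ln t <= 0 by exact: ln_le0.
    have : expR (- (a * ln t) + ln t * M%:R) <= expR (ln t) by rewrite ler_expR; nra.
    by rewrite expRD expRM_natr -tE.
  have If : bsec (fun x => zt * H (dil t x)) \in I.
    by rewrite inE; apply: bsec_I; [by []|apply: (csmoothZ _ openT); exact: csmooth_dil].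
  rewrite inE in If.
  have Hs i : seminorm_lt (s i) (bsec (fun x => zt * H (dil t x))) d.
    move=> y Cy.
    have E : (fun y => complex.Re (si_form (s i) (bsec (fun x => zt * H (dil t x))
        (si_base (s i) *m nminus y)))) =
      fun y => complex.Re (si_form (s i) 1 * zt * K i (y, t)).
      apply/funext => y'; rewrite norm1_form -mulrA /K -(bsec_dil _ _ (si_baseP (s i))).
      rewrite /bsec; case: ifP => _; last by rewrite !mulr0.
      by rewrite /bfun; case: ifP => _; rewrite ?mulr0//; congr (complex.Re (_ * _)); ring.
    have cA : continuous (fun y : 'rV[R]_p.+1 => (y, t)).
      move=> z; exact: (@cvg_pair _ _ _ (nbhs z) (nbhs z) (nbhs t) _ _ _ (fun y => y)
        (fun=> t) cvg_id (cvg_cst t)).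
    have AL (b : R) (v u : 'rV[R]_p.+1) : (b *: v + u, t) = b *: @ydir R _ v + (u, t).
      by rewrite /ydir; congr (_, _); rewrite /= scaler0 add0r.
    have sKt := csmooth_affine AL cA (fun _ _ => Logic.I) (sK i) : csmooth setT _.
    rewrite E; have -> : iterD (si_dirs (s i)) (fun y => complex.Re (si_form (s i) 1 * zt * K i (y, t))) y =
        complex.Re (si_form (s i) 1 * zt * iterDC (map (@ydir R _) (si_dirs (s i))) (K i) (y, t)).
      rewrite -(iterDC_affine (K i) (si_dirs (s i)) y AL).
      by rewrite -(iterDC_Z (si_form (s i) 1 * zt) (si_dirs (s i)) openT Logic.I sKt).
    have [B0 HBi] := HB i.
    apply: (le_lt_trans (Re_norm1 _)); apply: (le_lt_trans (norm1M _ _)).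
    have Hn := HBi y t Cy; rewrite (ltW t0) t1 in Hn; have {}Hn := Hn isT.
    apply: (le_lt_trans (ler_pM (norm1_ge0 _) (norm1_ge0 _) (norm1M _ _) Hn)).
    have Hc : c i * norm1 zt * (B i * t ^+ M) <= c i * (A * 2) * B i * t.
      have -> : c i * norm1 zt * (B i * t ^+ M) = c i * B i * (norm1 zt * t ^+ M) by ring.
      have -> : c i * (A * 2) * B i * t = c i * B i * (A * 2 * t) by ring.
      by apply: ler_wpM2l => //; rewrite mulr_ge0 ?norm1_ge0.
    apply: (le_lt_trans Hc).
    have : c i * (A * 2) * B i <= S.
      by rewrite /S (bigD1 i)//= lerDl sumr_ge0// => j _; exact: S0.
    move=> HS; have : c i * (A * 2) * B i * t <= S * t by rewrite ler_wpM2r// ltW.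
    move=> /le_lt_trans; apply.
    have : t <= d / (1 + S) by rewrite ge_min lexx orbT.
    rewrite ler_pdivlMr// => h; lra.
  have := Hd _ If Hs 0 erefl.
  rewrite /= nminus0 mulmx1 -/(at1 _ _) -/(lift_at1 _).
  rewrite (lift_at1Z DD _ (csmooth_dil _ sH)) (lift_at1_dil sH t0) scalerA -mulrA -cexpD addNr.
  by rewrite cexp0 mulr1 linearZ /= [_ *: _]/(_ * _) cReM /= mul0r subr0.
apply/eqP; apply: contraT => r0; have n0 : 0 < `|complex.Re (phi (lift_at1 H))| by rewrite normr_gt0.
have := key (`|complex.Re (phi (lift_at1 H))|^-1); rewrite invr_gt0 => /(_ n0).
by rewrite normrM normfV normr_id mulVf ?gt_eqF// ltxx.
Qed.

End FlatOperator.

(** * Taylor polynomials *)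

Section Jets.
Variables (R : realType) (k : nat).
Implicit Types (q : mpoly k R[i]) (x : 'rV[R]_k) (H : 'rV[R]_k -> R[i]) (l : seq 'I_k).

Definition ev q x : R[i] := meval (fun i => (x 0 i)%:C) q.
Definition evec (i : 'I_k) : 'rV[R]_k := delta_mx 0 i.

Lemma smooth_coord (U : set 'rV[R]_k) i : open U -> smooth_real U (fun x : 'rV[R]_k => x 0 i).
Proof.
move=> oU; apply: smooth_linearP => // [a u v|]; first by rewrite !mxE.
exact: coord_continuous.
Qed.

Lemma csmooth_ev q : csmooth setT (ev q).
Proof.
have oT : open [set: 'rV[R]_k] by exact: openT.
have H : csmooth [set: 'rV[R]_k] (fun x => \sum_(m <- msupp q) mcoeff m q *
    \prod_i (x 0 i)%:C ^+ m i).
  apply: (csmooth_sum _ _ oT) => m; apply: (csmoothZ _ oT).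
  apply: (csmooth_prod _ oT) => i; apply: (csmoothX _ oT).
  by apply: (csmooth_real oT); exact: smooth_coord.
by apply: (csmooth_ext oT _ H) => x _; rewrite /ev mevalE.
Qed.

Lemma iterDC1M (V : normedModType R) (U : set V) (F G : V -> R[i]) (v x : V) : U x ->
  csmooth U F -> csmooth U G ->
  iterDC [:: v] (fun y => F y * G y) x =
  iterDC [:: v] F x * G x + F x * iterDC [:: v] G x.
Proof.
move=> Ux [rF iF] [rG iG].
have dd (f g : V -> R) : smooth_real U f -> smooth_real U g ->
    is_derive x v (fun y => f y * g y) (f x * 'D_v g x + g x * 'D_v f x).
  move=> sf sg; have [_ df] := sf [::] x Ux; have [_ dg] := sg [::] x Ux.
  exact: is_deriveM (derivableP (df v)) (derivableP (dg v)).
apply: complexP.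
  have [_ E] := is_deriveB (dd _ _ rF rG) (dd _ _ iF iG).
  rewrite /iterDC /= cReD !cReM /=.
  rewrite (_ : (fun y => complex.Re (F y * G y)) = (fun y => complex.Re (F y) * complex.Re (G y))
    - (fun y => complex.Im (F y) * complex.Im (G y))).
    by rewrite E; ring.
  by apply/funext => y; rewrite cReM.
have [_ E] := is_deriveD (dd _ _ rF iG) (dd _ _ iF rG).
rewrite /iterDC /= cImD !cImM /=.
rewrite (_ : (fun y => complex.Im (F y * G y)) = (fun y => complex.Re (F y) * complex.Im (G y))
  + (fun y => complex.Im (F y) * complex.Re (G y))).
  by rewrite E; ring.
by apply/funext => y; rewrite cImM.
Qed.

(** The identity holds for constants and variables and is stable under sums and products. *)
Lemma iterDC1_ev q i x : iterDC [:: evec i] (ev q) x = ev (mderiv i q) x.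
Proof.
have oT : open [set: 'rV[R]_k] by exact: openT.
pose P q := forall x, iterDC [:: evec i] (ev q) x = ev (mderiv i q) x.
have PC c : P (mpolyC k c).
  move=> y; rewrite mderivC /ev meval0.
  have -> : (fun z : 'rV[R]_k => meval (fun i0 => (z 0 i0)%:C) (mpolyC k c)) = fun=> c.
    by apply/funext => z; rewrite mevalC.
  by rewrite /iterDC /= !derive_cst.
have PX j : P (mpolyX R[i] (mnm1 j)).
  move=> y; rewrite mderivX /ev mnm1E.
  have -> : (fun z : 'rV[R]_k => meval (fun i0 => (z 0 i0)%:C) (mpolyX R[i] (mnm1 j))) =
      fun z => (z 0 j)%:C by apply/funext => z; rewrite mevalXU.
  have E : 'D_(evec i) (fun z : 'rV[R]_k => z 0 j) y = (j == i)%:R.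
    have l : linear (fun z : 'rV[R]_k => z 0 j) by move=> a u v; rewrite !mxE.
    pose L : {linear 'rV[R]_k -> R} := HB.pack (fun z : 'rV[R]_k => z 0 j)
      (GRing.isLinear.Build R _ _ _ _ l).
    by have [_ ->] := is_derive_linear L y (evec i); rewrite /= mxE eqxx.
  rewrite /iterDC /= derive_cst E mevalZ.
  case: (eqVneq j i) => [<-|_]; last by rewrite mul0r.
  have -> : mnm_sub (mnm1 j) (mnm1 j) = @mnm0 k.
    by apply/mnmP => a; rewrite mnmBE subnn mnm0E.
  by rewrite mpolyX0 meval1 mulr1.
have PD a b : P a -> P b -> P (a + b).
  move=> Pa Pb y; rewrite mderivD /ev mevalD -/(ev _ y) -Pa -/(ev (mderiv i b) y) -Pb.
  rewrite -(iterDC_D _ oT Logic.I (csmooth_ev a) (csmooth_ev b)).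
  by congr (iterDC _ _ y); apply/funext => z; rewrite /ev mevalD.
have PM a b : P a -> P b -> P (a * b).
  move=> Pa Pb y; rewrite mderivM /ev mevalD !mevalM -!/(ev _ y) -Pa -Pb.
  rewrite -(iterDC1M _ Logic.I (csmooth_ev a) (csmooth_ev b)).
  by congr (iterDC _ _ y); apply/funext => z; rewrite /ev mevalM.
have P1 : P 1 by exact: PC.
suff : P q by exact.
elim/mpolyind: q => [|c m q _ _ Pq]; first exact: (PC 0).
apply: (PD _ _ _ Pq); rewrite -mul_mpolyC; apply: (PM _ _ (PC c)).
rewrite mpolyXE_id; elim/big_ind: _ => [|a b Pa Pb|j _]; [exact: P1|exact: PM|].
elim: (m j) => [|n ih]; first by rewrite expr0; exact: P1.
by rewrite exprS; exact: PM.
Qed.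

Lemma iterDC_ev l q x : iterDC (map evec l) (ev q) x = ev (foldr (@mderiv k R[i]) q l) x.
Proof.
elim: l x => [|i l ih] x /=; first by rewrite /iterDC /=; case: (ev q x).
rewrite -[evec i :: _]cat1s iterDC_cat -iterDC1_ev; congr (iterDC _ _ x).
exact/funext.
Qed.

Definition cflat N H : Prop := forall w, (size w < N)%N -> iterDC w H 0 = 0.

(** By multilinearity each direction can be expanded in the standard basis. *)
Lemma cflat_basis N H : csmooth setT H ->
  (forall l, (size l < N)%N -> iterDC (map evec l) H 0 = 0) -> cflat N H.
Proof.
move=> sH Hl w wN.
suff : forall l, (size l + size w < N)%N -> iterDC (map evec l ++ w) H 0 = 0.
  by move=> /(_ [::]); exact.
elim: w {wN} => [|v w ih] l lN; first by rewrite cats0; apply: Hl; rewrite addn0 in lN.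
rewrite (row_sum_delta v) (iterDC_dir_sum _ _ _ _ _ openT Logic.I sH) big1// => i _.
rewrite -cat_rcons -[delta_mx 0 i]/(evec i) -map_rcons ih ?mulr0//.
by rewrite size_rcons addSnnS.
Qed.

(** A canonical word for each multi-index; as derivatives commute, any word of indices may be
    replaced by it. *)
Definition mword (m : multinom k) : seq 'I_k := flatten [seq nseq (m i) i | i <- enum 'I_k].
Definition mdirs (m : multinom k) : seq 'rV[R]_k := map evec (mword m).
Definition mcount l : multinom k := Multinom [tuple (count_mem i l)%N | i < k].
Definition mfact (m : multinom k) : R[i] := (\prod_i (m i)`!)%:R.

Lemma perm_mword l : perm_eq l (mword (mcount l)).
Proof.
apply/allP => i _ /=; rewrite /mword count_flatten -map_comp sumnE big_map big_enum /=.
rewrite (bigD1 i)//= count_nseq /= eqxx mul1n big1 ?addn0 => [|j ji].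
  by rewrite multinomE tnth_mktuple.
by rewrite count_nseq /= (negbTE ji) mul0n.
Qed.

Lemma mdeg_mcount l : mdeg (mcount l) = size l.
Proof.
rewrite (perm_size (perm_mword l)) /mword size_flatten /shape -map_comp sumnE big_map big_enum /=.
by rewrite mdegE; apply: eq_bigr => i _; rewrite size_nseq.
Qed.

Lemma iterDC_word l H x : csmooth setT H ->
  iterDC (map evec l) H x = iterDC (mdirs (mcount l)) H x.
Proof.
move=> sH; apply: (iterDC_perm openT Logic.I sH).
by apply: perm_map; exact: perm_mword.
Qed.

Lemma mfact_neq0 m : mfact m != 0.
Proof. by rewrite pnatr_eq0 -lt0n prodn_gt0// => i; exact: fact_gt0. Qed.

Lemma iterDC_mdirs_ev m q : iterDC (mdirs m) (ev q) 0 = mcoeff m q * mfact m.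
Proof.
rewrite iterDC_ev -[foldr _ _ _]/(foldr (@mderiv k R[i]) q (flatten [seq nseq (m i) i | i <- enum 'I_k])).
rewrite -mderivm_foldr /ev.
have -> : meval (fun i => ((0 : 'rV[R]_k) 0 i)%:C) (mderivm m q) = mcoeff (@mnm0 k) (mderivm m q).
  rewrite {1}[mderivm m q]mpolyE raddf_sum /=.
  have [h|h] := boolP ((@mnm0 k) \in msupp (mderivm m q)).
    rewrite (bigD1_seq (@mnm0 k)) ?msupp_uniq//= mevalZ mpolyX0 meval1 mulr1 big1 ?addr0// => m' m'0.
    rewrite mevalZ mevalX; move: m'0; rewrite -mdeg_eq0 mdegE sum_nat_eq0 negb_forall.
    by move=> /existsP[i /= mi]; rewrite (bigD1 i)//= mxE expr0n (negbTE mi) mul0r mulr0.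
  rewrite (memN_msupp_eq0 h) big_seq big1// => m' m'S.
  rewrite mevalZ mevalX.
  have : m' != (@mnm0 k) by apply: contraNneq h => <-.
  rewrite -mdeg_eq0 mdegE sum_nat_eq0 negb_forall.
  by move=> /existsP[i /= mi]; rewrite (bigD1 i)//= mxE expr0n (negbTE mi) mul0r mulr0.
rewrite mcoeff_mderivm addm0 -mulr_natr; congr (_ * _%:R).
by apply: eq_bigr => i _; rewrite ffactnn.
Qed.

(** The Taylor polynomial at 0, truncated to degrees less than N. *)
Definition jet N H : mpoly k R[i] :=
  \sum_(m : bmultinom k N) (iterDC (mdirs m) H 0 / mfact m) *: mpolyX R[i] m.

Lemma mcoeff_jet N H m : (mdeg m < N)%N -> mcoeff m (jet N H) = iterDC (mdirs m) H 0 / mfact m.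
Proof.
move=> mN; rewrite /jet raddf_sum /= (bigD1 (BMultinom mN))//= mcoeffZ mcoeffX eqxx mulr1.
rewrite big1 ?addr0// => m' m'm; rewrite mcoeffZ mcoeffX.
by rewrite -[m' == m :> multinom k]/(m' == BMultinom mN) (negbTE m'm) mulr0.
Qed.

Lemma cflat_jet N H : csmooth setT H -> cflat N (fun x => H x + (-1) * ev (jet N H) x).
Proof.
move=> sH; have oT : open [set: 'rV[R]_k] by exact: openT.
have sE := csmoothZ (-1) oT (csmooth_ev (jet N H)).
apply: cflat_basis => [|l lN]; first exact: (csmoothD oT sH sE).
rewrite (iterDC_D _ oT Logic.I sH sE) (iterDC_Z _ _ oT Logic.I (csmooth_ev _)).
rewrite (iterDC_word l 0 sH) (iterDC_word l 0 (csmooth_ev _)).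
rewrite iterDC_mdirs_ev mcoeff_jet ?mdeg_mcount// divfK ?mfact_neq0//.
by rewrite mulN1r addrN.
Qed.

Lemma ev_inj q : (forall x, ev q x = 0) -> q = 0.
Proof.
move=> q0; apply/mpolyP => m; rewrite mcoeff0; apply: (mulIf (mfact_neq0 m)).
rewrite -iterDC_mdirs_ev mul0r (_ : ev q = fun=> 0); last exact/funext.
by rewrite /iterDC /= !iterD_zero.
Qed.

End Jets.

Section CexpCalculus.
Variable R : realType.

(** For z = a + i b, the case r = 1 has modulus exp a, so a = 0; then r = pi / b would give the
    value -1. *)
Lemma cexp_line_eq1 (z : R[i]) : (forall r : R, cexp (z * r%:C) = 1) -> z = 0.
Proof.
case: z => a b H.
have E (r : R) : expR (a * r) * cos (b * r) = 1 /\ expR (a * r) * sin (b * r) = 0.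
  have := H r; rewrite /cexp /= !mulr0 subr0 add0r => /eqP.
  rewrite eq_complex /= !mul0r subr0 addr0 => /andP[/eqP e1 /eqP e2].
  by rewrite e1 e2.
have a0 : a = 0.
  have [e1 e2] := E 1; rewrite !mulr1 in e1 e2.
  have : expR a ^+ 2 = 1.
    have : expR a ^+ 2 * (cos b ^+ 2 + sin b ^+ 2) = 1.
      by rewrite mulrDr -!exprMn e1 e2 expr1n expr0n /= addr0.
    by rewrite cos2Dsin2 mulr1.
  rewrite -expRM_natr -[RHS]expR0 => /expR_inj/eqP; rewrite mulf_eq0 pnatr_eq0 orbF.
  by move/eqP.
have [->|b0] := eqVneq b 0; first by rewrite a0.
have [e1 _] := E (pi / b); move: e1; rewrite a0 mul0r expR0 mul1r mulrC divfK// cospi.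
by move/eqP; rewrite eqNr oner_eq0.
Qed.

Lemma cexp_natr (n : nat) (r : R) : cexp (n%:R * r%:C) = (expR r)%:C ^+ n.
Proof.
have -> : n%:R * r%:C = (r * n%:R)%:C :> R[i] by rewrite rmorphM rmorph_nat mulrC.
rewrite /cexp /= cos0 sin0 expRM_natr rmorphXn /=.
by rewrite -[X in _ * X]/(1 : R[i]) mulr1.
Qed.

Lemma iterDC1_cexp (V : normedModType R) (f : V -> R) (z : R[i]) (v x : V) (d : R) :
  is_derive x v f d ->
  iterDC [:: v] (fun y => cexp (z * (f y)%:C)) x = z * d%:C * cexp (z * (f x)%:C).
Proof.
case: z => a b df.
have H (g : R -> R) (c g' : R) : is_derive (c * f x) 1 g g' ->
    is_derive x v (fun y => g (c * f y)) (g' * (c * d)).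
  move=> dg; have dcf : is_derive x v (fun y => c * f y) (c * d) by exact: is_deriveZ.
  have [d1 e1] := dcf; have [d2 e2] := dg.
  by have := is_derive_comp1 d1 d2; rewrite e1 e2.
have he := H _ a _ (is_derive_expR _).
have hc := H _ b _ (is_derive_cos _).
have hs := H _ b _ (is_derive_sin _).
have [_ e1] := is_deriveM he hc; have [_ e2] := is_deriveM he hs.
have E : (fun y => cexp ((a +i* b) * (f y)%:C)) =
    fun y => (expR (a * f y) * cos (b * f y)) +i* (expR (a * f y) * sin (b * f y)).
  apply/funext => y; rewrite /cexp /= !mulr0 subr0 add0r.
  by apply: complexP => /=; rewrite ?mul0r ?subr0 ?addr0.
rewrite E /iterDC /= e1 e2 /cexp /= !mulr0 subr0 add0r /GRing.scale /=.
by apply: complexP => /=; ring.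
Qed.

End CexpCalculus.

(** * Values of T on monomials and weights under A' *)

Section PolyOperator.
Variables (R : realType) (p : nat).
Hypothesis p_gt0 : (0 < p)%N.
Variables (alpha beta : bool) (lambda nu : R[i]) (W : vectType R[i]).
Variable varpi : 'M[R]_p -> W -> W.
Hypothesis varpi_rep : is_rep varpi.
Local Notation I := (@I_triv R p.+1 alpha lambda).
Local Notation J := (J_rep varpi nu beta).
Variable D : ('M[R]_p.+2 -> R[i]^o) -> 'M[R]_p.+1 -> W.
Hypothesis DD : Diff I J D.
Local Notation bsec := (bsec alpha lambda).
Local Notation lift_at1 := (lift_at1 alpha lambda D).
Local Notation at1 := (at1 D).
Implicit Types (H : 'rV[R]_p.+1 -> R[i]) (m : multinom p.+1) (q : mpoly p.+1 R[i]).

(** W is finite-dimensional, so one takes the largest order among the real and imaginary parts of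
    the coordinates. *)
Lemma lift_at1_cflat : exists N, forall H, csmooth setT H -> cflat N H -> lift_at1 H = 0.
Proof.
pose b := vbasis {:W}.
have ex i (c : R[i]) : exists N, forall H, csmooth setT H -> cflat N H ->
    complex.Re (c * coord b i (lift_at1 H)) = 0.
  have [N HN] := lift_at1_flat_form p_gt0 varpi_rep DD (c *: linfun (coord b i : W -> R[i]^o)).
  exists N => H sH fH; rewrite -[RHS](HN H sH).
  - by rewrite scale_lfunE lfunE.
  - by move=> w wN; have := fH w wN => /(congr1 (@complex.Re R)).
  - by move=> w wN; have := fH w wN => /(congr1 (@complex.Im R)).
have /choice[n1 Hn1] := fun i => ex i 1.
have /choice[n2 Hn2] := fun i => ex i (- 'i%C).
pose N := \max_i maxn (n1 i) (n2 i).
exists N => H sH fH.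
rewrite (coord_vbasis (memvf (lift_at1 H))) big1// => i _.
have le i' : (maxn (n1 i') (n2 i') <= N)%N by exact: leq_bigmax.
have cf n : (n <= N)%N -> cflat n H by move=> nN w wn; apply: fH; exact: leq_trans wn nN.
have e1 := Hn1 i H sH (cf _ (leq_trans (leq_maxl _ _) (le i))).
have e2 := Hn2 i H sH (cf _ (leq_trans (leq_maxr _ _) (le i))).
rewrite mul1r in e1; rewrite cReM /= oppr0 mul0r sub0r mulN1r opprK in e2.
rewrite (_ : coord _ _ _ = 0) ?scale0r//.
exact: complexP.
Qed.

Definition tpoly q : W := lift_at1 (ev q).

Fact tpoly_is_linear : linear tpoly.
Proof.
move=> c a b; rewrite /tpoly -(lift_at1_lin DD _ (csmooth_ev a) (csmooth_ev b)).
by congr lift_at1; apply/funext => x; rewrite /ev mevalD mevalZ.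
Qed.

Lemma tpoly0 : tpoly 0 = 0.
Proof. by have := tpoly_is_linear (-1) 0 0; rewrite scaler0 addr0 scaleN1r addNr. Qed.

Lemma tpolyZ c q : tpoly (c *: q) = c *: tpoly q.
Proof. by have := tpoly_is_linear c q 0; rewrite tpoly0 !addr0. Qed.

Lemma tpolyD a b : tpoly (a + b) = tpoly a + tpoly b.
Proof. by have := tpoly_is_linear 1 a b; rewrite !scale1r. Qed.

Lemma tpoly_sum (T : Type) (r : seq T) (F : T -> mpoly p.+1 R[i]) :
  tpoly (\sum_(i <- r) F i) = \sum_(i <- r) tpoly (F i).
Proof. exact: (big_morph tpoly tpolyD tpoly0). Qed.

(** H and its Taylor polynomial differ by a flat function. Larger orders are included because
    reading off D_(a, l) requires an order above a + l. *)
Lemma lift_at1_jet : exists N, forall N', (N <= N')%N -> forall H, csmooth setT H ->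
  lift_at1 H = tpoly (jet N' H).
Proof.
have [N HN] := lift_at1_cflat; exists N => N' NN' H sH.
have sE := csmooth_ev (jet N' H).
have : lift_at1 (fun x => (-1) * ev (jet N' H) x + H x) = 0.
  apply: HN; first by apply: (csmoothD openT _ sH); exact: (csmoothZ _ openT).
  rewrite (_ : (fun x => _) = fun x => H x + -1 * ev (jet N' H) x).
    by move=> w wN; exact: (@cflat_jet _ _ N' H sH w (leq_trans wN NN')).
  by apply/funext => x; rewrite addrC.
by rewrite (lift_at1_lin DD _ sE sH) scaleN1r addrC => /eqP; rewrite subr_eq0 => /eqP.
Qed.

Definition weight m : nat := \sum_i (p + (i != ord_max)) * m i.

Lemma ev_dil m s x : ev (mpolyX R[i] m) (dil s x) = (s%:C) ^+ weight m * ev (mpolyX R[i] m) x.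
Proof.
rewrite /ev !mevalX /weight -prodrXr -big_split /=.
by apply: eq_bigr => i _; rewrite mxE rmorphM rmorphXn exprMn -exprM.
Qed.

(** A monomial is an eigenvector of every dilation, with eigenvalue s to its weight, while T
    multiplies by s^((nu - lambda) p); a non-zero value forces the exponents to agree. *)
Lemma tpoly_weight m : tpoly (mpolyX R[i] m) != 0 -> (nu - lambda) * p%:R = (weight m)%:R.
Proof.
move=> t0; apply/eqP; rewrite -subr_eq0; apply/eqP/cexp_line_eq1 => r.
have := lift_at1_dil p_gt0 varpi_rep DD (csmooth_ev (mpolyX R[i] m)) (expR_gt0 r).
rewrite (_ : (fun x => _) = fun x => (expR r)%:C ^+ weight m * ev (mpolyX R[i] m) x).
  rewrite (lift_at1Z DD _ (csmooth_ev _)) -/(tpoly _) => /eqP.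
  rewrite -subr_eq0 -scalerBl scaler_eq0 (negbTE t0) orbF subr_eq0 => /eqP.
  rewrite -cexp_natr expRK => E.
  have E' : cexp ((nu - lambda) * p%:R * r%:C) = cexp ((weight m)%:R * r%:C).
    by rewrite E rmorphM rmorph_nat mulrA.
  by rewrite mulrBl cexpD E' -cexpD addrN cexp0.
by apply/funext => x; rewrite ev_dil.
Qed.

End PolyOperator.

(** * Invariance of T under N'_+ *)

Section Nilpotent.
Variables (R : realType) (p : nat).
Hypothesis p_gt0 : (0 < p)%N.
Variables (alpha beta : bool) (lambda nu : R[i]) (W : vectType R[i]).
Variable varpi : 'M[R]_p -> W -> W.
Hypothesis varpi_rep : is_rep varpi.
Local Notation I := (@I_triv R p.+1 alpha lambda).
Local Notation J := (J_rep varpi nu beta).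
Variable D : ('M[R]_p.+2 -> R[i]^o) -> 'M[R]_p.+1 -> W.
Hypothesis DD : Diff I J D.
Local Notation bsec := (bsec alpha lambda).
Local Notation lift_at1 := (lift_at1 alpha lambda D).
Local Notation at1 := (at1 D).
Local Notation tpoly := (tpoly alpha lambda D).
Local Notation VR := ('rV[R]_p.+1 * R)%type.

Lemma form_separates (w : W) : (forall phi : 'Hom(W, R[i]^o), phi w = 0) -> w = 0.
Proof.
move=> H; rewrite (coord_vbasis (memvf w)) big1// => i _.
have := H (linfun (coord (vbasis {:W}) i : W -> R[i]^o)).
by rewrite lfunE /= => ->; rewrite scale0r.
Qed.

Lemma linear_formZ (phi : 'Hom(W, R[i]^o)) (a : R[i]) (w : W) : phi (a *: w) = a * phi w :> R[i].
Proof. by rewrite linearZ. Qed.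

Lemma derive_line_const (V : normedModType R) (F : V -> R) (v x : V) :
  (forall h : R, F (h *: v + x) = F x) -> 'D_v F x = 0.
Proof.
move=> H; rewrite /derive (_ : (fun h : R => _) = cst 0); first exact: lim_cst.
by apply/funext => h; rewrite /= H subrr scaler0.
Qed.

Lemma iterDC_line_const (V : normedModType R) (F : V -> R[i]) (v x : V) :
  (forall h : R, F (h *: v + x) = F x) -> iterDC [:: v] F x = 0.
Proof. by move=> H; rewrite /iterDC /= !derive_line_const// => h; rewrite H. Qed.

Lemma mevalZ_mon n (m : multinom n) (c : R[i]) (x : 'I_n -> R[i]) :
  meval (fun i => c * x i) (mpolyX R[i] m) = c ^+ mdeg m * meval x (mpolyX R[i] m).
Proof.
rewrite !mevalX mdegE -prodrXr -big_split /=.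
by apply: eq_bigr => i _; rewrite exprMn.
Qed.

Variables (m : multinom p.+1) (j : 'I_p).
Local Notation xJ := (lift ord_max j).
Local Notation q := (mpolyX R[i] m).
Local Notation d := (mdeg m).

(** For z = (x, t), [den] is the corner entry after the element of N'_+ with parameter t e_j, and
    positivity of [small] keeps the image point where the cut-off is 1. *)
Definition den (z : VR) : R := 1 + z.2 * z.1 0 xJ.
Definition small (z : VR) : R := den z ^+ 2 - 2 * \sum_i (z.1 0 i) ^+ 2.
Definition dom : set VR := [set z | 0 < den z] `&` [set z | 0 < small z].
Definition pulled (z : VR) : R[i] :=
  bsec (ev q) (diag_last1 (p_elt 1%:M 0 (z.2 *: delta_mx 0 j)) *m nminus z.1).
(** The exponent - lambda comes from [hfac], and - d from the homogeneity of the monomial evaluated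
    at x / [den]. *)
Definition model (z : VR) : R[i] :=
  cexp (- (lambda + d%:R) * (ln (den z))%:C) * ev q z.1.

Lemma smooth_fst_coord (U : set VR) i : open U -> smooth_real U (fun z : VR => z.1 0 i).
Proof.
apply: smooth_linearP => [a u v|z]; first by rewrite /= !mxE.
apply: (@continuous_comp _ _ _ (fun z : VR => z.1) (fun x => x 0 i)); first exact: cvg_fst.
exact: coord_continuous.
Qed.

Lemma smooth_snd_coord (U : set VR) : open U -> smooth_real U (fun z : VR => z.2).
Proof. by apply: smooth_linearP => [a u v //|z]; exact: cvg_snd. Qed.

Lemma smooth_den (U : set VR) : open U -> smooth_real U den.
Proof.
move=> oU; apply: (smoothD oU (smooth_cst 1 oU)).
exact: (smoothM oU (smooth_snd_coord oU) (smooth_fst_coord _ oU)).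
Qed.

Lemma smooth_small (U : set VR) : open U -> smooth_real U small.
Proof.
move=> oU; apply: (smoothB oU (smoothX 2 oU (smooth_den oU))); apply: (smoothZ 2 oU).
by apply: (smooth_sum _ oU) => i _; exact: (smoothX 2 oU (smooth_fst_coord i oU)).
Qed.

Lemma open_dom : open dom.
Proof. by apply: openI; apply: open_gt0_smooth; [exact: smooth_den openT|exact: smooth_small openT]. Qed.

Lemma csmooth_model : csmooth dom model.
Proof.
have oB := open_dom.
apply: (csmoothM oB).
  apply: (csmooth_cexp _ oB).
  apply: (smooth_comp1 oB (@open_gt R 0) (@smooth_ln R) (smooth_den oB)).
  by move=> z [].
have AL (a : R) (v y : VR) : (a *: v + y).1 = a *: v.1 + y.1 by [].
have cA : continuous (fun z : VR => z.1) by move=> z; exact: cvg_fst.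
exact: (@csmooth_affine _ _ _ dom setT _ _ _ AL cA (fun _ _ => Logic.I) (csmooth_ev q)).
Qed.

Lemma pulled_model z : dom z -> pulled z = model z.
Proof.
case: z => x t [/= u0 s0]; rewrite /pulled /model /=.
have If : I (bsec (ev q)) by apply: bsec_I => //; exact: csmooth_ev.
have S : \sum_i (t *: delta_mx 0 j : 'rV[R]_p) 0 i * x 0 (lift ord_max i) = t * x 0 xJ.
  rewrite (bigD1 j)//= !mxE !eqxx mulr1 big1 ?addr0// => i ij.
  by rewrite !mxE (negbTE ij) !mulr0 mul0r.
have uE : 1 + t * x 0 xJ = den (x, t) by [].
rewrite (section_p_elt (m := 1%:M) p_gt0 0 If (SL_SLpm (SL1 R p))) S uE ?gt_eqF//.
set u := den (x, t) in u0 s0 *.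
rewrite det1 invr1 expR0 !mul1r mul0r oppr0 expR0 mul1r.
have -> : mact 1%:M u^-1 u^-1 x = u^-1 *: x.
  apply/rowP; elim/ord_max_ind => [|i]; first by rewrite mact_max !mxE.
  rewrite mact_lift mxE (bigD1 i)//= mxE eqxx mul1r big1 ?addr0// => i' i'i.
  by rewrite mxE eq_sym (negbTE i'i) mul0r.
rewrite /bsec det_nminus eqxx /bfun nminus00 oner_eq0 chart_nminus hfac1 mulr1.
rewrite chi_eq1; last 2 first.
- exact: col_norm2_gt0 (SL_nminus _).
- rewrite nminus00 /col_norm2 big_ord_recl nminus00 expr1n.
  have -> : \sum_(i < p.+1) nminus (u^-1 *: x) (lift ord0 i) ord0 ^+ 2 =
      (\sum_i x 0 i ^+ 2) / u ^+ 2.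
    by rewrite mulr_suml; apply: eq_bigr => i _; rewrite nminusl0 mxE exprMn exprVn mulrC.
  have : (\sum_i x 0 i ^+ 2) / u ^+ 2 <= 1 / 2.
    rewrite ler_pdivrMr ?exprn_gt0//; move: s0; rewrite /small -/u /=; lra.
  lra.
rewrite mul1r (hfac_gt0 _ _ u0).
have -> : ev q (u^-1 *: x) = (u^-1)%:C ^+ d * ev q x.
  rewrite /ev -mevalZ_mon; apply: meval_eq => i.
  by rewrite mxE rmorphM.
rewrite mulrA; congr (_ * _).
have -> : u^-1 = expR (- ln u) by rewrite expRN lnK.
by rewrite -cexp_natr -cexpD rmorphN; congr cexp; ring.
Qed.

Lemma dom0 t : dom (0, t).
Proof.
split; rewrite /= /small /den /= mxE mulr0 addr0// expr1n big1 => [|i _].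
  by rewrite mulr0 subr0.
by rewrite mxE expr0n.
Qed.

Lemma is_derive_den x : is_derive ((x, 0) : VR) (@sdir R _) den (x 0 xJ).
Proof.
apply: is_derive_lineV.
rewrite (_ : (fun s : R => _) = fun s => 1 + s * x 0 xJ); last first.
  by apply/funext => s; rewrite /den /sdir /= scaler0 add0r addr0 [s *: 1]mulr1.
have h1 := is_derive_cst (1 : R) (0 : R) (1 : R).
have h2 : is_derive (0 : R) 1 (fun s : R => s * x 0 xJ) (x 0 xJ).
  have := is_deriveM (is_derive_id (0 : R) (1 : R)) (is_derive_cst (x 0 xJ) (0 : R) (1 : R)).
  by apply: (fun h => is_derive_eq h _); rewrite scaler0 add0r [_ *: 1]mulr1.
by apply: (is_derive_eq (is_deriveD h1 h2)); rewrite add0r.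
Qed.

Lemma model_derive x : dom (x, 0) ->
  iterDC [:: @sdir R _] model (x, 0) = ev (- (lambda + d%:R) *: (mpolyX R[i] (mnm1 xJ) * q)) x.
Proof.
move=> dx; have oB := open_dom.
have d1 : den (x, 0) = 1 by rewrite /den /= mul0r addr0.
have s1 : csmooth dom (fun z => cexp (- (lambda + d%:R) * (ln (den z))%:C)).
  apply: (csmooth_cexp _ oB).
  apply: (smooth_comp1 oB (@open_gt R 0) (@smooth_ln R) (smooth_den oB)).
  by move=> z [].
have s2 : csmooth dom (fun z => ev q z.1).
  have AL (a : R) (v y : VR) : (a *: v + y).1 = a *: v.1 + y.1 by [].
  have cA : continuous (fun z : VR => z.1) by move=> z; exact: cvg_fst.
  exact: (@csmooth_affine _ _ _ dom setT _ _ _ AL cA (fun _ _ => Logic.I) (csmooth_ev q)).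
rewrite (iterDC1M _ dx s1 s2).
rewrite [iterDC _ (fun z => ev q z.1) _]iterDC_line_const ?mulr0 ?addr0; last first.
  by move=> h; rewrite /= scaler0 add0r.
have dl : is_derive ((x, 0) : VR) (@sdir R _) (fun z => ln (den z)) (x 0 xJ).
  have [du eu] := is_derive_den x.
  have dln : is_derive (den (x, 0)) 1 (@ln R) (den (x, 0))^-1.
    by apply: is_derive1_ln; rewrite d1.
  have [dl el] := dln.
  by have := is_derive_comp1 du dl; rewrite eu el d1 invr1 mul1r.
rewrite (iterDC1_cexp _ dl) d1 ln1 mulr0 cexp0 mulr1.
by rewrite /ev mevalZ mevalM mevalXU /= mulrA.
Qed.

(* T is constant along the N'_+-orbit [t |-> pulled (., t)], whose derivative at
   t = 0 is [-(lambda + d) x_j q]; the derivative in t commutes with the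
   derivatives in x that make up T. *)
Lemma tpoly_nplus : (lambda + d%:R) *: tpoly (mpolyX R[i] (mnm1 xJ) * q) = 0.
Proof.
apply: form_separates => phi.
(* T is a finite combination of derivatives at 0, so a derivative in t can be applied to it term by
   term. *)
have [N /(_ N (leqnn _)) HN] := lift_at1_jet p_gt0 varpi_rep DD.
have oB := open_dom.
have If : I (bsec (ev q)) by apply: bsec_I => //; exact: csmooth_ev.
pose c (m' : bmultinom p.+1 N) := phi (tpoly (mpolyX R[i] m')) / mfact R m'.
have phiT H : csmooth setT H ->
    phi (lift_at1 H) = \sum_(m' : bmultinom p.+1 N) c m' * iterDC (mdirs R m') H 0.
  move=> sH; rewrite (HN H sH) /jet (tpoly_sum DD) linear_sum; apply: eq_bigr => m' _.
  by rewrite (tpolyZ DD) /= linear_formZ /c; ring.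
pose FF z := \sum_(m' : bmultinom p.+1 N)
  c m' * iterDC (map (@ydir R _) (mdirs R m')) model z.
have cA (t : R) : continuous (fun x : 'rV[R]_p.+1 => (x, t)).
  move=> z; exact: (@cvg_pair _ _ _ (nbhs z) (nbhs z) (nbhs t) _ _ _ (fun y => y)
        (fun=> t) cvg_id (cvg_cst t)).
have AL (t : R) (b : R) (v u : 'rV[R]_p.+1) : (b *: v + u, t) = b *: @ydir R _ v + (u, t).
  by rewrite /ydir; congr (_, _); rewrite /= scaler0 add0r.
(* N'_+ acts trivially in the inducing representation, so T of the translated section does not
   depend on t. *)
have FFc (t : R) : FF (0, t) = phi (at1 (bsec (ev q))).
  have pS : SL p.+1 (p_elt 1%:M 0 (t *: delta_mx 0 j : 'rV[R]_p)).
    by apply: det_p_elt => //; exact: SL_SLpm (SL1 R p).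
  pose ft g := bsec (ev q) (diag_last1 (p_elt 1%:M 0 (t *: delta_mx 0 j)) *m g).
  have Ift : I ft by exact: (ltrans_Ind (SL_diag_last1 pS) If).
  have -> : at1 (bsec (ev q)) = at1 ft.
    rewrite /ft (at1_p_elt p_gt0 DD 0 (t *: delta_mx 0 j) If (SL_SLpm (SL1 R p))).
    rewrite mulr0 oppr0 cexp0 scale1r det1 sgr1 rmorph1 expr1n scale1r invmx1.
    by have [_ -> _ _] := varpi_rep.
  rewrite (at1_chart DD Ift) phiT; last exact: csmooth_section1 Ift.
  apply: eq_bigr => m' _; congr (_ * _).
  rewrite -(iterDC_ext _ oB pulled_model (dom0 t)).
  by rewrite -(iterDC_affine _ _ _ (AL t)).
have F0 : iterDC [:: @sdir R _] FF (0, 0) = 0.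
  apply: iterDC_line_const => h.
  have -> : h *: @sdir R _ + (0, 0) = (0, h) :> VR.
    by rewrite /sdir; congr (_, _); rewrite /= ?scaler0 ?addr0// [_ *: 1]mulr1.
  by rewrite !FFc.
have sM := csmooth_model.
rewrite /FF (iterDC_sum _ _ oB (dom0 0)) in F0; last first.
  by move=> m'; apply: (csmoothZ _ oB); exact: csmooth_iterDC.
have key (m' : bmultinom p.+1 N) :
    iterDC [:: @sdir R _] (fun z => c m' * iterDC (map (@ydir R _) (mdirs R m')) model z) (0, 0) =
    c m' * iterDC (mdirs R m') (ev (- (lambda + d%:R) *: (mpolyX R[i] (mnm1 xJ) * q))) 0.
  rewrite (iterDC_Z _ _ oB (dom0 0) (csmooth_iterDC _ sM)); congr (_ * _).
  rewrite -iterDC_cat (iterDC_perm oB (dom0 0) sM (_ : perm_eq _ (map (@ydir R _) (mdirs R m') ++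
    [:: @sdir R _]))); last by rewrite perm_catC.
  rewrite iterDC_cat -(iterDC_affine (iterDC [:: @sdir R _] model) (mdirs R m') 0 (AL 0)).
  have oB0 : open [set x : 'rV[R]_p.+1 | dom (x, 0)].
    by apply: (@open_comp _ _ (fun x : 'rV[R]_p.+1 => (x, 0 : R)) dom) => // x _; exact: cA.
  by apply: (iterDC_ext _ oB0); [exact: model_derive|exact: dom0].
rewrite (eq_bigr _ (fun m' _ => key m')) -(phiT _ (csmooth_ev _)) -/(tpoly _) in F0.
rewrite (tpolyZ DD) scaleNr linearN in F0.
by apply/eqP; rewrite -oppr_eq0; apply/eqP.
Qed.

End Nilpotent.

(** * The representations poly^l *)

Section Substitution.
Variables (R : realType) (p : nat).
Implicit Types (g : 'M[R]_p) (q : mpoly p R[i]) (m : multinom p).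

Definition linsub g q : mpoly p R[i] :=
  comp_mpoly [tuple \sum_j (g i j)%:C *: mpolyX R[i] (mnm1 j) | i < p] q.

Lemma poly_act_linsub g q : poly_act g q = linsub (invmx g) q.
Proof. by []. Qed.

Lemma meval_linsub g q (v : 'I_p -> R[i]) :
  meval v (linsub g q) = meval (fun i => \sum_j (g i j)%:C * v j) q.
Proof.
rewrite /linsub comp_mpoly_meval; apply: meval_eq => i.
rewrite tnth_mktuple raddf_sum; apply: eq_bigr => j _.
by rewrite /= mevalZ mevalXU.
Qed.

Lemma linsub_dhomog l g q : q \is ishomog1 l mdeg -> linsub g q \is ishomog1 l mdeg.
Proof.
move=> /dhomogP qH.
have dX i : tnth [tuple \sum_j (g i j)%:C *: mpolyX R[i] (mnm1 j) | i < p] i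
    \is ishomog1 1 mdeg.
  rewrite tnth_mktuple; apply: rpred_sum => j _; apply: rpredZ.
  by rewrite dhomogX; apply/eqP; exact: mdeg1.
rewrite /linsub comp_mpolyE big_seq; apply: rpred_sum => m mp; apply: rpredZ.
have -> : l = (\sum_(i < p) 1 * m i)%N.
  by have /= <- := qH m mp; rewrite mdegE; apply: eq_bigr => i _; rewrite mul1n.
elim/big_rec2: _ => [|i d r _ dr]; first exact: dhomog1.
by apply: dhomogM => //; apply: dhomogMn.
Qed.

Lemma linsub_diag (d : 'rV[R]_p) q m :
  mcoeff m (linsub (diag_mx d) q) = (\prod_i (d 0 i)%:C ^+ m i) * mcoeff m q.
Proof.
rewrite /linsub comp_mpolyEX raddf_sum /=.
have E m' : comp_mpoly [tuple \sum_j (diag_mx d i j)%:C *: mpolyX R[i] (mnm1 j) | i < p]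
    (mpolyX R[i] m') = (\prod_i (d 0 i)%:C ^+ m' i) *: mpolyX R[i] m'.
  rewrite comp_mpolyX [in RHS]mpolyXE_id -scaler_prod; apply: eq_bigr => i _.
  rewrite tnth_mktuple (bigD1 i)//= big1 ?addr0 => [|j ji]; last first.
    by rewrite mxE eq_sym (negbTE ji) scale0r.
  by rewrite mxE eqxx exprZn.
under eq_bigr => m' _ do rewrite E !mcoeffZ mcoeffX.
rewrite [q in RHS]mpolyE raddf_sum mulr_sumr /=; apply: eq_bigr => m' _.
rewrite mcoeffZ mcoeffX; case: eqP => [->|_]; last by rewrite !mulr0.
by ring.
Qed.

(** Evaluation at the j-th basis vector kills every other monomial of degree l. *)
Lemma mcoeff_powU l q (j : 'I_p) : q \is ishomog1 l mdeg ->
  mcoeff (mnm_muln (mnm1 j) l) q = meval (fun i => (i == j)%:R) q.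
Proof.
move=> /dhomogP qH; rewrite mevalE [q in LHS]mpolyE raddf_sum /= big_seq [RHS]big_seq.
apply: eq_bigr => m /qH /= ml.
rewrite mcoeffZ mcoeffX; congr (_ * _).
case: eqP => [->|mj].
  rewrite big1// => i _; rewrite mulmnE mnm1E eq_sym.
  by case: (eqVneq i j) => [|ij]; rewrite ?expr1n// mul0n.
have [i ij mi] : exists2 i, i != j & m i != 0%N.
  apply/exists_inP; apply/contra_notT: mj; rewrite negb_exists => /forallP H.
  have {}H i : i != j -> m i = 0%N.
    by move=> ij; have := H i; rewrite ij negbK => /eqP.
  apply/mnmP => i; rewrite mulmnE mnm1E eq_sym; case: (eqVneq i j) => [->|ij].
    by rewrite mul1n -ml mdegE (bigD1 j)//= big1 ?addn0.
  by rewrite mul0n H.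
by rewrite (bigD1 i)//= (negbTE ij) expr0n (negbTE mi) mul0r.
Qed.

(** Each partial derivative of S^k is k S^(k-1), so the coefficient of m is a non-zero multiple of
    that of m divided by one of its variables. *)
Lemma mcoeff_sum_pow m : mcoeff m ((\sum_(i < p) mpolyX R[i] (mnm1 i)) ^+ mdeg m) != 0.
Proof.
elim: {m}_.+1 {-2}m (ltnSn (mdeg m)) => // n IH m mn.
case: (posnP (mdeg m)) => [m0|m_gt0].
  by have /eqP := m0; rewrite mdeg_eq0 => /eqP mz; rewrite m0 mz expr0 mcoeff1 eqxx oner_eq0.
set S := \sum_i _.
have dS i : mderiv i S = 1.
  rewrite /S raddf_sum (bigD1 i)//= big1 ?addr0 => [|j ji].
    rewrite mderivX mnm1E eqxx scale1r (_ : mnm_sub _ _ = @mnm0 p) ?mpolyX0//.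
    by apply/mnmP => k; rewrite mnmBE subnn mnm0E.
  by rewrite mderivX mnm1E (negbTE ji) scale0r.
have [i mi] : exists i, m i != 0%N.
  apply/existsP; apply: contraTT m_gt0; rewrite negb_exists => /forallP H.
  by rewrite lt0n negbK mdegE big1// => i _; apply/eqP; have := H i; rewrite negbK.
have leU : lem (mnm1 i) m.
  by apply/mnm_lepP => j; rewrite mnm1E; case: eqP => // <-; rewrite lt0n.
have mE := submK leU.
set m' := mnm_sub m (mnm1 i) in mE.
have dm : mdeg m = (mdeg m').+1 by rewrite -mE mdegD mdeg1 addn1.
have m'n : (mdeg m' < n)%N by rewrite -ltnS -dm.
have dX k : mderiv i (S ^+ k) = S ^+ k.-1 *+ k.
  elim: k => [|k IHk]; first by rewrite expr0 mulr0n -mpolyC1 mderivC.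
  rewrite exprS mderivM IHk dS mul1r mulrnAr -exprS mulrS.
  by case: k {IHk} => [|k]; rewrite ?mulr0n.
have := IH _ m'n; apply: contraNN => /eqP c0.
have := mcoeff_mderiv i (S ^+ mdeg m) m'; rewrite mE c0 mul0rn dX dm mcoeffMn => /eqP.
by rewrite mulrn_eq0 /= => /eqP ->.
Qed.
End Substitution.

(** * Irreducibility of poly^l *)

Section PolyIrreducible.
Variables (R : realType) (p l : nat).
Hypothesis p_gt1 : (1 < p)%N.
Implicit Types (g : 'M[R]_p) (q : mpoly p R[i]) (m : multinom p).
Variable K : mpoly p R[i] -> Prop.
Hypothesis KL : forall c a b, K a -> K b -> K (c *: a + b).
Hypothesis KS : forall g q, SL p g -> q \is ishomog1 l mdeg -> K q -> K (linsub g q).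

(** With the entries 2 and 1/2 the eigenvalues on monomials are powers of 2, so comparing them is
    comparing exponents. *)
Definition torus2 (i j : 'I_p) : 'rV[R]_p :=
  \row_k (if k == i then 2 else if k == j then 2^-1 else 1).

Lemma SL_torus2 i j : i != j -> SL p (diag_mx (torus2 i j)).
Proof.
move=> ij; rewrite /SL /= det_diag (bigD1 i)//= (bigD1 j) 1?eq_sym//= big1 => [|k /andP[ki kj]].
  by rewrite !mxE eqxx eq_sym (negbTE ij) eqxx mulr1 divff.
by rewrite mxE (negbTE ki) (negbTE kj).
Qed.

Lemma torus2_monomial i j m : i != j ->
  \prod_k (torus2 i j 0 k)%:C ^+ m k = 2 ^+ m i / 2 ^+ m j :> R[i].
Proof.
move=> ij; rewrite (bigD1 i)//= (bigD1 j) 1?eq_sym//= big1 => [|k /andP[ki kj]].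
  rewrite !mxE eqxx eq_sym (negbTE ij) eqxx mulr1; congr (_ * _).
    by rewrite rmorph_nat.
  by rewrite fmorphV rmorph_nat exprVn.
by rewrite mxE (negbTE ki) (negbTE kj) expr1n.
Qed.

Lemma two_pow_inj (a b c d : nat) : 2 ^+ a / 2 ^+ b = 2 ^+ c / 2 ^+ d :> R[i] -> (a + d = c + b)%N.
Proof.
move=> E; have n0 k : 2 ^+ k != 0 :> R[i] by rewrite expf_eq0 pnatr_eq0 andbF.
have : 2 ^+ (a + d) = 2 ^+ (c + b) :> R[i].
  by rewrite !exprD -[2 ^+ a](divfK (n0 b)) E mulrAC divfK.
rewrite -!natrX => /eqP; rewrite eqr_nat => /eqP; exact: expnI.
Qed.

(** If all differences m i - m j agreed with those of m', summing over j with equal degrees would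
    give m = m'. *)
Lemma torus_separates m m' : mdeg m = mdeg m' -> m <> m' ->
  exists i j : 'I_p, i != j /\ (m i + m' j != m' i + m j)%N.
Proof.
move=> dm mm'; apply: contrapT => H.
have {}H (i j : 'I_p) : (m i + m' j = m' i + m j)%N.
  case: (eqVneq i j) => [->|ij]; first by rewrite addnC.
  by apply: contrapT => /eqP h; apply: H; exists i, j.
apply: mm'; apply/mnmP => i.
have : (\sum_j (m i + m' j) = \sum_j (m' i + m j))%N by apply: eq_bigr => j _; rewrite H.
rewrite !big_split /= -!mdegE dm => /addIn; rewrite !sum_nat_const card_ord.
by move=> /eqP; rewrite eqn_mul2l gtn_eqF ?(ltnW p_gt1)//= => /eqP.
Qed.

(* The torus elements [torus2 i j] separate two given monomials, so that one can
   be eliminated from q. *)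
Lemma invariant_monomial q m : q \is ishomog1 l mdeg -> K q -> mcoeff m q != 0 ->
  K (mpolyX R[i] m).
Proof.
elim: {q}_.+1 {-2}q (ltnSn (size (msupp q))) => // n IH q qn qH Kq qm.
have mS : m \in msupp q by rewrite mcoeff_msupp.
case: (pselect (exists2 m', m' \in msupp q & m' <> m)) => [[m' m'S m'm]|H]; last first.
  have K0 : K 0 by have := KL (-1) Kq Kq; rewrite scaleN1r addNr.
  suff -> : mpolyX R[i] m = (mcoeff m q)^-1 *: q + 0 by exact: KL.
  apply/mpolyP => m'; rewrite addr0 mcoeffZ mcoeffX.
  case: (eqVneq m m') => [<-|mm']; first by rewrite mulVf.
  rewrite (_ : mcoeff m' q = 0) ?mulr0//; apply/eqP; rewrite -[_ == 0]negbK -mcoeff_msupp.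
  by apply/negP => m'S; apply: H; exists m' => //; apply/eqP; rewrite eq_sym.
have /dhomogP qHP := qH.
have dmm' : mdeg m = mdeg m' by rewrite [LHS](qHP _ mS) [RHS](qHP _ m'S).
have [i [j [ij sep]]] := torus_separates dmm' (fun e => m'm (esym e)).
set T := linsub (diag_mx (torus2 i j)) q.
(* The eigenvalue on m': the combination T - c q loses that monomial and keeps m. *)
set c := 2 ^+ m' i / 2 ^+ m' j : R[i].
pose q' := (- c) *: q + T.
have cq' m'' : mcoeff m'' q' = (2 ^+ m'' i / 2 ^+ m'' j - c) * mcoeff m'' q.
  by rewrite mcoeffD mcoeffZ /T linsub_diag torus2_monomial// mulrBl mulNr addrC.
have sub : {subset msupp q' <= rem m' (msupp q)}.
  move=> m''; rewrite (rem_filter _ (msupp_uniq _)) mem_filter /= !mcoeff_msupp cq'.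
  rewrite mulf_eq0 negb_or => /andP[h ->]; rewrite andbT.
  by apply: contraNneq h => ->; rewrite subrr.
apply: (IH q').
- rewrite -ltnS; apply: leq_trans qn; rewrite ltnS.
  have := uniq_leq_size (msupp_uniq _) sub; rewrite size_rem// => le.
  have S0 : (0 < size (msupp q))%N by case: (msupp q) mS.
  by rewrite -(prednK S0) ltnS.
- by rewrite rpredD// ?rpredZ//; exact: linsub_dhomog.
- by apply: KL => //; apply: KS => //; exact: SL_torus2.
- rewrite cq' mulf_neq0// subr_eq0; apply: contraNneq sep => /two_pow_inj ->.
  by [].
Qed.

Let j0 : 'I_p := Ordinal (ltnW p_gt1).

(** Substitution sends y_i to y_i + y_j0 for i other than j0, and the transpose sends y_j0 to the
    sum of all variables. As j0 is the first index, the matrix is lower unitriangular. *)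
Definition shear : 'M[R]_p := \matrix_(i, k) ((i == k) || (k == j0))%:R.

Lemma SL_shear : SL p shear.
Proof.
rewrite /SL /= det_trig; last first.
  apply/is_trig_mxP => i k ik; rewrite mxE (_ : _ || _ = false)//.
  by apply/negbTE; rewrite negb_or -!val_eqE/= (ltn_eqF ik) -lt0n (leq_ltn_trans _ ik).
by rewrite big1// => i _; rewrite mxE eqxx.
Qed.

(* A shear turns a monomial into a polynomial containing y_j ^ l, and another
   one turns y_j ^ l into (y_1 + .. + y_p) ^ l, which contains every monomial. *)
Lemma invariant_full q r : q \is ishomog1 l mdeg -> K q -> q <> 0 ->
  r \is ishomog1 l mdeg -> K r.
Proof.
move=> qH Kq q0 /dhomogP rH.
have K0 : K 0 by have := KL (-1) Kq Kq; rewrite scaleN1r addNr.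
have [m mS] : exists m, m \in msupp q.
  case E : (msupp q) => [|m s]; last by exists m; rewrite inE eqxx.
  by case: q0; apply/eqP; rewrite -msupp_eq0 E.
have Km : K (mpolyX R[i] m) by apply: (invariant_monomial qH) => //; rewrite -mcoeff_msupp.
have ml : mdeg m = l by move/dhomogP: qH => /(_ m mS).
have mH : mpolyX R[i] m \is ishomog1 l mdeg by rewrite dhomogX; apply/eqP.
have s1H := linsub_dhomog shear mH.
have Ks1 : K (linsub shear (mpolyX R[i] m)) by apply: KS => //; exact: SL_shear.
have Kj : K (mpolyX R[i] (mnm_muln (mnm1 j0) l)).
  apply: (invariant_monomial s1H Ks1); rewrite mcoeff_powU// meval_linsub mevalX big1 ?oner_neq0//.
  move=> i _; rewrite (bigD1 j0)//= big1 => [|k kj]; last by rewrite (negbTE kj) mulr0.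
  by rewrite mxE eqxx orbT addr0 mulr1 expr1n.
have jH : mpolyX R[i] (mnm_muln (mnm1 j0) l) \is ishomog1 l mdeg.
  by rewrite dhomogX; apply/eqP; rewrite /= mdegMn mdeg1 mul1n.
have tS : SL p shear^T by rewrite /SL /= det_tr; exact: SL_shear.
have sE : linsub shear^T (mpolyX R[i] (mnm_muln (mnm1 j0) l)) =
    (\sum_(i < p) mpolyX R[i] (mnm1 i)) ^+ l.
  rewrite /linsub comp_mpolyX (bigD1 j0)//= big1 => [|i ij]; last first.
    by rewrite mulmnE mnm1E eq_sym (negbTE ij) mul0n expr0.
  rewrite mulr1 mulmnE mnm1E eqxx mul1n tnth_mktuple; congr (_ ^+ _).
  by apply: eq_bigr => i _; rewrite !mxE eqxx orbT scale1r.
have Ks : K ((\sum_(i < p) mpolyX R[i] (mnm1 i)) ^+ l) by rewrite -sE; apply: KS.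
have sH := linsub_dhomog shear^T jH; rewrite sE in sH.
rewrite (mpolyE r) big_seq; apply: big_ind => // [a b Ka Kb|m' /rH /= m'l].
  by rewrite -[a]scale1r; exact: KL.
rewrite -[_ *: _]addr0; apply: KL => //; apply: (invariant_monomial sH Ks).
by rewrite -m'l; exact: mcoeff_sum_pow.
Qed.

End PolyIrreducible.

(** * Schur's lemma and intertwiners from poly^l *)

Section Irreducible.
Variables (R : realType) (p' : nat) (W : vectType R[i]).
Local Notation p := p'.+1.
Variable varpi : 'M[R]_p -> W -> W.
Hypothesis varpi_rep : is_rep varpi.
Hypothesis varpi_irr : irreducible_on (SL p) varpi.
Hypothesis p_gt1 : (1 < p)%N.
Implicit Types (g : 'M[R]_p).

Lemma irreducible_vspace (U : {vspace W}) w : w \in U -> w != 0 ->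
  (forall g, SL p g -> forall w, w \in U -> varpi g w \in U) -> forall w, w \in U.
Proof.
move=> wU w0 /(varpi_irr.2 U)[U0|->]; last by move=> v; exact: memvf.
by move: wU; rewrite U0 memv0 (negbTE w0).
Qed.

(** Schur's lemma: over the algebraically closed field R[i] the map T has an eigenspace, which is
    invariant and non-zero. *)
Lemma irreducible_scalar (T : 'End(W)) :
  (forall g, SL p g -> forall w, T (varpi g w) = varpi g (T w)) ->
  exists c, forall w, T w = c *: w.
Proof.
move=> TE; have [W0 _] := varpi_irr.
have d0 : (0 < \dim {:W})%N by rewrite lt0n dimv_eq0; exact/eqP.
have [c ev] := eigenvalue_closed (passmx.mxof (vbasis {:W}) (vbasis {:W}) T) d0.
exists c => w.
have : passmx.leigenspace T c != 0%VS.
  by rewrite (passmx.leigenspaceE (vbasisP {:W})) passmx.vsof_eq0 ?vbasisP.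
rewrite -vpick0 => v0.
have mE u : (u \in passmx.leigenspace T c) = (T u == c *: u).
  by rewrite memv_ker add_lfunE opp_lfunE scale_lfunE id_lfunE subr_eq0.
apply/eqP; rewrite -mE; apply: (irreducible_vspace (memv_pick _) v0) => g gS u.
have [L _ _ _] := varpi_rep.
have gL : varpi g (c *: u) = c *: varpi g u.
  have lin := L g (SL_SLpm gS).
  have := lin c u 0; rewrite addr0 => ->; have := lin (-1) 0 0.
  by rewrite scaler0 addr0 scaleN1r addNr => ->; rewrite addr0.
by rewrite !mE (TE _ gS) => /eqP ->; rewrite gL.
Qed.

(** The image is an invariant subspace of W and the kernel one of poly^l; both spaces are
    irreducible and the map is non-zero. *)
Lemma rep_equiv_of_intertwiner l (Psi : {linear dhomog p R[i] l -> W}) :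
  (forall g, SL p g -> forall q, Psi (poly_rep g q) = varpi g (Psi q)) ->
  (exists q, Psi q != 0) -> rep_equiv (SL p) (@poly_rep R p l) varpi Psi.
Proof.
move=> PsiE [q0 Pq0]; split=> //.
pose f := linfun Psi; have fE q : f q = Psi q by rewrite lfunE.
have full w : w \in limg f.
  apply: (@irreducible_vspace _ (Psi q0)) => //; first by rewrite -fE memv_img ?memvf.
  by move=> g gS _ /memv_imgP[q _ ->]; rewrite fE -PsiE// -fE memv_img ?memvf.
have ker0 : lker f == 0%VS.
  rewrite -subv0; apply/subvP => q; rewrite memv_ker fE memv0 => /eqP Pq.
  apply/eqP/val_inj => /=; apply: contrapT => q_neq0.
  (* The kernel, as a predicate on polynomials to which [invariant_full] applies. *)
  pose K (r : mpoly p R[i]) := exists s : dhomog p R[i] l, val s = r /\ Psi s = 0.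
  have KL c a b : K a -> K b -> K (c *: a + b).
    by move=> [s [<- s0]] [s' [<- s'0]]; exists (c *: s + s'); split; rewrite ?linearD ?linearZ /= ?s0 ?s'0 ?scaler0 ?addr0.
  have KS g r : SL p g -> r \is ishomog1 l mdeg -> K r -> K (linsub g r).
    move=> gS _ [s [<- s0]]; exists (poly_rep (invmx g) s); split.
      by rewrite /= poly_act_linsub invmxK.
    rewrite PsiE ?s0; last exact: SLV.
    have [L _ _ _] := varpi_rep; have := L _ (SL_SLpm (SLV gS)) (-1) 0 0.
    by rewrite scaler0 addr0 scaleN1r addNr.
  have Kq : K (val q) by exists q.
  have [s [sq0 s0]] := invariant_full p_gt1 KL KS (dhomog_is_dhomog q) Kq q_neq0 (dhomog_is_dhomog q0).
  by move: Pq0; rewrite -(val_inj sq0) s0 eqxx.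
exists (fun w => (f^-1)%VF w) => [q|w]; first by rewrite -fE lker0_lfunK.
by rewrite -fE limg_lfunVK.
Qed.

(** Schur's lemma for [Psi] composed with the inverse of [Phi]. *)
Lemma rep_equiv_scalar l (Psi Phi : {linear dhomog p R[i] l -> W}) :
  rep_equiv (SL p) (@poly_rep R p l) varpi Psi ->
  rep_equiv (SL p) (@poly_rep R p l) varpi Phi -> exists c, forall q, Psi q = c *: Phi q.
Proof.
move=> [_ PsiE] [bP PhiE]; have [g gK Kg] := bP.
pose f := linfun Phi; have fE q : f q = Phi q by rewrite lfunE.
have ker0 : lker f == 0%VS by apply/lker0P => q q'; rewrite !fE; exact: (bij_inj bP).
pose T : 'End(W) := (linfun Psi \o f^-1)%VF.
have TE q : T (Phi q) = Psi q by rewrite comp_lfunE -fE lker0_lfunK// lfunE.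
have [c Tc] : exists c, forall w, T w = c *: w.
  apply: irreducible_scalar => h hS w; rewrite -(Kg w) -PhiE// !TE.
  exact: PsiE.
by exists c => q; rewrite -TE Tc.
Qed.

(** A torus element has the eigenvalue 2^l on the l-th power of the first variable, whereas its
    eigenvalues on poly^l2 are 2^(m_0 - m_1) with m_0 <= l2. *)
Lemma poly_rep_degree_le l l2 (Psi : {linear dhomog p R[i] l -> W})
    (Phi : {linear dhomog p R[i] l2 -> W}) :
  rep_equiv (SL p) (@poly_rep R p l) varpi Psi ->
  rep_equiv (SL p) (@poly_rep R p l2) varpi Phi -> (l <= l2)%N.
Proof.
move=> [bP PsiE] [[g gK Kg] PhiE].
pose i0 : 'I_p := ord0; pose i1 : 'I_p := Ordinal p_gt1.
have i01 : i1 != i0 by [].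
pose t := diag_mx (torus2 R i0 i1).
have tS : SL p t by apply: SL_torus2; rewrite eq_sym.
have tuS := SL_unit tS.
have XH : mpolyX R[i] (mnm_muln (mnm1 i0) l) \is ishomog1 l mdeg.
  by rewrite dhomogX; apply/eqP; rewrite /= mdegMn mdeg1 mul1n.
pose x : dhomog p R[i] l := DHomog XH.
have x0 : x != 0.
  by apply/eqP => /(congr1 val)/= /eqP; rewrite -msupp_eq0 msuppX.
have eX : poly_rep (invmx t) x = 2 ^+ l *: x.
  apply/val_inj/mpolyP => m /=; rewrite poly_act_linsub invmxK linsub_diag.
  rewrite torus2_monomial 1?eq_sym// mcoeffZ mcoeffX; case: eqP => [<-|_]; last by rewrite !mulr0.
  by rewrite !mulmnE !mnm1E eqxx mul1n eq_sym (negbTE i01) mul0n expr0 divr1.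
pose y := g (Psi x).
have y0 : y != 0.
  apply/eqP => /(congr1 Phi); rewrite Kg linear0 => /eqP; rewrite -(linear0 Psi).
  by rewrite (inj_eq (bij_inj bP)) (negbTE x0).
have eY : poly_rep (invmx t) y = 2 ^+ l *: y.
  apply: (can_inj gK); rewrite PhiE; last exact: SLV.
  by rewrite linearZ /= /y Kg -PsiE ?eX ?linearZ//; exact: SLV.
have [m mS] : exists m, m \in msupp (val y).
  case E : (msupp (val y)) => [|m s]; last by exists m; rewrite inE eqxx.
  by case/eqP: y0; apply/val_inj/eqP; rewrite -msupp_eq0 E.
have ml : mdeg m = l2 by have /dhomogP/(_ m mS) := dhomog_is_dhomog y.
have := congr1 (fun q => mcoeff m (val q)) eY.
rewrite /= poly_act_linsub invmxK linsub_diag torus2_monomial 1?eq_sym// mcoeffZ.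
move/mulIf; rewrite -mcoeff_msupp => /(_ mS).
rewrite -[2 ^+ l]divr1 -(expr0 2) => /two_pow_inj; rewrite addn0 => E.
by rewrite -ml mdegE (bigD1 i0)//= E -addnA leq_addr.
Qed.

Lemma poly_rep_degree l l2 (Psi : {linear dhomog p R[i] l -> W})
    (Phi : {linear dhomog p R[i] l2 -> W}) :
  rep_equiv (SL p) (@poly_rep R p l) varpi Psi ->
  rep_equiv (SL p) (@poly_rep R p l2) varpi Phi -> l = l2.
Proof.
by move=> P1 P2; apply/eqP; rewrite eqn_leq (poly_rep_degree_le P1 P2) (poly_rep_degree_le P2 P1).
Qed.

End Irreducible.

Lemma linear_packed (F : pzRingType) (V W : lmodType F) (f : V -> W) : linear f ->
  exists g : {linear V -> W}, g =1 f.
Proof.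
move=> lf; pose g : {linear V -> W} := HB.pack f (GRing.isLinear.Build F V W *:%R f lf).
by exists g.
Qed.

(** * Classification *)

Section Mixed.
Variables (R : realType) (p : nat).
Implicit Types (q : mpoly p R[i]) (m : multinom p.+1) (a l : nat).

Definition mjoin (m : 'I_p -> nat) a : multinom p.+1 :=
  Multinom [tuple (if unlift ord_max i is Some j then m j else a) | i < p.+1].
Definition mhead m : multinom p := Multinom [tuple m (lift ord_max j) | j < p].

Lemma mjoin_max (m : 'I_p -> nat) a : mjoin m a ord_max = a.
Proof. by rewrite multinomE tnth_mktuple unlift_none. Qed.

Lemma mjoin_lift (m : 'I_p -> nat) a j : mjoin m a (lift ord_max j) = m j.
Proof. by rewrite multinomE tnth_mktuple liftK. Qed.

Lemma mheadE m j : mhead m j = m (lift ord_max j).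
Proof. by rewrite multinomE tnth_mktuple. Qed.

Lemma mjoin_head m : mjoin (mhead m) (m ord_max) = m.
Proof.
apply/mnmP; apply: ord_max_ind => [|j]; first by rewrite mjoin_max.
by rewrite mjoin_lift mheadE.
Qed.

Definition mixed q a : mpoly p.+1 R[i] :=
  comp_mpoly [tuple mpolyX R[i] (mnm1 (lift ord_max j)) | j < p] q * mpolyX R[i] (mnm1 ord_max) ^+ a.

Lemma mixed_is_linear a : linear (fun q => mixed q a).
Proof. by move=> c q r; rewrite /mixed linearD linearZ /= mulrDl scalerAl. Qed.

Lemma ev_mixed q a x :
  ev (mixed q a) x = meval (fun j => (x 0 (lift ord_max j))%:C) q * (x 0 ord_max)%:C ^+ a.
Proof.
rewrite /ev /mixed mevalM comp_mpoly_meval rmorphXn /= mevalXU; congr (_ * _).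
by apply: meval_eq => j; rewrite tnth_mktuple mevalXU.
Qed.

Lemma mixedX (m : multinom p) a : mixed (mpolyX R[i] m) a = mpolyX R[i] (mjoin m a).
Proof.
rewrite /mixed comp_mpolyX [RHS]mpolyXE_id big_ord_recr /= mjoin_max; congr (_ * _).
by apply: eq_bigr => j _; rewrite tnth_mktuple -lift_max_widen mjoin_lift.
Qed.

Lemma mevalZ_hom l q (c : R[i]) (x : 'I_p -> R[i]) : q \is ishomog1 l mdeg ->
  meval (fun i => c * x i) q = c ^+ l * meval x q.
Proof.
move=> /dhomogP qH; rewrite (mpolyE q) !raddf_sum /= mulr_sumr big_seq [RHS]big_seq.
apply: eq_bigr => m /qH /= <-; rewrite [in LHS]mevalZ [in RHS]mevalZ mevalZ_mon.
by rewrite mulrCA.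
Qed.

Lemma mixed_mact (g : 'M[R]_p) (u v : R) l q a x : q \is ishomog1 l mdeg ->
  ev (mixed q a) (mact g u v x) = u%:C ^+ l * v%:C ^+ a * ev (mixed (linsub g q) a) x.
Proof.
move=> qH.
rewrite [LHS]ev_mixed.
rewrite (ev_mixed (linsub g q) a x).
rewrite (meval_linsub g q).
rewrite (mact_max g u v x).
have -> : meval (fun j => (mact g u v x 0 (lift ord_max j))%:C) q =
    u%:C ^+ l * meval (fun j => \sum_k (g j k)%:C * (x 0 (lift ord_max k))%:C) q.
  rewrite -(mevalZ_hom _ _ qH); apply: meval_eq => j.
  rewrite mact_lift rmorphM rmorph_sum /=; congr (_ * _).
  by apply: eq_bigr => k _; rewrite rmorphM.
have -> : (v * x 0 ord_max)%:C = v%:C * (x 0 ord_max)%:C by rewrite rmorphM.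
rewrite exprMn; set w := meval _ _; clearbody w.
by rewrite mulrACA.
Qed.

Definition ytuple l (lf : {ffun 'I_p -> 'I_l.+1}) : multinom p := Multinom [tuple (lf j : nat) | j < p].

Lemma ytupleE l (lf : {ffun 'I_p -> 'I_l.+1}) j : ytuple lf j = lf j.
Proof. by rewrite multinomE tnth_mktuple. Qed.

Lemma val_indhomog l q : q \is ishomog1 l mdeg -> val (indhomog l q) = q.
Proof. by move=> qH; rewrite /indhomog insubdK. Qed.

Lemma append0_0 : append0 (0 : 'rV[R]_p) = 0.
Proof. by rewrite /append0 row_mx0 castmx_const. Qed.

(** A derivative at 0 is the matching Taylor coefficient times the factorials of the exponents;
    those of x' cancel against [ytilde], and a! remains. *)
Lemma D_ml_jet a l N (H : 'rV[R]_p.+1 -> R[i]) : csmooth setT H -> (a + l < N)%N ->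
  D_ml a l H 0 = \sum_(lf : {ffun 'I_p -> 'I_l.+1} | (\sum_j lf j)%N == l)
    (mcoeff (mjoin (ytuple lf) a) (jet N H) * (a`!)%:R) *: indhomog l (mpolyX R[i] (ytuple lf)).
Proof.
move=> sH aN; apply: eq_bigr => lf /eqP lfl; rewrite append0_0.
set w := nseq a ord_max ++ flatten [seq nseq (lf j) (lift ord_max j) | j <- enum 'I_p].
have -> : @dirs_xn R p a ++ @dirs_x' R p (fun j => lf j) = map (@evec R p.+1) w.
  rewrite map_cat map_nseq; congr (_ ++ _).
  rewrite /dirs_x' map_flatten -map_comp; congr flatten.
  by apply: eq_map => j; rewrite /= map_nseq.
have wE : mcount w = mjoin (ytuple lf) a.
  apply/mnmP => i; rewrite multinomE tnth_mktuple count_cat count_nseq count_flatten.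
  rewrite -map_comp sumnE big_map big_enum /=; elim/ord_max_ind: i => [|i].
    rewrite mjoin_max eqxx mul1n big1 ?addn0// => j _.
    by rewrite count_nseq /= eq_sym (negbTE (neq_lift _ _)).
  rewrite mjoin_lift ytupleE (negbTE (neq_lift _ _)) mul0n add0n.
  rewrite (bigD1 i)//= count_nseq /= eqxx mul1n big1 ?addn0// => j ji.
  by rewrite count_nseq /= (inj_eq lift_inj) (negbTE ji).
have mfE : mfact R (mjoin (ytuple lf) a) = (\prod_j (lf j)`!)%:R * (a`!)%:R.
  rewrite /mfact big_ord_recr /= mjoin_max natrM; congr ((_ %:R) * _).
  by apply: eq_bigr => j _; rewrite -lift_max_widen mjoin_lift ytupleE.
have dw : (mdeg (mcount w) < N)%N.
  rewrite wE mdegE big_ord_recr /= mjoin_max; apply: leq_ltn_trans aN.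
  by rewrite addnC leq_add2l -{2}lfl; apply/eq_leq/eq_bigr => j _; rewrite -lift_max_widen mjoin_lift ytupleE.
rewrite (iterDC_word _ _ sH) -[iterDC _ _ _](divfK (mfact_neq0 R (mcount w))) -(mcoeff_jet _ dw).
rewrite wE mfE.
have -> : @ytilde R p (fun j => lf j) = ((\prod_j (lf j)`!)%:R)^-1 *: mpolyX R[i] (ytuple lf).
  by rewrite /ytilde [in RHS]mpolyXE_id; congr (_ *: _); apply: eq_bigr => j _; rewrite ytupleE.
have XH : mpolyX R[i] (ytuple lf) \is ishomog1 l mdeg.
  by rewrite dhomogX; apply/eqP; rewrite /= mdegE -[RHS]lfl; apply: eq_bigr => j _; rewrite ytupleE.
have n0 : (\prod_j (lf j)`!)%:R != 0 :> R[i].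
  by rewrite pnatr_eq0 -lt0n prodn_gt0// => j; exact: fact_gt0.
have -> : indhomog l (((\prod_j (lf j)`!)%:R)^-1 *: mpolyX R[i] (ytuple lf)) =
    ((\prod_j (lf j)`!)%:R)^-1 *: indhomog l (mpolyX R[i] (ytuple lf)).
  by apply/val_inj; rewrite val_indhomog ?rpredZ//= val_indhomog.
by rewrite scalerA; congr (_ *: _); rewrite -mulrA; congr (_ * _); rewrite mulrAC divff// mul1r.
Qed.

End Mixed.

(** * Parameters and shape of a non-zero operator *)

Section Classification.
Variables (R : realType) (p' : nat).
Local Notation p := p'.+1.
Hypothesis p_gt1 : (1 < p)%N.
Variables (alpha beta : bool) (lambda nu : R[i]) (W : vectType R[i]).
Variable varpi : 'M[R]_p -> W -> W.
Hypothesis varpi_ext : irr_ext varpi.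
Local Notation I := (@I_triv R p.+1 alpha lambda).
Local Notation J := (J_rep varpi nu beta).
Variable D : ('M[R]_p.+2 -> R[i]^o) -> 'M[R]_p.+1 -> W.
Hypothesis DD : Diff I J D.
Local Notation bsec := (bsec alpha lambda).
Local Notation lift_at1 := (lift_at1 alpha lambda D).
Local Notation at1 := (at1 D).
Local Notation tpoly := (tpoly alpha lambda D).

Let p_gt0 : (0 < p)%N. Proof. by []. Qed.
Let varpi_rep : is_rep varpi. Proof. by have [] := varpi_ext. Qed.
Let varpi_irr : irreducible_on (SL p) varpi. Proof. by have [] := varpi_ext. Qed.

(** At t = 0 the element g of M' sends (x', x_n) to det g times (g x', x_n), whence the power l + a
    of the determinant. *)
Lemma tpoly_mact l a q (g : 'M[R]_p) : q \is ishomog1 l mdeg -> SLpm p g ->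
  ((\det g)%:C ^+ alpha * (\det g)%:C ^+ (l + a)) *: tpoly (mixed (linsub g q) a) =
  (\det g)%:C ^+ beta *: varpi (invmx g) (tpoly (mixed q a)).
Proof.
move=> qH gS; have := lift_at1_p_elt p_gt0 DD 0 (csmooth_ev (mixed q a)) gS.
rewrite mulr0 oppr0 cexp0 scale1r expR0 !mulr1 invrK mul0r oppr0 expR0 mul1r.
have sgE : Num.sg (\det g) = \det g by case: gS => ->; rewrite ?sgrN sgr1.
have hE : hfac alpha lambda (\det g)^-1 = (\det g)%:C ^+ alpha.
  have := hfac_p_elt alpha lambda 0 gS.
  by rewrite expR0 mulr1 mulr0 oppr0 cexp0 mul1r sgE.
rewrite sgE hE => <-; rewrite -scalerA; congr (_ *: _).
rewrite /tpoly -(lift_at1Z DD _ (csmooth_ev _)); congr lift_at1.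
by apply/funext => x; rewrite [RHS](mixed_mact _ _ _ _ _ qH) exprD.
Qed.

Lemma exists_det_opp1 : exists2 g : 'M[R]_p, SLpm p g & \det g = -1.
Proof.
pose g : 'M[R]_p := diag_mx (\row_j (if j == 0 then -1 else 1)).
have dg : \det g = -1.
  rewrite det_diag (bigD1 0)//= big1 => [|j j0]; first by rewrite mxE eqxx mulr1.
  by rewrite mxE (negbTE j0).
by exists g => //; right.
Qed.

(** One monomial not killed by T fixes all parameters: its bidegree carries the intertwiner, and A',
    N'_+ and an element of determinant -1 give nu, lambda and beta. *)
Lemma tpoly_rep_equiv m : tpoly (mpolyX R[i] m) != 0 ->
  let l := mdeg (mhead m) in let a := m ord_max in
  exists Psi : {linear dhomog p R[i] l -> W},
  [/\ forall q, Psi q = tpoly (mixed (val q) a),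
      rep_equiv (SL p) (@poly_rep R p l) varpi Psi,
      beta = alpha (+) odd (a + l),
      l = 0%N \/ lambda = 1 - (a + l)%:R
    & nu = lambda + (a + l)%:R + l%:R / p%:R].
Proof.
move=> t0 l a.
have Xh : mpolyX R[i] (mhead m) \is ishomog1 l mdeg by rewrite dhomogX.
have [Psi PsiE] : exists Psi : {linear dhomog p R[i] l -> W},
    Psi =1 (fun q => tpoly (mixed (val q) a)).
  apply: linear_packed => c q r.
  by rewrite /= mixed_is_linear (tpoly_is_linear DD).
have Psi0 : Psi (DHomog Xh) != 0 by rewrite PsiE /= mixedX mjoin_head.
have PE : rep_equiv (SL p) (@poly_rep R p l) varpi Psi.
  apply: (rep_equiv_of_intertwiner varpi_rep varpi_irr p_gt1) => [g gS q|].
    have gVS := SLV gS.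
    have := tpoly_mact a (dhomog_is_dhomog q) (SL_SLpm gVS).
    rewrite [\det _]gVS rmorph1 !expr1n mul1r !scale1r invmxK.
    by rewrite !PsiE /= poly_act_linsub.
  by exists (DHomog Xh).
exists Psi; split=> //.
(* An element of determinant -1 compares beta with alpha; [irr_ext] makes [Psi] equivariant for it
   as well. *)
- have [_ _ _ /(_ l Psi PE)[_ PE']] := varpi_ext.
  have [g gS dg] := exists_det_opp1.
  have gVS := SLpmV gS.
  have := tpoly_mact a Xh gS.
  have := PE' _ gVS (DHomog Xh); rewrite !PsiE /= poly_act_linsub invmxK => <-.
  rewrite dg => /eqP; rewrite -subr_eq0 -scalerBl scaler_eq0 => /orP[|/eqP E]; last first.
    have /eqP := PE' _ gVS (DHomog Xh).
    rewrite [X in X == _]PsiE /= poly_act_linsub invmxK E => /eqP E'.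
    have : varpi (invmx (invmx g)) (varpi (invmx g) (Psi (DHomog Xh))) = varpi g 0 by rewrite -E' invmxK.
    have [L v1 vM _] := varpi_rep.
    have v0 : varpi g 0 = 0.
      by have := L _ gS (-1) 0 0; rewrite scaler0 addr0 scaleN1r addNr.
    rewrite v0 invmxK -vM// mulmxV ?v1; last exact: SLpm_unit.
    by move=> P0; rewrite P0 eqxx in Psi0.
  rewrite rmorphN rmorph1 -exprD subr_eq0.
  rewrite -signr_odd -[X in _ == X]signr_odd => /eqP/signr_inj.
  rewrite oddD -addnC -/a -/l !oddb addnC => <-.
  by rewrite addnC.
(* For l > 0 the monomial is x_j times some m' of degree a + l - 1, and [tpoly_nplus] for m' gives
   lambda + deg m' = 0. *)
- case: (posnP l) => [|l0]; [by left|right].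
  have [j mj] : exists j, mhead m j != 0%N.
    apply/existsP; apply: contraTT l0; rewrite negb_exists => /forallP H.
    by rewrite lt0n negbK /l mdegE big1// => j _; apply/eqP; have := H j; rewrite negbK.
  rewrite mheadE in mj; set xJ := lift ord_max j in mj.
  have leU : lem (mnm1 xJ) m.
    by apply/mnm_lepP => k; rewrite mnm1E; case: eqP => // <-; rewrite lt0n.
  have mE := submK leU; set m' := mnm_sub m (mnm1 xJ) in mE.
  have := tpoly_nplus p_gt0 varpi_rep DD m' j.
  rewrite -mpolyXD addmC mE => /eqP; rewrite scaler_eq0 (negbTE t0) orbF => /eqP lE.
  have dm : (a + l)%N = (mdeg m').+1.
    rewrite -[(mdeg m').+1]addn1 -(mdeg1 xJ) -mdegD mE [mdeg m]mdegE big_ord_recr /= addnC.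
    by rewrite /l mdegE; congr (_ + _)%N; apply: eq_bigr => k _; rewrite -lift_max_widen mheadE.
  apply/eqP; rewrite dm -subr_eq0 -[X in _ == X]lE -natr1; apply/eqP; ring.
- have := tpoly_weight p_gt0 varpi_rep DD t0.
  have -> : weight m = (p * (a + l) + l)%N.
    rewrite /weight big_ord_recr /= eqxx addn0.
    have -> : (\sum_(i < p) (p + (widen_ord (leqnSn p) i != ord_max)) * m (widen_ord (leqnSn p) i) =
        p.+1 * l)%N.
      rewrite /l mdegE big_distrr /=; apply: eq_bigr => k _.
      by rewrite -lift_max_widen mheadE eq_sym neq_lift addn1.
    by rewrite -/a mulnDr [(p.+1 * l)%N]mulSn -addnA addnC; congr (_ + _)%N; exact: addnC.
  have pn : p%:R != 0 :> R[i] by rewrite pnatr_eq0.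
  move=> E; apply: (mulIf pn); rewrite [RHS]mulrDl divfK// -[nu](subrK lambda) mulrDl E.
  by rewrite natrD natrM; ring.
Qed.

Lemma diff_classify :
  (forall f, I f -> forall g, D f g = 0) \/
  exists a l (Phi : {linear dhomog p R[i] l -> W}),
    [/\ rep_equiv (SL p) (@poly_rep R p l) varpi Phi,
        beta = alpha (+) odd (a + l),
        l = 0%N \/ lambda = 1 - (a + l)%:R,
        nu = lambda + (a + l)%:R + l%:R / p%:R
      & exists c, forall f, I f -> forall g, SL p.+1 g ->
          D f g = c *: Phi (D_ml a l (fun x => f (diag_last1 g *m nminus x)) 0)].
Proof.
case: (pselect (exists m, tpoly (mpolyX R[i] m) != 0)) => [[m t0]|T0]; [right|left].
  have [Psi [PsiE PE bE lE nE]] := tpoly_rep_equiv t0.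
  set l := mdeg (mhead m) in Psi PsiE PE bE lE nE *.
  set a := m ord_max in PsiE bE lE nE.
  (* The scalar compensates the factor a! of [D_ml_jet]. *)
  exists a, l, Psi; split => //; exists ((a`!)%:R)^-1 => f If g gS.
  (* All monomials not killed by T share one bidegree: varpi determines l, and then nu determines
     a. *)
  have only m' : tpoly (mpolyX R[i] m') != 0 -> mdeg (mhead m') = l /\ m' ord_max = a.
    move=> t'0; have [Psi' [_ PE' _ _ nE']] := tpoly_rep_equiv t'0.
    have ll := poly_rep_degree p_gt1 PE' PE; split => //.
    move: nE'; rewrite nE ll => /addIr/addrI/eqP; rewrite eqr_nat eqn_add2r => /eqP.
    by rewrite -/a => <-.
  have tE q : tpoly q = \sum_(lf : {ffun 'I_p -> 'I_l.+1} | (\sum_j lf j)%N == l)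
      mcoeff (mjoin (ytuple lf) a) q *: Psi (indhomog l (mpolyX R[i] (ytuple lf))).
    rewrite [in LHS](mpolyE q) (tpoly_sum DD).
    under [RHS]eq_bigr => lf _ do rewrite [q in mcoeff _ q]mpolyE raddf_sum scaler_suml.
    rewrite exchange_big /=; apply: eq_bigr => m' _.
    rewrite (tpolyZ DD); under [RHS]eq_bigr => lf _ do rewrite mcoeffZ -scalerA.
    rewrite -scaler_sumr; congr (_ *: _).
    have PX (lf : {ffun 'I_p -> 'I_l.+1}) : (\sum_j lf j)%N == l ->
        Psi (indhomog l (mpolyX R[i] (ytuple lf))) = tpoly (mpolyX R[i] (mjoin (ytuple lf) a)).
      move=> /eqP lfl; rewrite PsiE val_indhomog ?mixedX// dhomogX; apply/eqP.
      by rewrite /= mdegE -[RHS]lfl; apply: eq_bigr => j _; rewrite ytupleE.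
    case: (eqVneq (tpoly (mpolyX R[i] m')) 0) => [t0'|/only[ml ma]].
      rewrite t0' big1// => lf lfl; rewrite mcoeffX (PX _ lfl).
      by case: eqP => [<-|_]; rewrite ?t0' ?scaler0 ?scale0r.
    pose lf0 : {ffun 'I_p -> 'I_l.+1} := [ffun j => inord (mhead m' j)].
    have lf0E j : lf0 j = mhead m' j :> nat.
      rewrite ffunE inordK// ltnS -ml mdegE (bigD1 j)//=; exact: leq_addr.
    have yE : ytuple lf0 = mhead m' by apply/mnmP => j; rewrite ytupleE lf0E.
    have lf0l : (\sum_j lf0 j)%N == l.
      by apply/eqP; transitivity (mdeg (mhead m')) => //; rewrite mdegE; apply: eq_bigr => j _; rewrite lf0E.
    rewrite (bigD1 lf0 lf0l) /= big1 => [|lf /andP[lfl ne]].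
      by rewrite (PX _ lf0l) yE -ma mjoin_head mcoeffX eqxx scale1r addr0.
    rewrite mcoeffX; case: eqP => [E|_]; last by rewrite scale0r.
    case/eqP: ne; apply/ffunP => j; apply/val_inj; rewrite /= lf0E E mheadE.
    by rewrite mjoin_lift ytupleE.
  have [N HN] := lift_at1_jet p_gt0 varpi_rep DD.
  have If' : I (fun h => f (diag_last1 g *m h)) by exact: (ltrans_Ind (SL_diag_last1 gS) If).
  have sH := csmooth_section1 If'.
  rewrite (op_at1 DD If gS) (at1_chart DD If') (HN (N + (a + l).+1)%N (leq_addr _ _) _ sH) tE.
  rewrite (D_ml_jet sH (N := (N + (a + l).+1)%N)); last by rewrite addnS ltnS leq_addl.
  rewrite linear_sum scaler_sumr; apply: eq_bigr => lf _.
  rewrite linearZ /= scalerA mulrCA mulVf ?mulr1//.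
move=> f If g; case: (pselect (SL p.+1 g)) => gS; last exact: (op_offSL DD).
have [N HN] := lift_at1_jet p_gt0 varpi_rep DD.
have If' : I (fun h => f (diag_last1 g *m h)) by exact: (ltrans_Ind (SL_diag_last1 gS) If).
rewrite (op_at1 DD If gS) (at1_chart DD If') (HN N (leqnn _) _ (csmooth_section1 If')).
rewrite [jet _ _]mpolyE (tpoly_sum DD) big1// => m _.
rewrite (tpolyZ DD) (_ : tpoly _ = 0) ?scaler0//; apply/eqP/negPn/negP => t0.
by apply: T0; exists m.
Qed.

End Classification.

(** * The operators D_(m, l) *)

Section DmlTheory.
Variables (R : realType) (p a l : nat).
Implicit Types (H K : 'rV[R]_p.+1 -> R[i]) (x : 'rV[R]_p).
Local Notation lf_type := {ffun 'I_p -> 'I_l.+1}.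

Definition D_ml_dirs (lf : lf_type) : seq 'rV[R]_p.+1 :=
  @dirs_xn R p a ++ @dirs_x' R p (fun j => lf j).

Lemma D_mlE H x : D_ml a l H x = \sum_(lf : lf_type | (\sum_j lf j)%N == l)
  iterDC (D_ml_dirs lf) H (append0 x) *: indhomog l (@ytilde R p (fun j => lf j)).
Proof. by []. Qed.

Lemma D_ml_ext (U : set 'rV[R]_p.+1) H K x : open U -> (forall y, U y -> H y = K y) ->
  U (append0 x) -> D_ml a l H x = D_ml a l K x.
Proof.
by move=> oU HK Ux; rewrite !D_mlE; apply: eq_bigr => lf _; rewrite (iterDC_ext _ oU HK Ux).
Qed.

Lemma D_ml_lin c H K x : csmooth setT H -> csmooth setT K ->
  D_ml a l (fun y => c * H y + K y) x = c *: D_ml a l H x + D_ml a l K x.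
Proof.
move=> sH sK; have oT : open [set: 'rV[R]_p.+1] by exact: openT.
rewrite !D_mlE scaler_sumr -big_split /=; apply: eq_bigr => lf _.
rewrite (iterDC_D _ oT Logic.I (csmoothZ c oT sH) sK) (iterDC_Z _ _ oT Logic.I sH).
by rewrite scalerDl scalerA.
Qed.

Lemma append0_lift x i : append0 x 0 (lift ord_max i) = x 0 i.
Proof. by rewrite /append0 castmxE /= cast_ord_id cast_lift_max row_mxEl. Qed.

Lemma append0_max x : append0 x 0 ord_max = 0.
Proof. by rewrite /append0 castmxE /= cast_ord_id cast_max row_mxEr mxE. Qed.

Lemma append0_linear : linear (@append0 R p).
Proof.
move=> c u v; apply/rowP; elim/ord_max_ind => [|i].
  by rewrite !mxE !append0_max mulr0 addr0.
by rewrite !mxE !append0_lift !mxE.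
Qed.

Lemma append0D (c : R) (u v : 'rV[R]_p) : append0 (c *: u + v) = c *: append0 u + append0 v.
Proof. exact: append0_linear. Qed.

Lemma append0_continuous : continuous (@append0 R p).
Proof. exact: continuous_mx_linear append0_linear. Qed.

Lemma D_ml_shift H x : D_ml a l (fun y => H (append0 x + y)) 0 = D_ml a l H x.
Proof.
rewrite !D_mlE append0_0; apply: eq_bigr => lf _; congr (_ *: _).
have AL (h : R) (v y : 'rV[R]_p.+1) : append0 x + (h *: v + y) = h *: v + (append0 x + y).
  by rewrite addrCA.
by rewrite (iterDC_affine H _ _ AL) addr0 (_ : map _ _ = D_ml_dirs lf)// map_id.
Qed.

End DmlTheory.

(** * The operator on sections attached to D_(a, l) *)

Section OperatorOfDml.
Variables (R : realType) (p : nat).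
Variables (alpha : bool) (lambda : R[i]) (W : vectType R[i]) (a l : nat).
Variable Phi : {linear dhomog p R[i] l -> W}.
Local Notation I := (@I_triv R p.+1 alpha lambda).
Implicit Types (f : 'M[R]_p.+2 -> R[i]^o) (g h : 'M[R]_p.+1) (x : 'rV[R]_p).

(** The value at g is that of D_(a, l) at the origin on the section translated by g, which makes
    sense outside the chart N'_- too; off SL it is 0, by the encoding of sections. *)
Definition Dop f g : W :=
  if \det g == 1 then Phi (D_ml a l (fun y => f (diag_last1 g *m nminus y)) 0) else 0.

Lemma Dop_SL f g : SL p.+1 g ->
  Dop f g = Phi (D_ml a l (fun y => f (diag_last1 g *m nminus y)) 0).
Proof. by rewrite /Dop => ->; rewrite eqxx. Qed.

Lemma Dop_offSL f g : ~ SL p.+1 g -> Dop f g = 0.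
Proof. by rewrite /Dop; case: eqP. Qed.

Lemma diag_last1_nminus x : diag_last1 (nminus x) = nminus (append0 x).
Proof.
apply/matrixP; elim/ord_max_ind => [|i]; elim/ord_max_ind => [|j].
- by rewrite diag_last1_mm -lift0_max nminusE block1E mxE eqxx.
- rewrite diag_last1_ml nminusE -{1}lift0_max; case: (unliftP ord0 j) => [j' ->|->].
    by rewrite -lift0_lift_max block1E mxE -val_eqE /= /bump leqNgt ltn_ord /= add0n gtn_eqF.
  by rewrite lift_max_ord0 block1E mxE append0_max.
- rewrite diag_last1_lm nminusE -{2}lift0_max; case: (unliftP ord0 i) => [i' ->|->].
    by rewrite -lift0_lift_max block1E mxE -val_eqE /= /bump leqNgt ltn_ord /= add0n ltn_eqF.
  by rewrite lift_max_ord0 block1E mxE.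
- rewrite diag_last1_ll !nminusE; case: (unliftP ord0 i) => [i' ->|->];
    case: (unliftP ord0 j) => [j' ->|->]; rewrite -?lift0_lift_max ?lift_max_ord0 !block1E ?mxE//.
    by rewrite (inj_eq lift_inj).
  by rewrite append0_lift.
Qed.

(** Translation by an element of N'_- is a shift in x', with which D_(a, l) commutes; so [Dop] is
    given by D_(a, l) in every translated chart. *)
Lemma Dop_base f h x : SL p.+1 h ->
  Dop f (h *m nminus x) = Phi (D_ml a l (fun y => f (diag_last1 h *m nminus y)) x).
Proof.
move=> hS; rewrite Dop_SL; last exact: SLM hS (SL_nminus x).
rewrite -[in RHS]D_ml_shift; apply: (congr1 (fun H => Phi (D_ml a l H 0))); apply/funext => y.
by rewrite diag_last1M diag_last1_nminus -mulmxA -nminusD.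
Qed.

Lemma Dop_nminus f x : Dop f (nminus x) = Phi (D_ml a l (fun y => f (nminus y)) x).
Proof.
rewrite -[nminus x]mul1mx Dop_base; last exact: SL1.
by apply: (congr1 (fun H => Phi (D_ml a l H x))); apply/funext => y; rewrite diag_last1_1 mul1mx.
Qed.

Lemma Dop_lin c f f' : I f -> I f' ->
  Dop (fun k => c *: f k + f' k) = (fun g => c *: Dop f g + Dop f' g).
Proof.
move=> If If'; apply/funext => g; case: (pselect (SL p.+1 g)) => gS; last first.
  by rewrite !Dop_offSL// scaler0 addr0.
have gS' := SL_diag_last1 gS.
rewrite !Dop_SL// -linearP -(D_ml_lin _ _ _ _ (csmooth_section gS' If) (csmooth_section gS' If')).
by [].
Qed.

Lemma Dop_translate f h g : SL p.+1 h ->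
  Dop (fun k => f (diag_last1 h *m k)) g = Dop f (h *m g).
Proof.
move=> hS; case: (pselect (SL p.+1 g)) => gS; last first.
  by rewrite !Dop_offSL// => /(SLM_iff _ hS).
rewrite !Dop_SL//; last exact: SLM.
by apply: (congr1 (fun H => Phi (D_ml a l H 0))); apply/funext => y; rewrite diag_last1M mulmxA.
Qed.

Lemma Dop_equivariant f h : SL p.+1 h -> Dop (ltrans (diag_last1 h) f) = ltrans h (Dop f).
Proof.
move=> hS; apply/funext => g; rewrite /ltrans diag_last1V// Dop_translate//.
exact: SLV.
Qed.

Lemma diag_last1_linear : linear (fun g => diag_last1 g - diag_last1 0).
Proof.
move=> c u v; apply/matrixP; elim/ord_max_ind => [|i]; elim/ord_max_ind => [|j];
  rewrite !mxE ?diag_last1_ll ?diag_last1_lm ?diag_last1_ml ?diag_last1_mm ?mxE; ring.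
Qed.

Lemma diag_last1_continuous : continuous (@diag_last1 R p.+1).
Proof.
rewrite (_ : @diag_last1 R p.+1 = fun k => (diag_last1 k - diag_last1 0) + diag_last1 0).
  move=> g; have c1 := continuous_mx_linear diag_last1_linear.
  exact: (@cvgD _ _ _ _ _ _ _ _ _ (c1 g) (cvg_cst _)).
by apply/funext => k; rewrite subrK.
Qed.

(** If f vanishes near diag(g, 1), then for h near g the section translated by h vanishes near the
    origin, where all derivatives are taken. *)
Lemma Dop_supp f g : I f -> SL p.+1 g -> supp (Dop f) g -> supp f (diag_last1 g).
Proof.
move=> If gS; apply: contraPP => /existsNP[U /not_implyP[Ug U0]] /=.
have {}U0 k : U k -> f k = 0.
  by move=> Uk; apply: contrapT => /eqP fk; apply: U0; exists k.
have oUi := @open_interior _ U.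
have Vg : nbhs g [set h | U^° (diag_last1 h)].
  exact: (@diag_last1_continuous g _ (nbhs_interior Ug)).
move=> /(_ _ Vg)[h [/= Dh Uh]]; move: Dh; case: (pselect (SL p.+1 h)) => hS; last first.
  by rewrite Dop_offSL// eqxx.
rewrite Dop_SL// (@D_ml_ext _ _ _ _ [set y | U^° (diag_last1 h *m nminus y)] _ (fun=> 0)).
- rewrite (_ : D_ml _ _ _ _ = 0) ?linear0 ?eqxx// D_mlE big1// => lf _.
  by rewrite /iterDC /= !iterD_zero scale0r.
- by apply: (@open_comp _ _ (fun y => diag_last1 h *m nminus y)) => // z _; exact: continuous_nminus_mul.
- by move=> y /interior_subset/U0.
- by rewrite /= append0_0 nminus0 mulmx1.
Qed.

End OperatorOfDml.

(** * Continuity of the operator *)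

Section DopContinuity.
Variables (R : realType) (p : nat).
Variables (alpha : bool) (lambda : R[i]) (W : vectType R[i]) (a l : nat).
Variable Phi : {linear dhomog p R[i] l -> W}.
Local Notation I := (@I_triv R p.+1 alpha lambda).
Local Notation lf_type := {ffun 'I_p -> 'I_l.+1}.
Local Notation Dop := (Dop a Phi).
Local Notation dirs := (@D_ml_dirs R p a l).
Implicit Types (f : 'M[R]_p.+2 -> R[i]^o).

(** Extended by 0 to multi-indices of other degrees, so that sums run over a whole finite type. *)
Definition form_coef (psi : 'Hom(W, R[i]^o)) (lf : lf_type) : R[i] :=
  if (\sum_j lf j)%N == l then psi (Phi (indhomog l (@ytilde R p (fun j => lf j)))) else 0.

Lemma form_D_ml (psi : 'Hom(W, R[i]^o)) H x :
  psi (Phi (D_ml a l H x)) = \sum_lf form_coef psi lf * iterDC (dirs lf) H (append0 x) :> R[i].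
Proof.
rewrite D_mlE !linear_sum big_mkcond /=; apply: eq_bigr => lf _; rewrite /form_coef.
case: ifP => _; last by rewrite mul0r.
by rewrite linearZ linear_formZ mulrC.
Qed.

Lemma iterDC_form_D_ml (psi : 'Hom(W, R[i]^o)) H w x : csmooth setT H ->
  iterDC w (fun y => psi (Phi (D_ml a l H y)) : R[i]) x =
  \sum_lf form_coef psi lf * iterDC (map (@append0 R p) w ++ dirs lf) H (append0 x).
Proof.
move=> sH; have oT : open [set: 'rV[R]_p] by exact: openT.
rewrite (_ : (fun y => _) =
    fun y => \sum_lf form_coef psi lf * iterDC (dirs lf) H (append0 y)); last first.
  by apply/funext => y; exact: form_D_ml.
have s1 (lf : lf_type) : csmooth setT (fun y => iterDC (dirs lf) H (append0 y)).
  exact: (csmooth_affine (@append0D R p) (@append0_continuous R p) (fun _ _ => Logic.I)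
    (csmooth_iterDC (dirs lf) sH)).
rewrite (iterDC_sum _ _ oT Logic.I); last by move=> lf; exact: csmoothZ.
apply: eq_bigr => lf _; rewrite (iterDC_Z _ _ oT Logic.I (s1 lf)); congr (_ * _).
by rewrite (iterDC_affine _ _ _ (@append0D R p)) [in RHS]iterDC_cat.
Qed.

Definition re_im_form (b : bool) : 'Hom((R[i]^o : vectType R[i]), R[i]^o) :=
  if b then \1%VF else (- 'i%C) *: \1%VF.

Lemma re_im_formE b (z : R[i]) :
  complex.Re (re_im_form b z) = if b then complex.Re z else complex.Im z.
Proof.
case: b; rewrite /re_im_form ?scale_lfunE id_lfunE//.
rewrite -[(- _) *: _]/(- 'i%C * z) cReM /= oppr0 mul0r sub0r mulN1r opprK.
by [].
Qed.

(** A seminorm of [Dop f] in the chart at h is controlled by seminorms of f in the chart at diag(h,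
    1), over the image of the compact set and along the concatenated directions: one for each
    multi-index and each of Re and Im. *)
Lemma Dop_continuous : continuous_op I Dop.
Proof.
move=> s' e e0; set h := si_base s'; set C := si_set s'; set w := si_dirs s'; set psi := si_form s'.
have hS : SL p.+1 h := si_baseP s'.
have cC : compact (@append0 R p @` C).
  apply: continuous_compact; last exact: si_compact.
  by apply: continuous_subspaceT; exact: append0_continuous.
pose s0 (t : lf_type * bool) : seminorm_index p.+1 (R[i]^o : vectType R[i]) :=
  SeminormIndex (SL_diag_last1 hS) cC (map (@append0 R p) w ++ dirs t.1) (re_im_form t.2).
pose S := \sum_lf norm1 (form_coef psi lf).
have S0 : 0 <= S by apply: sumr_ge0 => lf _; rewrite addr_ge0.
(* The factor 2 accounts for real and imaginary parts; the summand 1 makes the final inequality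
   strict. *)
pose d := e / (2 * S + 1).
have d0 : 0 < d by rewrite divr_gt0// ltr_pwDr// mulr_ge0.
exists #|{: lf_type * bool}|, (fun i => s0 (enum_val i)), d; split=> // f If small x Cx.
have sH := csmooth_section (SL_diag_last1 hS) If.
set H := fun y => _ in sH.
have -> : (fun y => complex.Re (psi (Dop f (h *m nminus y)))) =
    fun y => complex.Re (psi (Phi (D_ml a l H y)) : R[i]).
  by apply/funext => y; rewrite Dop_base.
have -> : iterD w (fun y => complex.Re (psi (Phi (D_ml a l H y)) : R[i])) x =
    complex.Re (iterDC w (fun y => psi (Phi (D_ml a l H y)) : R[i]) x) by [].
rewrite (iterDC_form_D_ml _ _ _ sH).
have bound lf : norm1 (iterDC (map (@append0 R p) w ++ dirs lf) H (append0 x)) <= 2 * d.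
  have B b : `|iterD (map (@append0 R p) w ++ dirs lf)
      (fun y => if b then complex.Re (H y) else complex.Im (H y)) (append0 x)| < d.
    have := small (enum_rank (lf, b)) (append0 x); rewrite /= enum_rankK /=.
    move=> /(_ (ex_intro2 _ _ x Cx erefl)); congr (`|iterD _ _ _| < _).
    by apply/funext => y; rewrite re_im_formE.
  by have := B true; have := B false; rewrite /norm1 /=; lra.
have le : norm1 (\sum_lf form_coef psi lf *
    iterDC (map (@append0 R p) w ++ dirs lf) H (append0 x)) <= S * (2 * d).
  rewrite /S mulr_suml; elim/big_rec2: _ => [|lf b z _ IH].
    by rewrite /norm1 /= normr0 addr0.
  apply: (le_trans (y := norm1 (form_coef psi lf * iterDC (map (@append0 R p) w ++ dirs lf) H (append0 x)) + norm1 z)).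
    rewrite /norm1 cReD cImD.
    have := ler_normD (complex.Re (form_coef psi lf * iterDC (map (@append0 R p) w ++ dirs lf) H (append0 x))) (complex.Re z).
    have := ler_normD (complex.Im (form_coef psi lf * iterDC (map (@append0 R p) w ++ dirs lf) H (append0 x))) (complex.Im z).
    lra.
  apply: lerD => //; apply: le_trans (norm1M _ _) _.
  by apply: ler_wpM2l => //; rewrite addr_ge0.
apply: (@le_lt_trans _ _ (S * (2 * d))).
  by apply: le_trans le; rewrite /norm1 lerDl.
have D0 : 0 < 2 * S + 1 by rewrite ltr_pwDr// mulr_ge0.
have -> : S * (2 * d) = S * 2 * e / (2 * S + 1) by rewrite /d; ring.
rewrite ltr_pdivrMr//; have -> : e * (2 * S + 1) = S * 2 * e + e by ring.
by rewrite ltrDl.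
Qed.

End DopContinuity.

(** * Smoothness of the image *)

Section DopSmooth.
Variables (R : realType) (p : nat).
Variables (alpha : bool) (lambda : R[i]) (W : vectType R[i]) (a l : nat).
Variable Phi : {linear dhomog p R[i] l -> W}.
Local Notation I := (@I_triv R p.+1 alpha lambda).
Local Notation Dop := (Dop a Phi).
Local Notation dirs := (@D_ml_dirs R p a l).
Local Notation VM := ('M[R]_p.+1 * 'rV[R]_p.+1)%type.
Local Notation hfac := (hfac alpha lambda).
Implicit Types (f : 'M[R]_p.+2 -> R[i]^o).

Definition gx (z : VM) : 'M[R]_p.+2 := diag_last1 z.1 *m nminus z.2.

Lemma smooth_gx i j : smooth_real setT (fun z : VM => gx z i j).
Proof.
have oT : open [set: VM] by exact: openT.
have s1 (i' j' : 'I_p.+1) : smooth_real setT (fun z : VM => z.1 i' j').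
  apply: smooth_linearP => //; first by move=> c u v; rewrite /= !mxE.
  move=> z; apply: (@continuous_comp _ _ _ (fun z : VM => z.1) (fun g => g i' j')); first exact: cvg_fst.
  exact: coord_continuous.
have s2 (i' : 'I_p.+1) : smooth_real setT (fun z : VM => z.2 0 i').
  apply: smooth_linearP => //; first by move=> c u v; rewrite /= !mxE.
  move=> z; apply: (@continuous_comp _ _ _ (fun z : VM => z.2) (fun g => g 0 i')); first exact: cvg_snd.
  exact: coord_continuous.
have sd (i' k : 'I_p.+2) : smooth_real setT (fun z : VM => diag_last1 z.1 i' k).
  elim/ord_max_ind: i' => [|i']; elim/ord_max_ind: k => [|k].
  - by apply: (smooth_ext oT _ (smooth_cst 1 oT)) => z _; rewrite diag_last1_mm.
  - by apply: (smooth_ext oT _ (smooth_cst 0 oT)) => z _; rewrite diag_last1_ml.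
  - by apply: (smooth_ext oT _ (smooth_cst 0 oT)) => z _; rewrite diag_last1_lm.
  - by apply: (smooth_ext oT _ (s1 i' k)) => z _; rewrite diag_last1_ll.
have sn (k j' : 'I_p.+2) : smooth_real setT (fun z : VM => nminus z.2 k j').
  case: (unliftP ord0 k) => [k' ->|->]; case: (unliftP ord0 j') => [j0 ->|->].
  - apply: (smooth_ext oT _ (smooth_cst (k' == j0)%:R oT)) => z _.
    by rewrite nminusE block1E mxE.
  - by apply: (smooth_ext oT _ (s2 k')) => z _; rewrite nminusl0.
  - by apply: (smooth_ext oT _ (smooth_cst 0 oT)) => z _; rewrite nminusE block1E mxE.
  - by apply: (smooth_ext oT _ (smooth_cst 1 oT)) => z _; rewrite nminus00.
apply: (smooth_ext oT _ (smooth_sum _ oT (fun k _ => smoothM oT (sd i k) (sn k j)))) => z _.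
by rewrite /gx mxE.
Qed.

Definition gdom : set VM := [set z | gx z ord0 ord0 != 0].

Lemma open_gdom : open gdom.
Proof. exact: open_neq0_smooth (smooth_gx _ _). Qed.

(** The formula of [I_chart] extends the translated section to an open set of matrices; f itself is
    0 off SL. *)
Definition gsec f (z : VM) : R[i] := hfac (gx z ord0 ord0) * f (nminus (chart (gx z))).

Lemma csmooth_gsec f : I f -> csmooth gdom (gsec f).
Proof.
move=> If; have oB := open_gdom.
have sE i j : smooth_real gdom (fun z => gx z i j) by apply: smooth_sub (smooth_gx i j).
apply: (csmoothM oB); first by apply: (csmooth_hfac _ _ oB (sE _ _)) => z.
by apply: (csmooth_chart oB (csmooth_section1 If) sE) => z.
Qed.

Lemma gx0 (g : 'M[R]_p.+1) : gx (g, 0) ord0 ord0 = g ord0 ord0.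
Proof. by rewrite /gx /= nminus0 mulmx1 -{1 2}lift_max_ord0 diag_last1_ll. Qed.

(** Joint smoothness of [gsec] in (h, x) lets the derivatives in x at 0 be differentiated further in
    h. *)
Lemma Dop_smooth_near1 f : I f -> exists (U : set 'M[R]_p.+1) (F : 'M[R]_p.+1 -> W),
  [/\ open U, U 1%:M, smooth_on U F & forall h, U h -> SL p.+1 h -> F h = Dop f h].
Proof.
move=> If; pose U := [set h : 'M[R]_p.+1 | h ord0 ord0 != 0].
have oU : open U by apply: (open_neq0_smooth (smooth_entry _ _ openT)).
pose xdir (v : 'rV[R]_p.+1) : VM := (0, v).
pose F h : W := Phi (D_ml a l (fun x => gsec f (h, x)) 0).
have oX h : open [set x : 'rV[R]_p.+1 | gdom (h, x)].
  apply: (@open_comp _ _ (fun x : 'rV[R]_p.+1 => (h, x)) gdom); last exact: open_gdom.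
  by move=> x _; exact: (@cvg_pair _ _ _ (nbhs x) (nbhs h) (nbhs x) _ _ _ (fun=> h) (fun y => y) (cvg_cst h) cvg_id).
have X0 h : U h -> gdom (h, 0) by rewrite /gdom /= gx0.
exists U, F; split=> //; first by rewrite /U /= mxE eqxx oner_eq0.
  move=> psi; have sG := csmooth_gsec If.
  have AL (c : R) (v y : 'M[R]_p.+1) : (c *: v + y, 0) = c *: ((v, 0) : VM) + (y, 0).
    by congr (_, _); rewrite /= scaler0 add0r.
  have cA : continuous (fun h : 'M[R]_p.+1 => (h, 0 : 'rV[R]_p.+1)).
    move=> h; exact: (@cvg_pair _ _ _ (nbhs h) (nbhs h) (nbhs (0 : 'rV[R]_p.+1)) _ _ _ (fun y => y) (fun=> 0) cvg_id (cvg_cst _)).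
  have s1 (lf : {ffun 'I_p -> 'I_l.+1}) : csmooth U (fun h => form_coef Phi psi lf *
      iterDC (map xdir (dirs lf)) (gsec f) (h, 0)).
    apply: (csmoothZ _ oU).
    exact: (csmooth_affine AL cA X0 (csmooth_iterDC (map xdir (dirs lf)) sG)).
  have [s _] := csmooth_sum (index_enum _) predT oU s1.
  apply: (smooth_ext oU _ s) => h Uh; rewrite /F form_D_ml.
  congr complex.Re; apply: eq_bigr => lf _; congr (_ * _).
  have ALx (c : R) (v y : 'rV[R]_p.+1) : (h, c *: v + y) = c *: xdir v + (h, y).
    by rewrite /xdir; congr (_, _); rewrite /= scaler0 add0r.
  by rewrite (iterDC_affine (gsec f) _ _ ALx) append0_0.
move=> h Uh hS; rewrite Dop_SL// /F; apply: (congr1 Phi).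
refine (@D_ml_ext R p a l _ _ _ 0 (oX h) _ _); last by rewrite append0_0; exact: X0.
move=> x xB; rewrite (I_chart _ If)//.
by apply: SLM; [exact: SL_diag_last1|exact: SL_nminus].
Qed.

Lemma Dop_smooth f : I f -> smooth_on_SL (Dop f).
Proof.
move=> If g gS; have If' := ltrans_Ind (SL_diag_last1 gS) If.
have [U [F [oU U1 sF FE]]] := Dop_smooth_near1 If'.
have gVS := SLV gS; have gu := SL_unit gS.
have cL : continuous (fun h : 'M[R]_p.+1 => invmx g *m h).
  by apply: continuous_mx_linear => c u v; rewrite mulmxDr scalemxAr.
have oV : open [set h | U (invmx g *m h)].
  by apply: (@open_comp _ _ (fun h => invmx g *m h) U) => // z _; exact: cL.
exists [set h | U (invmx g *m h)], (fun h => F (invmx g *m h)); split=> //.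
- by rewrite /= mulVmx.
- move=> psi; have AL (c : R) (v y : 'M[R]_p.+1) :
    invmx g *m (c *: v + y) = c *: (invmx g *m v) + invmx g *m y by rewrite mulmxDr scalemxAr.
  exact: (smooth_affine AL cL (fun _ u => u) (sF psi)).
by move=> h Uh hS; rewrite FE// ?Dop_translate// ?mulKVmx//; exact: SLM.
Qed.

End DopSmooth.

(** * Bol's lemma and derivatives along lines *)

Section Bol.
Variable R : realType.
Implicit Types (s c : R) (phi h : R -> R).
Local Notation diffn n h := (iterD (nseq n (1 : R)) h).

Lemma is_derive_diffn (U : set R) h n s : smooth_real U h -> U s ->
  is_derive s 1 (diffn n h) (diffn n.+1 h s).
Proof. by move=> sh Us; have [_ dh] := sh (nseq n 1) s Us; exact: DeriveDef. Qed.

Lemma derD (f h : R -> R) s (a b : R) : is_derive s 1 f a -> is_derive s 1 h b ->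
  is_derive s 1 (fun s => f s + h s) (a + b).
Proof. exact: is_deriveD. Qed.

Lemma derM (f h : R -> R) s (a b : R) : is_derive s 1 f a -> is_derive s 1 h b ->
  is_derive s 1 (fun s => f s * h s) (a * h s + f s * b).
Proof.
move=> df dh; apply: (is_derive_eq (is_deriveM df dh)).
by rewrite /GRing.scale /= addrC [h s * a]mulrC.
Qed.

Lemma derX (f : R -> R) s (a : R) n : is_derive s 1 f a ->
  is_derive s 1 (fun s => f s ^+ n) (n%:R * f s ^+ n.-1 * a).
Proof.
move=> df; have := is_deriveX n df; rewrite /GRing.scale /=; congr (is_derive _ _ _ _).
by apply/funext => r; elim: n => [|n ih]; rewrite ?expr0// !exprS -ih.
Qed.

Lemma derC (a s : R) : is_derive s 1 (fun _ : R => a) 0.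
Proof. exact: is_derive_cst. Qed.

Lemma is_derive_affine c s : is_derive s 1 (fun s : R => 1 + s * c) c.
Proof.
have := derD (derC 1 s) (derM (is_derive_id s (1 : R)) (derC c s)).
by rewrite add0r mul1r mulr0 addr0.
Qed.

(** Leibniz's rule, which stops after two terms for an affine factor. *)
Lemma diffn_affineM (U : set R) c h n s : open U -> smooth_real U h -> U s ->
  diffn n.+1 (fun s => (1 + s * c) * h s) s =
  (1 + s * c) * diffn n.+1 h s + c * n.+1%:R * diffn n h s.
Proof.
move=> oU sh; elim: n s => [|n ih] s Us.
  have [_ e] := derM (is_derive_affine c s) (is_derive_diffn 0 sh Us).
  by rewrite /= in e *; rewrite e mulr1 addrC.
rewrite -[LHS]/('D_1 (diffn n.+1 (fun s => (1 + s * c) * h s)) s).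
rewrite (near_eq_derive _ (open_near_eq oU Us ih)).
have d1 := derM (is_derive_affine c s) (is_derive_diffn n.+1 sh Us).
have d2 := derM (derC (c * n.+1%:R) s) (is_derive_diffn n sh Us).
have [_ e] := derD d1 d2; rewrite e.
set d := diffn n.+2 h s; set d' := diffn n.+1 h s; set d0 := diffn n h s.
by rewrite -[n.+2%:R]natr1 -[X in X + 1]/(n.+1%:R); ring.
Qed.

Lemma smooth_id : smooth_real setT (fun s : R => s).
Proof. by apply: (smooth_linearP _ _ openT) => // s; exact: cvg_id. Qed.

Lemma smooth_one_plus c : smooth_real setT (fun s => 1 + s * c).
Proof.
have oT : open [set: R] by exact: openT.
exact: (smoothD oT (smooth_cst 1 oT) (smoothM oT smooth_id (smooth_cst c oT))).
Qed.

(* Bol's lemma.  The first factor is (1 + s c) ^ (n - 1). *)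
Lemma bol c phi n s : smooth_real setT phi -> 0 < 1 + s * c ->
  diffn n (fun s => (1 + s * c) ^+ n * (1 + s * c)^-1 * phi (s * (1 + s * c)^-1)) s =
  (1 + s * c)^-1 ^+ n.+1 * diffn n phi (s * (1 + s * c)^-1).
Proof.
move=> sphi; pose U := [set s | 0 < 1 + s * c].
have oT : open [set: R] by exact: openT.
have su := smooth_one_plus c.
have oU : open U by exact: open_gt0_smooth su.
have sUu : smooth_real U (fun s => 1 + s * c) by apply: smooth_sub su.
have sv : smooth_real U (fun s => (1 + s * c)^-1).
  by apply: (smooth_comp1 oU (@open_neq0 R) (@smooth_inv R) sUu) => r /= r0; rewrite gt_eqF.
have ss : smooth_real U (fun s => s * (1 + s * c)^-1).
  by apply: (smoothM oU _ sv); apply: smooth_sub smooth_id.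
have sh k : smooth_real U (fun s => (1 + s * c) ^+ k * (1 + s * c)^-1 * phi (s * (1 + s * c)^-1)).
  apply: (smoothM oU (smoothM oU (smoothX k oU sUu) sv)).
  exact: (smooth_comp1 oU oT sphi ss (fun _ _ => Logic.I)).
suff H : forall k r, U r -> diffn k (fun s => (1 + s * c) ^+ k * (1 + s * c)^-1 * phi (s * (1 + s * c)^-1)) r =
    (1 + r * c)^-1 ^+ k.+1 * diffn k phi (r * (1 + r * c)^-1) by exact: H.
elim=> [|k ih] r Ur; first by rewrite /= expr0 mul1r expr1.
(* Passing from k to k + 1 multiplies the function by the affine factor 1 + s c, to which
   [diffn_affineM] applies. *)
have -> : (fun s => (1 + s * c) ^+ k.+1 * (1 + s * c)^-1 * phi (s * (1 + s * c)^-1)) =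
    fun s => (1 + s * c) * ((1 + s * c) ^+ k * (1 + s * c)^-1 * phi (s * (1 + s * c)^-1)).
  by apply/funext => r'; rewrite exprS !mulrA.
rewrite (diffn_affineM c k oU (sh k) Ur) (ih r Ur).
rewrite -[diffn k.+1 _ r]/('D_1 (diffn k (fun s => (1 + s * c) ^+ k * (1 + s * c)^-1 * phi (s * (1 + s * c)^-1))) r).
rewrite (near_eq_derive _ (open_near_eq oU Ur ih)).
have u0 : 1 + r * c != 0 by rewrite gt_eqF.
have dv : is_derive r 1 (fun s => (1 + s * c)^-1) (- (1 + r * c)^-1 ^+ 2 * c).
  have [du eu] := is_derive_affine c r.
  have [dn en] := is_derive_inv u0.
  have := @is_derive_comp1 _ _ (@GRing.inv R) (fun s => 1 + s * c) r 1 du dn.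
  by rewrite eu en exprVn.
have dX := derX k.+1 dv.
have ds := derM (is_derive_id r (1 : R)) dv.
have [dss es] := ds; have dphi := is_derive_diffn k sphi (Logic.I : setT (r * (1 + r * c)^-1)).
have [dp ep] := dphi.
have dc := @is_derive_comp1 _ _ (diffn k phi) (fun s => s * (1 + s * c)^-1) r 1 dss dp.
rewrite es ep in dc.
have [_ e] := derM dX dc; rewrite e.
set p1 := diffn k.+1 phi _; set p0 := diffn k phi _; clearbody p1 p0; rewrite [k.+1.-1]/=.
have -> : 1 * (1 + r * c)^-1 + r * (- (1 + r * c)^-1 ^+ 2 * c) = (1 + r * c)^-1 ^+ 2.
  by field.
rewrite (exprS _ k.+1) (exprS _ k); set w := (1 + r * c)^-1 ^+ k; clearbody w.
by field.
Qed.

End Bol.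

Section BolLine.
Variable R : realType.
Implicit Types (s c : R).
Local Notation diffn n h := (iterD (nseq n (1 : R)) h).

Lemma bolC c (F : R -> R[i]) n : csmooth setT F ->
  iterDC (nseq n (1 : R))
    (fun s => ((1 + s * c) ^+ n * (1 + s * c)^-1)%:C * F (s * (1 + s * c)^-1)) 0 =
  iterDC (nseq n (1 : R)) F 0.
Proof.
move=> [rF iF]; rewrite /iterDC.
have u0 : 0 < 1 + 0 * c by rewrite mul0r addr0.
have B phi : smooth_real setT phi ->
    diffn n (fun s => (1 + s * c) ^+ n * (1 + s * c)^-1 * phi (s * (1 + s * c)^-1)) 0 = diffn n phi 0.
  by move=> sphi; rewrite (bol n sphi u0) !mul0r addr0 invr1 expr1n mul1r.
rewrite -(B _ rF) -(B _ iF); congr (_ +i* _); congr (iterD _ _ _); apply/funext => s.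
  by rewrite cReM /= mul0r subr0.
by rewrite cImM /= mul0r addr0.
Qed.

Lemma diffn_pow n k s : diffn n (fun s => s ^+ k) s = (k ^_ n)%:R * s ^+ (k - n).
Proof.
elim: n s => [|n ih] s; first by rewrite /= ffactn0 mul1r subn0.
rewrite -[LHS]/('D_1 (diffn n (fun s => s ^+ k)) s).
rewrite (_ : diffn n _ = fun s => (k ^_ n)%:R * s ^+ (k - n)); last exact/funext.
have [_ e] := derM (derC (k ^_ n)%:R s) (derX (k - n) (is_derive_id s (1 : R))).
by rewrite e mul0r add0r mulr1 ffactnSr natrM mulrA subnS.
Qed.

Lemma iterDC_pow0 n k (z : R[i]) :
  iterDC (nseq n (1 : R)) (fun s => z * s%:C ^+ k) 0 = if k == n then z * (n`!)%:R else 0.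
Proof.
have oT : open [set: R] by exact: openT.
have sp : csmooth setT (fun s : R => s%:C ^+ k).
  by apply: (csmoothX k oT); apply: (csmooth_real oT); exact: smooth_id.
rewrite (iterDC_Z _ _ oT Logic.I sp).
have -> : iterDC (nseq n (1 : R)) (fun s : R => s%:C ^+ k) 0 = (diffn n (fun s => s ^+ k) 0)%:C.
  rewrite /iterDC; congr (_ +i* _).
    by congr (iterD _ _ _); apply/funext => s; rewrite -rmorphXn.
  rewrite -[RHS](iterD_zero (nseq n (1 : R)) 0); congr (iterD _ _ _).
  by apply/funext => s; rewrite -rmorphXn.
rewrite diffn_pow expr0n; case: (ltngtP k n) => [kn|kn|->].
- by rewrite ffact_small// mul0r mulr0.
- by rewrite subn_eq0 leqNgt kn /= mulr0 mulr0.
- by rewrite ffactnn subnn eqxx mulr1 rmorph_nat.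
Qed.

Variable k : nat.

Lemma iterDC_line (H : 'rV[R]_k -> R[i]) n x :
  iterDC (nseq n x) H 0 = iterDC (nseq n (1 : R)) (fun s => H (s *: x)) 0.
Proof.
have AL (h v y : R) : (h *: v + y) *: x = h *: (v *: x) + y *: x.
  by rewrite scalerDl [h *: v]/(h * v) scalerA.
by rewrite (iterDC_affine H _ _ AL) map_nseq scale1r scale0r.
Qed.

(** Along s |-> s x the n-th derivative at 0 is n! times the value at x of the part of degree n of
    the Taylor polynomial, and a polynomial without non-zero values is 0. So derivatives along lines
    determine all derivatives of order n. *)
Lemma jet_homogeneous (K : 'rV[R]_k -> R[i]) n : csmooth setT K ->
  (forall x, iterDC (nseq n x) K 0 = 0) ->
  forall m N, mdeg m = n -> (n < N)%N -> mcoeff m (jet N K) = 0.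
Proof.
move=> sK K0 m N mn nN; set q := jet N K.
pose r : mpoly k R[i] := \sum_(m <- msupp q | mdeg m == n) mcoeff m q *: mpolyX R[i] m.
have oT : open [set: 'rV[R]_k] by exact: openT.
have r0 : r = 0.
  apply: ev_inj => x; apply: (mulIf (_ : (n`!)%:R != 0)).
    by rewrite pnatr_eq0 -lt0n fact_gt0.
  rewrite mul0r -(K0 x).
  have -> : iterDC (nseq n x) K 0 = iterDC (nseq n x) (ev q) 0.
    have fl := @cflat_jet _ _ N K sK; have := fl (nseq n x).
    rewrite size_nseq (iterDC_D _ oT Logic.I sK (csmoothZ (-1) oT (csmooth_ev q))).
    rewrite (iterDC_Z _ _ oT Logic.I (csmooth_ev q)) mulN1r => /(_ nN)/eqP.
    by rewrite subr_eq0 => /eqP.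
  rewrite iterDC_line (_ : (fun s => _) = fun s =>
      \sum_(m <- msupp q) (mcoeff m q * ev (mpolyX R[i] m) x) * s%:C ^+ mdeg m); last first.
    apply/funext => s; rewrite /ev [q in LHS]mpolyE raddf_sum; apply: eq_bigr => m' _.
    rewrite /= mevalZ -mulrA; congr (_ * _); rewrite mulrC -mevalZ_mon; apply: meval_eq => j.
    by rewrite mxE rmorphM.
  have oR : open [set: R] by exact: openT.
  rewrite (iterDC_sum _ _ oR Logic.I); last first.
    move=> m'; apply: (csmoothZ _ oR); apply: (csmoothX _ oR); apply: (csmooth_real oR).
    exact: smooth_id.
  under [RHS]eq_bigr => m' _ do rewrite iterDC_pow0.
  rewrite -big_mkcond /= /ev /r raddf_sum mulr_suml; apply: eq_bigr => m' _.
  by rewrite /= mevalZ.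
have [mS|] := boolP (m \in msupp q); last by rewrite mcoeff_msupp negbK => /eqP.
have := congr1 (mcoeff m) r0; rewrite mcoeff0 /r raddf_sum /=.
rewrite -big_filter (bigD1_seq m) ?filter_uniq ?msupp_uniq//=; last by rewrite mem_filter mn eqxx.
rewrite mcoeffZ mcoeffX eqxx mulr1 big1 ?addr0// => m' m'm.
by rewrite mcoeffZ mcoeffX (negbTE m'm) mulr0.
Qed.

End BolLine.

(** * Equivariance under N'_+ *)

Section DopNplus.
Variables (R : realType) (p : nat).
Hypothesis p_gt0 : (0 < p)%N.
Variables (alpha : bool) (lambda : R[i]) (W : vectType R[i]) (a l : nat).
Variable Phi : {linear dhomog p R[i] l -> W}.
Local Notation I := (@I_triv R p.+1 alpha lambda).
Local Notation Dop := (Dop a Phi).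
Local Notation dirs := (@D_ml_dirs R p a l).
Hypothesis l_lambda : l = 0%N \/ lambda = 1 - (a + l)%:R.
Implicit Types (f : 'M[R]_p.+2 -> R[i]^o) (b : 'rV[R]_p).

Lemma p_elt_nplus b : p_elt 1%:M 0 b = nplus b.
Proof.
rewrite p_eltE// nplusE det1 invr1 expR0 mulr1 mul0r oppr0 expR0 !scale1r.
by [].
Qed.

Lemma nplus_section f b (x : 'rV[R]_p.+1) : I f -> 1 + \sum_j b 0 j * x 0 (lift ord_max j) != 0 ->
  f (diag_last1 (nplus b) *m nminus x) =
  hfac alpha lambda (1 + \sum_j b 0 j * x 0 (lift ord_max j)) *
  f (nminus ((1 + \sum_j b 0 j * x 0 (lift ord_max j))^-1 *: x)).
Proof.
move=> If; set u := 1 + _ => u0; rewrite -p_elt_nplus.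
rewrite (section_p_elt (m := 1%:M) p_gt0 0 If (SL_SLpm (SL1 R p))) -/u; last first.
  exact: u0.
rewrite det1 invr1 expR0 !mul1r mul0r oppr0 expR0 mul1r.
congr (_ * f (nminus _)); apply/rowP; elim/ord_max_ind => [|i].
  by rewrite mact_max !mxE.
rewrite mact_lift mxE (bigD1 i)//= mxE eqxx mul1r big1 ?addr0// => i' i'i.
by rewrite mxE eq_sym (negbTE i'i) mul0r.
Qed.

(** On the line through x, [hfac] is the power - lambda of 1 + s c, and - lambda = (a + l) - 1 is
    the exponent in Bol's lemma for derivatives of order a + l. *)
Lemma nplus_line f b (x : 'rV[R]_p.+1) : I f -> lambda = 1 - (a + l)%:R ->
  iterDC (nseq (a + l) x) (fun y => f (diag_last1 (nplus b) *m nminus y)) 0 =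
  iterDC (nseq (a + l) x) (fun y => f (nminus y)) 0.
Proof.
move=> If lE; rewrite !iterDC_line.
set c := \sum_j b 0 j * x 0 (lift ord_max j).
have sF : csmooth setT (fun s : R => f (nminus (s *: x)) : R[i]).
  have AL (h v y : R) : (h *: v + y) *: x = h *: (v *: x) + y *: x.
    by rewrite scalerDl [h *: v]/(h * v) scalerA.
  have cA : continuous (fun s : R => s *: x) by move=> s; apply: cvgZr_tmp; exact: cvg_id.
  exact: (csmooth_affine AL cA (fun _ _ => Logic.I) (csmooth_section1 If)).
rewrite -[RHS](bolC c _ sF).
pose U := [set s : R | 0 < 1 + s * c].
have oT : open [set: R] by exact: openT.
have oU : open U.
  exact: open_gt0_smooth (smooth_one_plus c).
apply: (iterDC_ext _ oU) => [s /= Us|]; last by rewrite /U /= mul0r addr0.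
have cE : 1 + \sum_j b 0 j * (s *: x) 0 (lift ord_max j) = 1 + s * c.
  by rewrite /c mulr_sumr; congr (_ + _); apply: eq_bigr => j _; rewrite mxE mulrCA.
rewrite (nplus_section If) cE ?gt_eqF// (hfac_gt0 _ _ Us) scalerA [(1 + _)^-1 * s]mulrC.
congr (_ * _).
have -> : - (lambda * (ln (1 + s * c))%:C) =
    (a + l)%:R * (ln (1 + s * c))%:C + 1%:R * (- ln (1 + s * c))%:C.
  by rewrite lE rmorphN; ring.
by rewrite cexpD !cexp_natr expRN lnK ?posrE// expr1 rmorphM rmorphXn.
Qed.

Lemma Dop_nplus1 f b : I f -> Dop f (nplus b) = Dop f 1%:M.
Proof.
move=> If.
have nS : SL p.+1 (nplus b) by rewrite -p_elt_nplus; apply: det_p_elt => //; exact: SL_SLpm (SL1 R p).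
rewrite (Dop_SL _ _ _ nS) (Dop_SL _ _ _ (SL1 R _)); apply: (congr1 Phi).
set H' := fun y => _; set H := fun y => f (_ *m _).
have -> : H = fun y => f (nminus y) by apply/funext => y; rewrite /H diag_last1_1 mul1mx.
have sH' : csmooth setT H' by exact: csmooth_section (SL_diag_last1 nS) If.
have sH := csmooth_section1 If.
case: l_lambda => [l0|lE].
  rewrite !D_mlE append0_0; apply: eq_bigr => lf _; congr (_ *: _).
  have -> : dirs lf = nseq a (@dir R p ord_max).
    rewrite -[RHS]cats0; congr (_ ++ _); rewrite /dirs_x'.
    rewrite (eq_map (g := fun=> [::])) => [|j].
      by elim: (enum 'I_p) => //= _ s; rewrite cats0.
    have := ltn_ord (lf j); rewrite ltnS => /leq_trans/(_ (eq_leq l0)).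
    by rewrite leqn0 => /eqP ->.
  rewrite !iterDC_line; congr (iterDC _ _ 0); apply/funext => s.
  have cE : 1 + \sum_j b 0 j * (s *: @dir R p ord_max) 0 (lift ord_max j) = 1.
    rewrite big1 ?addr0// => j _.
    by rewrite !mxE eq_sym (negbTE (neq_lift _ _)) andbF !mulr0.
  by rewrite /H' (nplus_section If) cE ?oner_neq0// hfac1 mul1r invr1 scale1r.
have oT : open [set: 'rV[R]_p.+1] by exact: openT.
apply/eqP; rewrite -subr_eq0 -scaleN1r addrC -(D_ml_lin _ _ _ _ sH sH').
(* The difference of the two sections has zero derivatives of order a + l along every line, hence no
   Taylor coefficients of that degree, and D_(a, l) reads no others. *)
set K := fun y => _.
have sK : csmooth setT K by exact: (csmoothD oT (csmoothZ _ oT sH) sH').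
have K0 x : iterDC (nseq (a + l) x) K 0 = 0.
  rewrite /K (iterDC_D _ oT Logic.I (csmoothZ (-1) oT sH) sH') (iterDC_Z _ _ oT Logic.I sH).
  by rewrite (nplus_line _ _ If lE) mulN1r addNr.
rewrite (D_ml_jet sK (N := (a + l).+1))// big1// => lf /eqP lfl.
rewrite (jet_homogeneous sK K0) ?mul0r ?scale0r//.
rewrite mdegE big_ord_recr /= mjoin_max addnC; congr (_ + _)%N; rewrite -[RHS]lfl.
by apply: eq_bigr => j _; rewrite -lift_max_widen mjoin_lift ytupleE.
Qed.

End DopNplus.

(** * Action of M'A' on D_(a, l) *)

Section DmlAction.
Variables (R : realType) (p a l : nat).
Implicit Types (H K : 'rV[R]_p.+1 -> R[i]) (q : mpoly p R[i]).
Local Notation lf_type := {ffun 'I_p -> 'I_l.+1}.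

Lemma D_ml_flat K : cflat (a + l).+1 K -> D_ml a l K 0 = 0.
Proof.
move=> fK; rewrite D_mlE append0_0 big1// => lf /eqP lfl; rewrite fK ?scale0r//.
rewrite ltnS /D_ml_dirs size_cat size_nseq leq_add2l size_flatten /shape -map_comp sumnE big_map big_enum /=.
by rewrite -[X in (_ <= X)%N]lfl; apply/eq_leq/eq_bigr => j _; rewrite size_nseq.
Qed.

Lemma D_mlZ c H : csmooth setT H -> D_ml a l (fun x => c * H x) 0 = c *: D_ml a l H 0.
Proof.
move=> sH; have s0 : csmooth [set: 'rV[R]_p.+1] (fun=> 0 : R[i]).
  by apply: csmooth_cst; exact: openT.
have := D_ml_lin a l c 0 sH s0; rewrite [X in _ = _ + X]D_ml_flat ?addr0 => [<-|w _]; last first.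
  by rewrite /iterDC /= !iterD_zero.
by apply: (congr1 (fun K => D_ml a l K 0)); apply/funext => x; rewrite addr0.
Qed.

Lemma D_ml_ev (q : mpoly p.+1 R[i]) : D_ml a l (ev q) 0 =
  \sum_(lf : lf_type | (\sum_j lf j)%N == l)
    (mcoeff (mjoin (ytuple lf) a) q * (a`!)%:R) *: indhomog l (mpolyX R[i] (ytuple lf)).
Proof.
rewrite (D_ml_jet (csmooth_ev q) (ltnSn (a + l))); apply: eq_bigr => lf /eqP lfl.
rewrite mcoeff_jet ?iterDC_mdirs_ev ?mulfK ?mfact_neq0//.
rewrite ltnS mdegE big_ord_recr /= mjoin_max addnC leq_add2l -[X in (_ <= X)%N]lfl.
by apply/eq_leq/eq_bigr => j _; rewrite -lift_max_widen mjoin_lift ytupleE.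
Qed.

Lemma mcoeff_mixed q a' (m : multinom p) :
  mcoeff (mjoin m a) (mixed q a') = if a' == a then mcoeff m q else 0.
Proof.
rewrite [q in LHS]mpolyE (_ : mixed _ a' = \sum_(m' <- msupp q) mcoeff m' q *: mpolyX R[i] (mjoin m' a')).
  rewrite raddf_sum /= [q in RHS]mpolyE; case: eqP => [->|aa'].
    rewrite raddf_sum /=; apply: eq_bigr => m' _; rewrite !mcoeffZ !mcoeffX; congr (_ * (_ : bool)%:R).
    apply/eqP/eqP => [E|-> //]; apply/mnmP => j.
    by rewrite -(mjoin_lift m' a j) E mjoin_lift.
  rewrite big1// => m' _; rewrite mcoeffZ mcoeffX; case: eqP => [E|_]; last by rewrite mulr0.
  by case: aa'; rewrite -(mjoin_max m' a') E mjoin_max.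
have mix0 : mixed (0 : mpoly p R[i]) a' = 0.
  by have := @mixed_is_linear R p a' (-1) 0 0; rewrite scaler0 addr0 scaleN1r addNr.
elim: (msupp q) => [|m' s ih]; first by rewrite !big_nil.
by rewrite !big_cons mixed_is_linear ih mixedX.
Qed.

(** At the origin D_(a, l) is, up to a!, the projection of polynomials to their component of
    bidegree (l, a). *)
Lemma D_ml_mixed l' q a' : q \is ishomog1 l' mdeg ->
  val (D_ml a l (ev (mixed q a')) 0) = if (a' == a) && (l' == l) then (a`!)%:R *: q else 0.
Proof.
move=> /dhomogP qH; rewrite D_ml_ev raddf_sum /=; apply/mpolyP => m; rewrite raddf_sum /=.
have term (lf : lf_type) : (\sum_j lf j)%N == l ->
    mcoeff m (val ((mcoeff (mjoin (ytuple lf) a) (mixed q a') * (a`!)%:R) *: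
      indhomog l (mpolyX R[i] (ytuple lf)))) =
    if (a' == a) && (ytuple lf == m) then mcoeff m q * (a`!)%:R else 0.
  move=> /eqP lfl; rewrite /= mcoeffZ -[mpoly_of_dhomog _]/(val _) val_indhomog; last first.
    by rewrite dhomogX; apply/eqP; rewrite /= mdegE -[RHS]lfl; apply: eq_bigr => j _; rewrite ytupleE.
  rewrite mcoeffX mcoeff_mixed; case: (a' == a); last by rewrite !mul0r.
  by case: eqP => [->|_] /=; rewrite ?mulr1 ?mulr0.
under eq_bigr => lf lfl do rewrite (term lf lfl).
case: (a' =P a) => [_|_] /=; last by rewrite big1 ?mcoeff0.
case: (eqVneq (mdeg m) l) => [ml|ml]; last first.
  rewrite big1 => [|lf /eqP lfl]; last first.
    case: eqP => // E; case/eqP: ml; rewrite -E -[RHS]lfl mdegE.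
    by apply: eq_bigr => j _; rewrite ytupleE.
  case: (l' =P l) => [l'l|_]; last by rewrite mcoeff0.
  rewrite mcoeffZ (_ : mcoeff m q = 0) ?mulr0//; apply/eqP; rewrite -[_ == 0]negbK -mcoeff_msupp.
  by apply/negP => /qH /= ml'; rewrite -ml' in l'l; rewrite l'l eqxx in ml.
pose lf0 : lf_type := [ffun j => inord (m j)].
have lf0E j : lf0 j = m j :> nat.
  rewrite ffunE inordK// ltnS; apply: leq_trans (_ : mdeg m <= l)%N; last by rewrite ml.
  by rewrite mdegE (bigD1 j)//=; exact: leq_addr.
have yE : ytuple lf0 = m by apply/mnmP => j; rewrite ytupleE lf0E.
have lf0l : (\sum_j lf0 j)%N == l.
  by apply/eqP; transitivity (mdeg m) => //; rewrite mdegE; apply: eq_bigr => j _; rewrite lf0E.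
rewrite (bigD1 lf0 lf0l) /= yE eqxx big1 ?addr0 => [|lf /andP[lfl ne]]; last first.
  case: eqP => // E; case/eqP: ne; apply/ffunP => j; apply/val_inj.
  by rewrite /= lf0E -E ytupleE.
case: (l' =P l) => [_|l'l]; first by rewrite mcoeffZ mulrC.
rewrite mcoeff0 (_ : mcoeff m q = 0) ?mul0r//; apply/eqP; rewrite -[_ == 0]negbK -mcoeff_msupp.
by apply/negP => /qH /= ml'; apply: l'l; rewrite -ml' ml.
Qed.

Lemma mact_linear (g : 'M[R]_p) (u v : R) (c : R) (x y : 'rV[R]_p.+1) :
  mact g u v (c *: x + y) = c *: mact g u v x + mact g u v y.
Proof.
apply/rowP; elim/ord_max_ind => [|i].
  by rewrite mact_max !mxE !unlift_none; ring.
rewrite !mact_lift [in RHS]mxE [in X in _ = X + _]mxE !mact_lift mulrCA -mulrDr; congr (_ * _).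
by rewrite mulr_sumr -big_split /=; apply: eq_bigr => k _; rewrite !mxE; ring.
Qed.

Lemma poly_rep_is_linear (g : 'M[R]_p) : linear (@poly_rep R p l g).
Proof. by move=> c q r; apply/val_inj; rewrite /= /poly_act linearD linearZ. Qed.

Lemma D_ml_mixed_linsub (g : 'M[R]_p) (c d : R[i]) l' q a' : q \is ishomog1 l' mdeg ->
  (c ^+ l' * d ^+ a') *: D_ml a l (ev (mixed (linsub g q) a')) 0 =
  (c ^+ l * d ^+ a) *: poly_rep (invmx g) (D_ml a l (ev (mixed q a')) 0).
Proof.
move=> qH; have := D_ml_mixed a' (linsub_dhomog g qH); have := D_ml_mixed a' qH.
generalize (D_ml a l (ev (mixed (linsub g q) a')) 0) (D_ml a l (ev (mixed q a')) 0) => A B eB eA.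
have vZ (z : R[i]) (C : dhomog p R[i] l) : val (z *: C) = z *: val C by [].
have vp (C : dhomog p R[i] l) : val (poly_rep (invmx g) C) = linsub g (val C).
  by rewrite /= poly_act_linsub invmxK.
apply/val_inj; rewrite !vZ vp eA eB.
case: (a' =P a) => [->|_] /=; last by rewrite /linsub comp_mpoly0 !scaler0.
case: (l' =P l) => [->|_]; last by rewrite /linsub comp_mpoly0 !scaler0.
by rewrite /linsub comp_mpolyZ.
Qed.

(** Both sides depend only on the Taylor polynomial of H up to degree a + l, because [mact] is
    linear and preserves flatness at 0; monomials are covered by [D_ml_mixed_linsub]. *)
Lemma D_ml_mact (g : 'M[R]_p) (u v : R) H : csmooth setT H ->
  D_ml a l (fun x => H (mact g u v x)) 0 =
  (u%:C ^+ l * v%:C ^+ a) *: poly_rep (invmx g) (D_ml a l H 0).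
Proof.
move=> sH; set N := (a + l).+1; set q := jet N H.
have oT : open [set: 'rV[R]_p.+1] by exact: openT.
have sE := csmooth_ev q.
have sK : csmooth setT (fun x => H x + (-1) * ev q x) by exact: (csmoothD oT sH (csmoothZ _ oT sE)).
have fK : cflat N (fun x => H x + (-1) * ev q x) by exact: cflat_jet.
have ev0 x : ev (0 : mpoly p.+1 R[i]) x = 0 by rewrite /ev meval0.
have mact0 : mact g u v 0 = 0.
  by have := mact_linear g u v (-1) 0 0; rewrite scaler0 addr0 scaleN1r addNr.
have HE : H = fun x => 1 * (H x + (-1) * ev q x) + ev q x.
  by apply/funext => x; rewrite mul1r mulN1r subrK.
have fKm : cflat N (fun x => H (mact g u v x) + (-1) * ev q (mact g u v x)).
  move=> w wN; rewrite (iterDC_affine (fun x => H x + (-1) * ev q x) _ _ (mact_linear g u v)).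
  by rewrite mact0; apply: fK; rewrite size_map.
have -> : D_ml a l H 0 = D_ml a l (ev q) 0.
  have := D_ml_lin a l 1 0 sK sE; rewrite -HE (D_ml_flat fK) scaler0 add0r.
  exact.
have -> : D_ml a l (fun x => H (mact g u v x)) 0 = D_ml a l (fun x => ev q (mact g u v x)) 0.
  have HEm : (fun x => H (mact g u v x)) =
      fun x => 1 * (H (mact g u v x) + (-1) * ev q (mact g u v x)) + ev q (mact g u v x).
    by apply/funext => x; rewrite mul1r mulN1r subrK.
  have := D_ml_lin a l 1 0 (csmooth_mact g u v sK) (csmooth_mact g u v sE).
  rewrite -HEm (D_ml_flat fKm) scaler0 add0r.
  exact.
elim/mpolyind: q {HE sE sK fK fKm} => [|c m q _ _ ih].
  have z0 : ev (0 : mpoly p.+1 R[i]) = fun=> 0 by exact/funext.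
  rewrite z0 D_ml_flat; last by move=> w _; rewrite /iterDC /= !iterD_zero.
  by have := poly_rep_is_linear (invmx g) (-1) 0 0; rewrite scaler0 addr0 scaleN1r addNr => ->; rewrite scaler0.
have sX := csmooth_ev (mpolyX R[i] m); have sq := csmooth_ev q.
have eE : ev (c *: mpolyX R[i] m + q) = fun x => c * ev (mpolyX R[i] m) x + ev q x.
  by apply/funext => x; rewrite /ev mevalD mevalZ.
rewrite eE (D_ml_lin a l c 0 (csmooth_mact g u v sX) (csmooth_mact g u v sq)).
rewrite (D_ml_lin a l c 0 sX sq) poly_rep_is_linear ih scalerDr; congr (_ + _).
rewrite [RHS]scalerA [X in X *: poly_rep _ _]mulrC -scalerA; congr (_ *: _).
rewrite -(mjoin_head m) -mixedX.
set a' := m ord_max; set m' := mhead m.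
have mH : mpolyX R[i] m' \is ishomog1 (mdeg m') mdeg by rewrite dhomogX.
have -> : (fun x => ev (mixed (mpolyX R[i] m') a') (mact g u v x)) =
    fun x => (u%:C ^+ mdeg m' * v%:C ^+ a') * ev (mixed (linsub g (mpolyX R[i] m')) a') x + ev 0 x.
  by apply/funext => x; rewrite [LHS](mixed_mact g u v a' x mH) ev0 addr0.
have z0 : D_ml a l (ev (0 : mpoly p.+1 R[i])) 0 = 0.
  have -> : ev (0 : mpoly p.+1 R[i]) = fun=> 0 by exact/funext.
  by rewrite D_ml_flat// => w _; rewrite /iterDC /= !iterD_zero.
rewrite (D_ml_lin a l _ 0 (csmooth_ev _) (csmooth_ev _)) z0 addr0.
exact: D_ml_mixed_linsub mH.
Qed.

End DmlAction.

(** * Membership in Diff(I, J) *)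

Section DopDiff.
Variables (R : realType) (p : nat).
Hypothesis p_gt0 : (0 < p)%N.
Variables (alpha beta : bool) (lambda nu : R[i]) (W : vectType R[i]) (a l : nat).
Variable varpi : 'M[R]_p -> W -> W.
Variable Phi : {linear dhomog p R[i] l -> W}.
Local Notation I := (@I_triv R p.+1 alpha lambda).
Local Notation J := (J_rep varpi nu beta).
Local Notation Dop := (Dop a Phi).
Hypothesis l_lambda : l = 0%N \/ lambda = 1 - (a + l)%:R.
Hypothesis nuE : nu = lambda + (a + l)%:R + l%:R / p%:R.
Hypothesis betaE : beta = alpha (+) odd (a + l).
Hypothesis PhiE : forall g, SLpm p g -> forall q, Phi (poly_rep g q) = varpi g (Phi q).
Implicit Types (f : 'M[R]_p.+2 -> R[i]^o) (m : 'M[R]_p).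

(** The exponents of exp (- t) are lambda from [hfac] and (a + l) + l / p from the change of
    variables, in total nu; those of the determinant are alpha and a + l, in total beta modulo 2. *)
Lemma Dop_levi1 f m t : I f -> SLpm p m ->
  Dop f (p_elt m t 0) =
  cexp (- (nu * t%:C)) *: ((\det m)%:C ^+ beta *: varpi (invmx m) (Dop f 1%:M)).
Proof.
move=> If mS; have pS : SL p.+1 (p_elt m t 0) by exact: det_p_elt.
rewrite (Dop_SL _ _ _ pS) (Dop_SL _ _ _ (SL1 R _)).
pose H y : R[i] := f (nminus y).
have -> : (fun y => f (diag_last1 1%:M *m nminus y)) = H.
  by apply/funext => y; rewrite diag_last1_1 mul1mx.
have sH : csmooth setT H := csmooth_section1 If.
set s := ((\det m)^-1 * expR t)^-1.
set u := expR (- (t / p%:R)) * s.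
have -> : (fun y => f (diag_last1 (p_elt m t 0) *m nminus y)) =
    fun y => hfac alpha lambda ((\det m)^-1 * expR t) * H (mact m u s y).
  apply/funext => y.
  have S0 : \sum_j (0 : 'rV[R]_p) 0 j * y 0 (lift ord_max j) = 0.
    by apply: big1 => j _; rewrite mxE mul0r.
  have := @section_p_elt R p p_gt0 alpha lambda f m t 0 y If mS.
  by rewrite S0 addr0 mulr1 oner_neq0 => ->.
rewrite (D_mlZ a l _ (csmooth_mact m u s sH)) (D_ml_mact a l m u s sH).
rewrite scalerA linearZ /= (PhiE (SLpmV mS)) !scalerA.
congr (_ *: _); rewrite (hfac_p_elt _ _ _ mS).
have sgE : Num.sg (\det m) = \det m by case: mS => ->; rewrite ?sgrN sgr1.
have dV : (\det m)^-1 = \det m by case: mS => ->; rewrite ?invrN1 ?invr1.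
have sE : s = expR (- t) * \det m by rewrite /s dV invfM dV expRN mulrC.
rewrite sgE /u sE.
have -> : (expR (- (t / p%:R)) * (expR (- t) * \det m))%:C ^+ l * (expR (- t) * \det m)%:C ^+ a =
    cexp (l%:R * (- (t / p%:R))%:C) * cexp ((a + l)%:R * (- t)%:C) * (\det m)%:C ^+ (a + l).
  rewrite !cexp_natr !rmorphM !exprMn !exprD; ring.
rewrite mulrACA -!cexpD; congr (cexp _ * _).
  have pn : p%:R != 0 :> R[i] by rewrite pnatr_eq0 -lt0n.
  by rewrite nuE !rmorphN rmorphM fmorphV rmorph_nat; field.
rewrite betaE; case: mS => ->; first by rewrite rmorph1 !expr1n mulr1.
rewrite rmorphN rmorph1 -exprD -[LHS]signr_odd -[RHS]signr_odd; congr (_ ^+ _).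
by rewrite !oddD !oddb; case: alpha (odd a) (odd l) => [] [] [].
Qed.

Lemma Dop_J f : I f -> J (Dop f).
Proof.
move=> If; split; [by move=> g gS; exact: Dop_offSL|exact: (Dop_smooth _ _ If)|].
move=> g gS m t x mS; have If' := ltrans_Ind (SL_diag_last1 gS) If.
pose f' k := f (diag_last1 g *m k); rewrite -/f' in If'.
rewrite -/(p_elt m t x) -(Dop_translate _ _ _ _ gS) -[in RHS](mulmx1 g) -(Dop_translate _ _ _ _ gS).
rewrite -/f'.
(* Splitting off the N'_+ factor reduces the covariance to [Dop_nplus1] and [Dop_levi1]. *)
have pE : p_elt m t x = p_elt m t 0 *m nplus x.
  rewrite {2}/p_elt; have -> : nplus (0 : 'rV[R]_p) = 1%:M.
    by rewrite -p_elt_nplus// p_eltE// det1 invr1 expR0 mulr1 mul0r oppr0 expR0 scaler0 scale1r -scalar_mx_block.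
  by rewrite mulmx1.
have pS : SL p.+1 (p_elt m t 0) by exact: det_p_elt.
have If'' := ltrans_Ind (SL_diag_last1 pS) If'.
have e1 := Dop_translate a Phi f' (nplus x) pS; have e3 := Dop_translate a Phi f' 1%:M pS.
have e2 := Dop_nplus1 p_gt0 Phi l_lambda x If''.
rewrite pE -[LHS]e1 [LHS]e2 [LHS]e3 mulmx1 (Dop_levi1 _ If' mS).
by rewrite /sgn_twist det_inv sgrV; case: mS => ->; rewrite ?sgrN sgr1.
Qed.

Lemma Dop_Diff : Diff I J Dop.
Proof.
split; first exact: Dop_J.
- by move=> c f f' If If'; exact: (Dop_lin _ _ _ If If').
- exact: Dop_continuous.
- by move=> f If g gS; exact: (Dop_supp If gS).
- by move=> f _ h hS; exact: Dop_equivariant.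
Qed.

End DopDiff.

(** * The trivial representation as poly^0 *)

Section DegreeZero.
Variables (R : realType) (p : nat) (W : vectType R[i]).
Variable varpi : 'M[R]_p -> W -> W.

Definition dhomog_one : dhomog p R[i] 0 := DHomog (dhomog1 _ _).

Lemma dhomog0E (q : dhomog p R[i] 0) : q = mcoeff (@mnm0 p) (val q) *: dhomog_one.
Proof.
apply/val_inj/mpolyP => m; rewrite /= mcoeffZ mcoeff1.
case: (eqVneq m (@mnm0 p)) => [->|m0]; first by rewrite mulr1.
rewrite mulr0; apply/eqP; rewrite -[_ == 0]negbK -mcoeff_msupp; apply/negP => mS.
have /dhomogP/(_ m mS)/= := dhomog_is_dhomog q.
by move/eqP; rewrite mdeg_eq0 (negbTE m0).
Qed.

Lemma poly_rep0 g (q : dhomog p R[i] 0) : poly_rep g q = q.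
Proof.
have e := congr1 val (dhomog0E q); apply/val_inj; rewrite /= poly_act_linsub /linsub.
by rewrite -[mpoly_of_dhomog q]/(val q) e /= comp_mpolyZ comp_mpoly1.
Qed.

(** Makes the first family the case l = 0 of the common treatment. *)
Lemma poly0_of_triv (phi : {linear R[i]^o -> W}) :
  rep_equiv (SL p) (@triv_rep R p) varpi phi ->
  exists Phi : {linear dhomog p R[i] 0 -> W},
    rep_equiv (SL p) (@poly_rep R p 0) varpi Phi /\
    forall q, Phi q = phi (mcoeff (@mnm0 p) (val q)).
Proof.
move=> [[g gK Kg] phiE].
have [Phi PE] : exists Phi : {linear dhomog p R[i] 0 -> W},
    Phi =1 (fun q => phi (mcoeff (@mnm0 p) (val q) : R[i]^o)).
  apply: linear_packed => c q r; rewrite /= mcoeffD mcoeffZ.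
  by rewrite -[c * _ + _]/(c *: (_ : R[i]^o) + _) linearP.
exists Phi; split=> //; split=> [|h hS q]; last by rewrite poly_rep0 PE -(phiE h hS).
exists (fun w => g w *: dhomog_one) => [q|w]; first by rewrite PE gK -dhomog0E.
rewrite PE /= mcoeffZ mcoeff1 eqxx mulr1; exact: Kg.
Qed.

Lemma triv_of_poly0 (Phi : {linear dhomog p R[i] 0 -> W}) :
  rep_equiv (SL p) (@poly_rep R p 0) varpi Phi ->
  exists phi : {linear R[i]^o -> W}, rep_equiv (SL p) (@triv_rep R p) varpi phi.
Proof.
move=> [[g gK Kg] PhiE].
have [phi pE] : exists phi : {linear R[i]^o -> W}, phi =1 (fun z => Phi (z *: dhomog_one)).
  apply: linear_packed => c z z'; rewrite scalerDl -linearP; congr (Phi (_ + _)).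
  by rewrite -[c *: z]/(c * z) scalerA.
exists phi; split=> [|h hS z]; last by rewrite /triv_rep pE -(PhiE h hS) poly_rep0.
exists (fun w => mcoeff (@mnm0 p) (val (g w))) => [z|w]; last by rewrite pE -dhomog0E Kg.
by rewrite pE gK /= mcoeffZ mcoeff1 eqxx mulr1.
Qed.

Lemma D_ml0 m H x : mcoeff (@mnm0 p) (val (D_ml m 0 H x)) = D_m0 m H x :> R[i].
Proof.
rewrite D_mlE.
pose lf0 : {ffun 'I_p -> 'I_1} := [ffun=> ord0].
have lfE (lf : {ffun 'I_p -> 'I_1}) : lf = lf0.
  by apply/ffunP => j; rewrite ffunE; apply/val_inj; case: (lf j) => -[].
have l0 : (\sum_j lf0 j)%N == 0%N by rewrite big1// => j _; rewrite ffunE.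
rewrite (bigD1 lf0 l0) /= big1 ?addr0 => [|lf /andP[_]]; last by rewrite (lfE lf) eqxx.
have y1 : @ytilde R p (fun j => lf0 j) = 1.
  rewrite /ytilde !big1 ?invr1 ?scale1r// => j _; rewrite ffunE//.
rewrite /= mcoeffZ y1 -[mpoly_of_dhomog _]/(val _) val_indhomog ?dhomog1// mcoeff1 eqxx mulr1.
rewrite /D_ml_dirs (_ : dirs_x' _ _ = [::]) ?cats0//.
rewrite /dirs_x' (eq_map (g := fun=> [::])) => [|j]; last by rewrite ffunE.
by elim: (enum 'I_p).
Qed.

End DegreeZero.

(** * Dimension one, resp. zero *)

Section Lines.
Variables (R : realType) (p' : nat).
Local Notation p := p'.+1.
Hypothesis p_gt1 : (1 < p)%N.
Variables (alpha beta : bool) (lambda nu : R[i]) (W : vectType R[i]).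
Variable varpi : 'M[R]_p -> W -> W.
Hypothesis varpi_ext : irr_ext varpi.
Local Notation I := (@I_triv R p.+1 alpha lambda).
Local Notation J := (J_rep varpi nu beta).

(** Every clause of [Diff] evaluates the operator on sections in I only. *)
Lemma Diff_ext D D' : (forall f, I f -> D f = D' f) -> Diff I J D' -> Diff I J D.
Proof.
move=> DE [D1 D2 D3 D4 D5]; split.
- by move=> f If; rewrite DE//; exact: D1.
- by move=> c f h If Ih; rewrite !DE ?D2//; exact: I_add.
- move=> s' e e0; have [N [s [d [d0 H]]]] := D3 s' e e0.
  by exists N, s, d; split=> // f If small; rewrite DE//; exact: H.
- by move=> f If g gS; rewrite DE//; exact: D4.
move=> f If h hS; rewrite !DE ?D5//.
have dS := SL_diag_last1 hS; exact: (ltrans_Ind (SLV dS) If).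
Qed.

Lemma varpi_linear g : SLpm p g -> linear (varpi g).
Proof. by move=> gS; have [[L _ _ _] _ _ _] := varpi_ext; exact: L. Qed.

Lemma varpi0 g : SLpm p g -> varpi g 0 = 0.
Proof.
by move=> /varpi_linear L; have := L (-1) 0 0; rewrite scaler0 addr0 scaleN1r addNr.
Qed.

Lemma Diff_zero D : (forall f, I f -> forall g, D f g = 0) -> Diff I J D.
Proof.
move=> D0; apply: (@Diff_ext _ (fun _ _ => 0)) => [f If|]; first exact/funext/D0.
split=> //.
- move=> f If; split=> // [g gS|g gS m t x mS].
    exists setT, (fun=> 0); split=> //; first exact: openT.
    move=> psi; rewrite (_ : (fun _ => _) = fun=> 0); first exact: (smooth_cst 0 openT).
    by apply/funext => y; rewrite linear0.
  by rewrite /sgn_twist varpi0 ?scaler0//; exact: SLpmV.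
- by move=> c f h _ _; apply/funext => g; rewrite scaler0 addr0.
(* The zero operator is controlled by an empty list of seminorms. *)
- move=> s' e e0; exists 0%N, (fun i : 'I_0 => False_rect _ (notF (ltn_ord i))), 1.
  split=> // f If _ x _; rewrite (_ : (fun _ => _) = fun=> 0).
    by rewrite iterD_zero normr0.
  by apply/funext => y; rewrite linear0.
- move=> f If g gS; rewrite /supp (_ : [set _ | _] = set0) ?closure0//.
  by apply/seteqP; split=> // h /=; rewrite eqxx.
Qed.

Lemma Diff_line a l (Phi : {linear dhomog p R[i] l -> W}) :
  rep_equiv (SL p) (@poly_rep R p l) varpi Phi ->
  beta = alpha (+) odd (a + l) -> l = 0%N \/ lambda = 1 - (a + l)%:R ->
  nu = lambda + (a + l)%:R + l%:R / p%:R ->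
  Diff_is_line I J (fun H x => Phi (D_ml a l H x)).
Proof.
move=> PE bE lE nE; exists (Dop a Phi); split=> [f _ x|D]; first exact: Dop_nminus.
have [varpi_rep varpi_irr _ extE] := varpi_ext.
split=> [DD|[c DE]]; last first.
  (* A multiple of the operator is the operator attached to the same multiple of [Phi], so
     [Dop_Diff] covers it, c = 0 included. *)
  have [cPhi cE] : exists cPhi : {linear dhomog p R[i] l -> W}, cPhi =1 (fun q => c *: Phi q).
    apply: linear_packed => k q r; rewrite linearP scalerDr !scalerA; congr (_ + _).
    by rewrite mulrC.
  apply: (@Diff_ext _ (Dop a cPhi)).
    move=> f If; apply/funext => g; rewrite DE// /Dop.
    by case: ifP => _; rewrite ?cE ?scaler0.
  apply: Dop_Diff => // g gS q; rewrite !cE.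
  have [_ ->//] := extE l Phi PE.
  have := varpi_linear gS c (Phi q) 0; rewrite varpi0// !addr0 => ->.
  by [].
have [D0|[a' [l' [Phi' [PE' _ _ nE' [c' DE]]]]]] := diff_classify p_gt1 varpi_ext DD.
  by exists 0 => f If g; rewrite D0// scale0r.
have ll' : l' = l := poly_rep_degree p_gt1 PE' PE.
subst l'.
have aa' : a' = a.
  by move: nE'; rewrite nE => /addIr/addrI/eqP; rewrite eqr_nat eqn_add2r => /eqP ->.
subst a'.
have [c cE] := rep_equiv_scalar varpi_rep varpi_irr PE' PE.
exists (c' * c) => f If g; case: (pselect (SL p.+1 g)) => gS; last first.
  by rewrite (op_offSL DD If gS) Dop_offSL// scaler0.
by rewrite DE// Dop_SL// cE scalerA.
Qed.

Lemma classification_nonzero D : Diff I J D ->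
  (forall m phi, ~ Lambda1 varpi alpha beta lambda nu m phi) ->
  (forall m l phi, ~ @Lambda2 R p W varpi alpha beta lambda nu m l phi) ->
  forall f, I f -> forall g, D f g = 0.
Proof.
move=> DD N1 N2.
have [//|[a [l [Phi [PE bE lE nE _]]]]] := diff_classify p_gt1 varpi_ext DD.
(* Degree 0 leaves lambda free and falls under [Lambda1]; positive degree fixes lambda and falls
   under [Lambda2]. *)
case: l Phi PE bE lE nE => [|l] Phi PE bE lE nE.
  have [phi phiE] := triv_of_poly0 PE.
  by case: (N1 a phi); split=> //; [rewrite bE addn0|rewrite nE addn0 mul0r addr0].
case: lE => // lE; case: (N2 a l.+1 Phi); split=> //.
by rewrite nE lE subrK.
Qed.

End Lines.

Theorem theorem4p15 (R : realType) (n : nat) (W : vectType R[i])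
    (alpha beta : bool) (varpi : 'M[R]_n.-1 -> W -> W) (lambda nu : R[i]) :
  (3 <= n)%N ->
  irr_ext varpi ->
  let I := @I_triv R n.-1.+1 alpha lambda in
  let J := J_rep varpi nu beta in
  [/\ forall m phi, Lambda1 varpi alpha beta lambda nu m phi ->
        Diff_is_line I J (fun f x' => phi (D_m0 m f x')),
      forall m ell phi, @Lambda2 R n.-1 W varpi alpha beta lambda nu m ell phi ->
        Diff_is_line I J (fun f x' => phi (D_ml m ell f x'))
    & (forall m phi, ~ Lambda1 varpi alpha beta lambda nu m phi) ->
      (forall m ell phi,
        ~ @Lambda2 R n.-1 W varpi alpha beta lambda nu m ell phi) ->
      Diff_is_zero I J].
Proof.
case: n varpi => [|[|p']] //= varpi n3 ext.
have p_gt1 : (1 < p'.+1)%N by [].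
split.
- move=> m phi [bE PE nE]; have [Phi [PE' PhiE]] := poly0_of_triv PE.
  have -> : (fun f x' => phi (D_m0 m f x')) = fun f x' => Phi (D_ml m 0 f x').
    by apply/funext => f; apply/funext => x; rewrite PhiE D_ml0.
  by apply: Diff_line => //; rewrite ?addn0 ?mul0r ?addr0//; left.
(* With lambda = 1 - (m + l), the common formula for nu becomes 1 + l / p. *)
- move=> m l phi [bE PE lE nE]; apply: Diff_line => //; first by right.
  by rewrite nE lE subrK.
move=> N1 N2 D; split=> [DD|]; last exact: Diff_zero.
exact: (classification_nonzero p_gt1 ext DD N1 N2).
Qed.
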